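(* Let $A$ be a ring and $I\subseteq A$ an ideal generated by a Koszul-regular sequence. Then the animated PD-envelope of $(A,I)$ coincides with the classical PD-envelope.
   Context: A finite sequence is Koszul-regular if its Koszul complex has vanishing homology in positive degrees. For a small category $\mathcal{C}$ with finite coproducts, $\mathcal{P}_\Sigma(\mathcal{C})\subseteq\operatorname{Fun}(\mathcal{C}^{\mathrm{op}},\operatorname{An})$ is the full subcategory of finite-product-preserving functors; a functor from $\mathcal{C}$ to an $\infty$-category with filtered colimits and geometric realizations extends essentially uniquely to its left derived functor on $\mathcal{P}_\Sigma(\mathcal{C})$, preserving filtered colimits and geometric realizations. Animated pairs: $\operatorname{Pair}^{\mathrm{an}}=\mathcal{P}_\Sigma(\operatorname{Pair}^{\mathrm{st}})$ with $\operatorname{Pair}^{\mathrm{st}}$ the category of ring-ideal pairs $(\mathbb{Z}[X,Y],(Y))$, $X,Y$ finite sets of variables; this is equivalent to the $\infty$-category of surjections of animated rings, and a ring-ideal pair $(A,I)$ is regarded as $A\twoheadrightarrow A/I$. Animated PD-pairs: $\operatorname{Pair}^{\gamma,\mathrm{an}}=\mathcal{P}_\Sigma(\operatorname{Pair}^{\gamma,\mathrm{st}})$ with $\operatorname{Pair}^{\gamma,\mathrm{st}}$ the category of PD-pairs $\Gamma_{\mathbb{Z}[X]}(Y)\twoheadrightarrow\mathbb{Z}[X]$, the PD-envelopes of the $(\mathbb{Z}[X,Y],(Y))$. The category of classical PD-pairs embeds fully faithfully in $\operatorname{Pair}^{\gamma,\mathrm{an}}$ via the restricted Yoneda functor. The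 animated PD-envelope functor $\operatorname{Pair}^{\mathrm{an}}\to\operatorname{Pair}^{\gamma,\mathrm{an}}$ is the left derived functor of the classical PD-envelope on $\operatorname{Pair}^{\mathrm{st}}$; it is left adjoint to the forgetful functor. The classical PD-envelope is the left adjoint of the forgetful functor from PD-pairs to ring-ideal pairs. *)

(* Defs.v *)
From HB Require Import structures.
From mathcomp Require Import all_boot all_order all_algebra.
From mathcomp Require Import boolp.
From mathcomp Require Import finmap.
From mathcomp.multinomials Require Import monalg.

Set Implicit Arguments.
Unset Strict Implicit.
Unset Printing Implicit Defensive.

Import GRing.Theory.
Local Open Scope ring_scope.

(* -------------------------------------------------------------------------- *)
(* Categories                                                                 *)
(* -------------------------------------------------------------------------- *)

Record category := Category {
  obj :> Type;
  hom : obj -> obj -> Type;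
  idc : forall a, hom a a;
  compose : forall a b c, hom b c -> hom a b -> hom a c;
  compA : forall a b c d (h : hom c d) (g : hom b c) (f : hom a b),
    compose h (compose g f) = compose (compose h g) f;
  comp1c : forall a b (f : hom a b), compose (idc b) f = f;
  compc1 : forall a b (f : hom a b), compose f (idc a) = f }.

Arguments hom {_} _ _.
Arguments idc {_} a.
Arguments compose {_ _ _ _}.

Definition isomorphic (C : category) (a b : C) : Prop :=
  exists (f : hom a b) (g : hom b a),
    compose g f = idc a /\ compose f g = idc b.

Definition opposite (C : category) : category :=
  @Category C (fun a b => hom b a) (fun a => idc a)
    (fun a b c g f => compose f g)
    (fun a b c d h g f => esym (compA f g h))
    (fun a b f => compc1 f) (fun a b f => comp1c f).

Definition set_cat : category :=
  @Category Type (fun S T => S -> T) (fun S => id) (fun R S T g f => g \o f)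
    (fun _ _ _ _ _ _ _ => erefl) (fun _ _ _ => erefl) (fun _ _ _ => erefl).

Record functor (C D : category) := Functor {
  fobj :> C -> D;
  fmap : forall a b : C, hom a b -> hom (fobj a) (fobj b);
  fmap1 : forall a, fmap (idc a) = idc (fobj a);
  fmapM : forall (a b c : C) (g : hom b c) (f : hom a b),
    fmap (compose g f) = compose (fmap g) (fmap f) }.

Arguments fmap {_ _} _ {_ _}.

Definition const_functor (C D : category) (d : D) : functor C D :=
  @Functor C D (fun _ => d) (fun _ _ _ => idc d) (fun _ => erefl)
    (fun _ _ _ _ _ => esym (comp1c (idc d))).

Lemma comp_functor1 (C D E : category) (G : functor D E) (F : functor C D)
  (a : C) : fmap G (fmap F (idc a)) = idc (G (F a)).
Proof. by rewrite !fmap1. Qed.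

Lemma comp_functorM (C D E : category) (G : functor D E) (F : functor C D)
  (a b c : C) (g : hom b c) (f : hom a b) :
  fmap G (fmap F (compose g f))
  = compose (fmap G (fmap F g)) (fmap G (fmap F f)).
Proof. by rewrite !fmapM. Qed.

Definition comp_functor (C D E : category) (G : functor D E)
    (F : functor C D) : functor C E :=
  @Functor C E (fun a => G (F a)) (fun _ _ f => fmap G (fmap F f))
    (comp_functor1 G F) (comp_functorM G F).

Definition hom_functor (C : category) (c : C) : functor C set_cat :=
  @Functor C set_cat (fun d => hom c d) (fun _ _ g f => compose g f)
    (fun a => funext (fun f => comp1c f))
    (fun _ _ _ g f => funext (fun h => esym (compA g f h))).

Record nat_trans (C D : category) (F G : functor C D) := NatTrans {
  ncomp :> forall a, hom (F a) (G a);
  ncompP : forall (a b : C) (f : hom a b),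
    compose (ncomp b) (fmap F f) = compose (fmap G f) (ncomp a) }.

Lemma whiskerP (C D E : category) (H : functor D E) (F G : functor C D)
  (u : nat_trans F G) (a b : C) (f : hom a b) :
  compose (fmap H (u b)) (fmap H (fmap F f))
  = compose (fmap H (fmap G f)) (fmap H (u a)).
Proof. by rewrite -!fmapM ncompP. Qed.

Definition whisker (C D E : category) (H : functor D E) (F G : functor C D)
    (u : nat_trans F G) : nat_trans (comp_functor H F) (comp_functor H G) :=
  @NatTrans C E (comp_functor H F) (comp_functor H G)
    (fun a => fmap H (u a)) (whiskerP H u).

Record left_adjoint (C D : category) (L : functor C D) (U : functor D C) :=
  LeftAdjoint {
    unit_at : forall c, hom c (U (L c));
    unit_nat : forall (c c' : C) (f : hom c c'),
      compose (unit_at c') f = compose (fmap U (fmap L f)) (unit_at c);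
    unit_univ : forall (c : C) (d : D) (g : hom c (U d)),
      exists! h : hom (L c) d, compose (fmap U h) (unit_at c) = g }.

(* -------------------------------------------------------------------------- *)
(* Simplicial objects                                                         *)
(* -------------------------------------------------------------------------- *)

(* The object n of the simplex category is the ordinal {0 < ... < n}. *)
Definition monotone m n (f : {ffun 'I_m.+1 -> 'I_n.+1}) : bool :=
  [forall i : 'I_m.+1, forall j : 'I_m.+1, (i <= j)%N ==> (f i <= f j)%N].

Definition simplex_hom m n := {f : {ffun 'I_m.+1 -> 'I_n.+1} | monotone f}.

Lemma monotone_id n : monotone [ffun i : 'I_n.+1 => i].
Proof. by apply/forallP => i; apply/forallP => j; rewrite !ffunE implybb. Qed.

Lemma monotone_comp m n p (g : simplex_hom n p) (f : simplex_hom m n) :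
  monotone [ffun i => val g (val f i)].
Proof.
apply/forallP => i; apply/forallP => j; apply/implyP => le_ij; rewrite !ffunE.
have /forallP/(_ i)/forallP/(_ j)/implyP/(_ le_ij) le_f := valP f.
by have /forallP/(_ (val f i))/forallP/(_ (val f j))/implyP/(_ le_f) := valP g.
Qed.

Lemma monotone_coface n (i : 'I_n.+2) : monotone [ffun j : 'I_n.+1 => lift i j].
Proof.
apply/forallP => j; apply/forallP => k; rewrite !ffunE /=.
by rewrite leq_bump2 implybb.
Qed.

Lemma monotone_zero n : monotone [ffun j : 'I_n.+1 => ord0 : 'I_1].
Proof. by apply/forallP => j; apply/forallP => k; rewrite !ffunE implybT. Qed.

Definition simplex_id n : simplex_hom n n := Sub _ (monotone_id n).
Definition coface n (i : 'I_n.+2) : simplex_hom n n.+1 :=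
  Sub _ (monotone_coface i).
Definition simplex_zero n : simplex_hom n 0 := Sub _ (monotone_zero n).
Definition simplex_comp m n p (g : simplex_hom n p) (f : simplex_hom m n) :
  simplex_hom m p := Sub _ (monotone_comp g f).

Lemma simplex_compA a b c d (h : simplex_hom c d) (g : simplex_hom b c)
  (f : simplex_hom a b) :
  simplex_comp h (simplex_comp g f) = simplex_comp (simplex_comp h g) f.
Proof. by apply/val_inj/ffunP => i; rewrite !ffunE. Qed.
Lemma simplex_comp1 a b (f : simplex_hom a b) :
  simplex_comp (simplex_id b) f = f.
Proof. by apply/val_inj/ffunP => i; rewrite !ffunE. Qed.
Lemma simplex_comp1r a b (f : simplex_hom a b) :
  simplex_comp f (simplex_id a) = f.
Proof. by apply/val_inj/ffunP => i; rewrite !ffunE. Qed.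

Definition simplex_cat : category :=
  @Category nat simplex_hom simplex_id simplex_comp
    simplex_compA simplex_comp1 simplex_comp1r.

Definition simplicial (C : category) := functor (opposite simplex_cat) C.

Definition sset := simplicial set_cat.

Definition face (X : sset) n (i : 'I_n.+2) : X n.+1 -> X n :=
  @fmap _ _ X n.+1 n (coface i).

(* The degenerate n-simplex at a vertex x. *)
Definition degen (X : sset) (x : X 0%N) n : X n :=
  @fmap _ _ X 0%N n (simplex_zero n) x.

(* Representatives of pi_n(X, x): n-simplices with boundary degenerate at x. *)
Definition sphere (X : sset) (x : X 0%N) n (s : X n) : Prop :=
  forall m (a : simplex_hom m n), (m < n)%N ->
    @fmap _ _ X n m a s = degen x m.

(* The relation defining pi_n(X, x) for a Kan complex X: there is an
   (n+1)-simplex w with d_i w degenerate at x for i < n, d_n w = s and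
   d_(n+1) w = t. *)
Definition sphere_homotopic (X : sset) (x : X 0%N) n (s t : X n) : Prop :=
  exists w : X n.+1, forall i : 'I_n.+2,
    face i w = if (i < n)%N then degen x n else if i == n :> nat then s else t.

(* Bijectivity on pi_0 and on all pi_n(X, x).  For Kan complexes this is the
   notion of weak homotopy equivalence.  It is only used below for simplicial
   sets of the form Hom(c, X) with c = (Z[S,T], (T)) or its PD-envelope; these
   are X(ring)^S * X(ideal)^T, which underlies a simplicial abelian group and
   hence is a Kan complex. *)
Definition weak_equivalence (X Y : sset) (f : nat_trans X Y) : Prop :=
  [/\ forall y : Y 0%N, exists x : X 0%N, sphere_homotopic y (f 0%N x) y,
      forall (x : X 0%N) n (s t : X n), sphere x s -> sphere x t ->
        sphere_homotopic (f 0%N x) (f n s) (f n t) -> sphere_homotopic x s t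
    & forall (x : X 0%N) n (t : Y n), sphere (f 0%N x) t ->
        exists2 s : X n, sphere x s & sphere_homotopic (f 0%N x) (f n s) t].

(* Let std : T -> C enumerate the objects of a full subcategory C0 of C.  Via
   the restricted Yoneda functor, a simplicial object X of C gives the
   simplicial presheaf c |-> Hom(c, X) on C0, which is the geometric realization
   of the presheaves Hom(-, X n) in Fun(C0^op, An); sifted colimits in
   P_Sigma(C0) are computed there.  A map of simplicial objects is an
   equivalence in P_Sigma(C0) when it is one at every object of C0. *)
Definition animated_equivalence (T : Type) (C : category) (std : T -> C)
    (X Y : simplicial C) (u : nat_trans X Y) : Prop :=
  forall t : T, weak_equivalence (whisker (hom_functor (std t)) u).

(* -------------------------------------------------------------------------- *)
(* Ring-ideal pairs                                                           *)
(* -------------------------------------------------------------------------- *)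

(* Rings are comPzRingType, so the zero ring is included, and ideals may be
   improper. *)
Record ideal (A : comPzRingType) := Ideal {
  in_ideal :> A -> Prop;
  ideal0 : in_ideal 0;
  idealD : forall x y, in_ideal x -> in_ideal y -> in_ideal (x + y);
  idealM : forall a x, in_ideal x -> in_ideal (a * x) }.

Definition generated (A : comPzRingType) (S : A -> Prop) (x : A) : Prop :=
  exists n (c s : 'I_n -> A),
    (forall i, S (s i)) /\ x = \sum_(i < n) c i * s i.

Section Span.
Variables (A : comPzRingType) (S : A -> Prop).

Lemma span0 : generated S 0.
Proof.
by exists 0%N, (fun _ => 0), (fun _ => 0); split=> [[]//|]; rewrite big_ord0.
Qed.

Lemma spanD x y : generated S x -> generated S y -> generated S (x + y).
Proof.
move=> [m [c [s [Ss ->]]]] [n [d [t [St ->]]]].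
pose glue (u : 'I_m -> A) (v : 'I_n -> A) (i : 'I_(m + n)) :=
  match split i with inl j => u j | inr k => v k end.
exists (m + n)%N, (glue c d), (glue s t); split=> [i|].
  by rewrite /glue; case: (split i).
rewrite big_split_ord /=; congr (_ + _); apply: eq_bigr => i _; rewrite /glue.
  by rewrite -[lshift n i]/(unsplit (inl i)) unsplitK.
by rewrite -[rshift m i]/(unsplit (inr i)) unsplitK.
Qed.

Lemma spanM a x : generated S x -> generated S (a * x).
Proof.
move=> [n [c [s [Ss ->]]]]; exists n, (fun i => a * c i), s; split=> //.
by rewrite big_distrr /=; apply: eq_bigr => i _; rewrite mulrA.
Qed.

Definition ideal_span : ideal A := Ideal span0 spanD spanM.
End Span.

Record ring_pair := RingPair { pring : comPzRingType; pideal : ideal pring }.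

Record pair_hom (P Q : ring_pair) := PairHom {
  pair_fun :> {rmorphism pring P -> pring Q};
  pair_homP : forall x, pideal P x -> pideal Q (pair_fun x) }.

Lemma rmorphism_ext (A B : pzSemiRingType) (f g : {rmorphism A -> B}) :
  f =1 g -> f = g.
Proof.
case: f g => [f [[f1] [f2]]] [g [[g1] [g2]]] /= /funext fg.
case: _ / fg in g1 g2 *.
by rewrite (Prop_irrelevance f1 g1) (Prop_irrelevance f2 g2).
Qed.

Lemma pair_hom_ext (P Q : ring_pair) (f g : pair_hom P Q) : f =1 g -> f = g.
Proof.
case: f g => [f fP] [g gP] /= /rmorphism_ext fg.
by case: _ / fg in gP *; rewrite (Prop_irrelevance fP gP).
Qed.

Definition pair_id (P : ring_pair) : pair_hom P P :=
  @PairHom P P idfun (fun x Px => Px).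

Definition pair_comp (P Q R : ring_pair) (g : pair_hom Q R)
    (f : pair_hom P Q) :
    pair_hom P R :=
  @PairHom P R (g \o f) (fun x Px => pair_homP g (pair_homP f Px)).

Lemma pair_compA (P Q R S : ring_pair) (h : pair_hom R S) (g : pair_hom Q R)
  (f : pair_hom P Q) :
  pair_comp h (pair_comp g f) = pair_comp (pair_comp h g) f.
Proof. exact: pair_hom_ext. Qed.
Lemma pair_comp1 (P Q : ring_pair) (f : pair_hom P Q) :
  pair_comp (pair_id Q) f = f.
Proof. exact: pair_hom_ext. Qed.
Lemma pair_comp1r (P Q : ring_pair) (f : pair_hom P Q) :
  pair_comp f (pair_id P) = f.
Proof. exact: pair_hom_ext. Qed.

Definition pair_cat : category :=
  @Category ring_pair pair_hom pair_id pair_comp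
    pair_compA pair_comp1 pair_comp1r.

(* (Z[X,Y], (Y)), for arbitrary sets of variables X and Y. *)
Definition poly_var (V : choiceType) (v : V) : {malg int[{cmonom V}]} :=
  mkmalgU (ucm v) 1.

Definition free_pair (X Y : choiceType) : ring_pair :=
  @RingPair {malg int[{cmonom (X + Y)%type}]}
    (ideal_span (fun p => exists y : Y, p = poly_var (inr y : (X + Y)%type))).

(* Pair^st, indexed by the numbers of variables *)
Definition std_pair (mn : nat * nat) : pair_cat := free_pair 'I_mn.1 'I_mn.2.

(* -------------------------------------------------------------------------- *)
(* PD-pairs                                                                   *)
(* -------------------------------------------------------------------------- *)

(* gamma n x is meaningful only for x in the ideal. *)
Record is_pd_structure (A : comPzRingType) (I : ideal A)
    (gamma : nat -> A -> A) : Prop := IsPDStructure {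
  pd0 : forall x, I x -> gamma 0%N x = 1;
  pd1 : forall x, I x -> gamma 1%N x = x;
  pd_ideal : forall n x, I x -> I (gamma n.+1 x);
  pdD : forall n x y, I x -> I y ->
    gamma n (x + y) = \sum_(i < n.+1) gamma i x * gamma (n - i)%N y;
  pdM : forall n a x, I x -> gamma n (a * x) = a ^+ n * gamma n x;
  pd_mul : forall m n x, I x ->
    gamma m x * gamma n x = gamma (m + n)%N x *+ 'C(m + n, m);
  pd_comp : forall m n x, I x ->
    gamma m (gamma n.+1 x)
    = gamma (m * n.+1)%N x *+ ((m * n.+1)`! %/ (m`! * n.+1`! ^ m)) }.

Record pd_pair := PDPair {
  pd_base : ring_pair;
  gamma : nat -> pring pd_base -> pring pd_base;
  gammaP : is_pd_structure (pideal pd_base) gamma }.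

Record pd_hom (D E : pd_pair) := PDHom {
  pd_fun :> pair_hom (pd_base D) (pd_base E);
  pd_homP : forall n x, pideal (pd_base D) x ->
    pd_fun (@gamma D n x) = @gamma E n (pd_fun x) }.

Lemma pd_hom_ext (D E : pd_pair) (f g : pd_hom D E) :
  pd_fun f = pd_fun g -> f = g.
Proof.
case: f g => [f fP] [g gP] /= fg.
by case: _ / fg in gP *; rewrite (Prop_irrelevance fP gP).
Qed.

Definition pd_id (D : pd_pair) : pd_hom D D :=
  @PDHom D D (pair_id _) (fun _ _ _ => erefl).

Lemma pd_comp_subproof (D E F : pd_pair) (g : pd_hom E F) (f : pd_hom D E)
  n x : pideal (pd_base D) x ->
  pair_comp g f (@gamma D n x) = @gamma F n (pair_comp g f x).
Proof.
by move=> Dx /=; rewrite (pd_homP f) // (pd_homP g) //; apply: (pair_homP f).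
Qed.

Definition pd_hom_comp (D E F : pd_pair) (g : pd_hom E F) (f : pd_hom D E) :
  pd_hom D F := PDHom (pd_comp_subproof g f).

Definition pd_pair_cat : category :=
  @Category pd_pair pd_hom pd_id pd_hom_comp
    (fun a b c d h g f => @pd_hom_ext _ _ (pd_hom_comp h (pd_hom_comp g f))
       (pd_hom_comp (pd_hom_comp h g) f) (pair_compA h g f))
    (fun a b f => @pd_hom_ext _ _ (pd_hom_comp (pd_id b) f) f (pair_comp1 f))
    (fun a b f => @pd_hom_ext _ _ (pd_hom_comp f (pd_id a)) f (pair_comp1r f)).

Definition forget_pd : functor pd_pair_cat pair_cat :=
  @Functor pd_pair_cat pair_cat pd_base (fun _ _ f => pd_fun f)
    (fun _ => erefl) (fun _ _ _ _ _ => erefl).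

(* Pair^(gamma,st): the PD-envelopes of the objects of Pair^st *)
Definition std_pd_pair (Env : functor pair_cat pd_pair_cat) (mn : nat * nat) :
  pd_pair_cat := Env (std_pair mn).

(* -------------------------------------------------------------------------- *)
(* The animated PD-envelope of a ring-ideal pair                              *)
(* -------------------------------------------------------------------------- *)

(* A simplicial object of Pair consisting of free pairs whose geometric
   realization in Pair^an = P_Sigma(Pair^st) is P. *)
Record free_resolution (P : pair_cat) := FreeResolution {
  res :> simplicial pair_cat;
  res_free : forall n, exists X Y : choiceType,
    isomorphic (res n) (free_pair X Y : pair_cat);
  augmentation : nat_trans res (const_functor _ P);
  res_equivalence : animated_equivalence std_pair augmentation }.

(* The left derived functor of Env restricted to Pair^st preserves filtered
   colimits, so its value at a free pair (Z[X,Y], (Y)), the filtered colimit of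
   the free pairs on the finite subsets of X and Y, is Env (Z[X,Y], (Y)); and
   since it preserves geometric realizations, its value at P is the geometric
   realization of Env applied levelwise to any free resolution of P. *)
Definition animated_pd_envelope (Env : functor pair_cat pd_pair_cat)
    (P : pair_cat) (R : free_resolution P) : simplicial pd_pair_cat :=
  comp_functor Env (res R).

(* The canonical map from the animated to the classical PD-envelope; the target
   is Env P, regarded as a constant simplicial object. *)
Definition animated_to_classical (Env : functor pair_cat pd_pair_cat)
    (P : pair_cat) (R : free_resolution P) :
    nat_trans (animated_pd_envelope Env R)
      (comp_functor Env (const_functor _ P)) :=
  whisker Env (augmentation R).

(* -------------------------------------------------------------------------- *)
(* Koszul-regular sequences                                                   *)
(* -------------------------------------------------------------------------- *)

Section Koszul.
Variables (A : comPzRingType) (r : nat) (f : 'I_r -> A).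

(* The exterior algebra of A^r: x S is the coefficient of the basis element
   e_S = e_(i_1) /\ ... /\ e_(i_p), where S = {i_1 < ... < i_p}. *)
Definition koszul := {ffun {set 'I_r} -> A}.

Definition koszul_degree (p : nat) (x : koszul) : Prop :=
  forall S : {set 'I_r}, #|S| != p -> x S = 0.

(* d (e_S) = \sum_(i in S) (-1)^(number of j in S with j < i) f_i e_(S \ i) *)
Definition koszul_d (x : koszul) : koszul :=
  [ffun S : {set 'I_r} => \sum_(i | i \notin S)
     (-1) ^+ #|[set j in S | (j < i)%N]| * f i * x (i |: S)].

Definition koszul_regular : Prop :=
  forall (p : nat) (x : koszul), (0 < p)%N ->
    koszul_degree p x -> koszul_d x = 0 ->
    exists2 y : koszul, koszul_degree p.+1 y & koszul_d y = x.
End Koszul.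

(* Main.v *)
(* Write y_1, ..., y_r for variables acting on A through f.  The bar resolution of
   A over Z[y] is a simplicial ring Q whose pairs (Q_n, (y)) are free.  It resolves
   (A, I): its rings resolve A, and since f is Koszul-regular, Q_n/(y) computes
   Tor^(Z[y])(A, Z), which is A/I in degree 0 and vanishes above.

   For a functor F on pairs, F applied to a free resolution of (A, I) is exact if
   and only if the bar construction of F at (A, I), over the comonad of free
   pairs, is exact: both are sides of one double complex.  So it suffices to treat
   the resolution Q.

   The envelope E_n of (Q_n, (y)) is a torsion-free ring containing Q_n, the union
   over N > 0 of (1/N) G_N, where G_N is the ideal of Q_n spanned by the
   y^a N / gcd(N, a!).  All but finitely many monomials y^a lie in G_N, so Q/G_N
   has a finite filtration with quotients of the form Q/(y, c); these are acyclic
   in degrees >= 2, hence G_N and E are acyclic in degrees >= 1.  In degree 0,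
   pi_0 of E inherits a PD structure, and the universal property of the classical
   envelope of (A, I) identifies the two. *)

From HB Require Import structures.
From mathcomp Require Import all_boot all_order all_algebra.
From mathcomp Require Import boolp finmap zify ring generic_quotient.
From mathcomp.multinomials Require Import monalg.
Require Import Defs.

Set Implicit Arguments.
Unset Strict Implicit.
Unset Printing Implicit Defensive.

Import GRing.Theory Num.Theory.
Local Open Scope ring_scope.

(** * Augmented simplicial abelian groups *)

(** A morphism out of a standard object is a tuple of ring elements and ideal elements, so being an
    equivalence becomes exactness of two augmented complexes, one of rings and one of ideals. The
    obstacle is that [R] is arbitrary and the envelope is not additive: chain homotopies between
    resolutions do not pass through it. Contractions are therefore built as mere functions on
    underlying sets; the comonad of free pairs turns such functions into morphisms of pairs, which
    every functor respects. The weight N / gcd(N, a!) arises because y^a is a! times a basis element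
    of the envelope of a free pair: it is the least multiple of y^a that becomes divisible by N. The
    bound 2 cannot be lowered: Q/(y) resolves A/I, so reducing modulo c creates the c-torsion of A/I
    in degree 1. This is harmless, since homology of Q/G_N in degree n+1 governs that of G_N in
    degree n. Degree 0 needs another argument because A is an arbitrary ring: its envelope has no
    known basis and may have torsion, so that only its generators and its universal property are at
    hand. *)

Definition alt (M : zmodType) (n : nat) (F : nat -> M) : M :=
  \sum_(i < n) F i *~ (-1) ^+ i.

Section Alternating.
Variable M : zmodType.
Implicit Types F : nat -> M.

Lemma alt0 F : alt 0 F = 0.
Proof. by rewrite /alt big_ord0. Qed.

Lemma altSl n F : alt n.+1 F = F 0%N - alt n (fun i => F i.+1).
Proof.
rewrite /alt big_ord_recl /= mulr1z; congr (_ + _).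
by rewrite -sumrN; apply: eq_bigr => i _; rewrite exprS mulN1r mulrNz.
Qed.

Lemma altSr n F : alt n.+1 F = alt n F + F n *~ (-1) ^+ n.
Proof. by rewrite /alt big_ord_recr. Qed.

Lemma eq_alt n F1 F2 : (forall i, (i < n)%N -> F1 i = F2 i) -> alt n F1 = alt n F2.
Proof. by move=> eqF; apply: eq_bigr => i _; rewrite eqF. Qed.

Lemma altB n F1 F2 : alt n (fun i => F1 i - F2 i) = alt n F1 - alt n F2.
Proof. by rewrite /alt -sumrB; apply: eq_bigr => i _; rewrite mulrzBl. Qed.

Lemma alt_const0 n : alt n (fun _ => 0 : M) = 0.
Proof. by rewrite /alt big1 // => i _; rewrite mul0rz. Qed.

Lemma alt_trunc m n F : (m <= n)%N ->
  (forall i, (m <= i < n)%N -> F i = 0) -> alt n F = alt m F.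
Proof.
elim: n => [|n IHn]; first by rewrite leqn0 => /eqP->.
rewrite leq_eqVlt => /predU1P[->//|lt_mn] F0.
rewrite altSr F0 ?mul0rz ?addr0 ?IHn // => [i /andP[le_mi lt_in]|].
  by rewrite F0 // le_mi ltnW.
by rewrite -ltnS lt_mn ltnSn.
Qed.

Lemma alt_closed (W : M -> Prop) n F : W 0 ->
  (forall x y, W x -> W y -> W (x - y)) -> (forall i, W (F i)) -> W (alt n F).
Proof.
move=> W0 WB; elim: n F => [|n IHn] F WF; first by rewrite alt0.
by rewrite altSl; apply/WB/IHn.
Qed.

(** The cancellation behind the vanishing of the double boundary. The column j = 0 cancels the row i
    = 0, and what is left is the same sum with both indices shifted by one. *)
Lemma alt_sym n (a : nat -> nat -> M) :
  (forall i j, (i < j)%N -> (j <= n.+1)%N -> a i j = a j.-1 i) ->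
  alt n.+2 (fun j => alt n.+1 (fun i => a i j)) = 0.
Proof.
elim: n a => [|n IHn] a a_sym.
  by rewrite !altSl !alt0 !subr0 (a_sym 0%N 1%N) // subrr.
rewrite altSl (@eq_alt n.+2 (fun i => alt n.+2 (fun i0 => a i0 i.+1))
  (fun j => a j 0%N - alt n.+1 (fun i => a i.+1 j.+1))); last first.
  by move=> j lt_j; rewrite altSl a_sym.
rewrite altB opprB addrCA subrr addr0; apply: IHn => i j lt_ij le_j.
by rewrite a_sym //; case: j lt_ij le_j.
Qed.
End Alternating.

Lemma raddf_alt (M N : zmodType) (f : {additive M -> N}) n F :
  f (alt n F) = alt n (fun i => f (F i)).
Proof. by rewrite /alt raddf_sum; apply: eq_bigr => i _; rewrite raddfMz. Qed.

Section Chain.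
Variables (G : nat -> zmodType) (D : forall k, G k.+1 -> G k).
Variable V : forall k, G k -> Prop.

(** Every element of level 0 is a cycle, so exactness there is surjectivity of the augmentation. *)
Definition cycle k : G k -> Prop :=
  if k is k'.+1 then fun z => D z = 0 else fun=> True.

Definition chain_exact k := forall z : G k, V z -> cycle z ->
  exists2 w : G k.+1, V w & D w = z.
End Chain.

(* Level 0 is the target of the augmentation, level k.+1 is the group of
   k-simplices; the subgroups V stand for either the ring or the ideal of a
   pair. *)
Section Simplicial.
Variables (G : nat -> zmodType) (d : forall k, nat -> {additive G k.+1 -> G k}).
Variables (s : forall k, nat -> {additive G k.+1 -> G k.+2}).
Variable V : forall k, G k -> Prop.

Definition bd k (z : G k.+1) : G k := alt k.+1 (fun i => d k i z).

Local Notation exact_at := (chain_exact bd V).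

Lemma bdB k : zmod_morphism (@bd k).
Proof.
by move=> x y; rewrite /bd -altB; apply: eq_alt => i _; rewrite raddfB.
Qed.
HB.instance Definition _ k := GRing.isZmodMorphism.Build _ _ (@bd k) (@bdB k).

Hypothesis dd : forall k i j, (i < j)%N -> (j <= k.+1)%N ->
  forall x, d k i (d k.+1 j x) = d k j.-1 (d k.+1 i x).

Lemma bd_bd k (z : G k.+2) : bd (bd z) = 0.
Proof.
rewrite /bd (@eq_alt _ _ _ (fun i => alt k.+2 (fun j => d k i (d k.+1 j z)))).
  rewrite -[RHS](@alt_sym _ k (fun i j => d k i (d k.+1 j z))) => [|i j lt_ij le_j].
    rewrite /alt (eq_bigr _ (fun i _ => mulrz_suml _ _ _ _)) exchange_big /=.
    apply: eq_bigr => j _; rewrite mulrz_suml; apply: eq_bigr => i _.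
    by rewrite mulrzAC.
  exact: dd.
by move=> i _; rewrite raddf_alt.
Qed.

Hypothesis ds_lt : forall k i j, (i < j)%N -> (j <= k.+1)%N ->
  forall x, d k.+2 i (s k.+1 j x) = s k j.-1 (d k.+1 i x).
Hypothesis ds_eq : forall k j, (j <= k)%N -> forall x, d k.+1 j (s k j x) = x.
Hypothesis ds_eqS : forall k j, (j <= k)%N -> forall x, d k.+1 j.+1 (s k j x) = x.
Hypothesis ds_gt : forall k i j, (j.+1 < i)%N -> (i <= k.+2)%N ->
  forall x, d k.+2 i (s k.+1 j x) = s k j (d k.+1 i.-1 x).
Hypothesis VB : forall k (x y : G k), V x -> V y -> V (x - y).
Hypothesis V0 : forall k, V (0 : G k).
Hypothesis Vd : forall k i x, V x -> V (d k i x).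
Hypothesis Vs : forall k i x, V x -> V (s k i x).

Lemma VN k (x : G k) : V x -> V (- x).
Proof. by move=> Vx; rewrite -sub0r; apply: VB. Qed.

Lemma VD k (x y : G k) : V x -> V y -> V (x + y).
Proof. by move=> Vx Vy; rewrite -[y]opprK; apply: VB => //; apply: VN. Qed.

(** Exactness of the Moore complex: all faces of the cycle vanish, and the filler has no nonzero
    face except the 0th. *)
Definition nexact_at k := forall z : G k, V z ->
  (if k is k'.+1 return G k -> Prop then
     fun z => forall i, (i <= k')%N -> d k' i z = 0 else fun=> True) z ->
  exists2 w : G k.+1, V w & d k 0 w = z /\
    forall i, (0 < i <= k)%N -> d k i w = 0.

Lemma ds_gt0 k i j (x : G k.+1) : (j.+1 < i <= k.+1)%N ->
  d k i.-1 x = 0 -> d k.+1 i (s k j x) = 0.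
Proof.
case/andP; case: k x => [|k] x lt_ji le_ik dx0; first by lia.
by rewrite ds_gt // dx0 raddf0.
Qed.

Lemma alt_ds0 k t (x : G k.+1) : (t <= k)%N ->
  alt t (fun i => d k i x) = 0 -> alt t (fun i => d k.+1 i (s k t x)) = 0.
Proof.
case: t => [|t]; first by rewrite !alt0.
case: k x => [//|k] x le_tk dx0; rewrite -[RHS](raddf0 (s k t)) -dx0 raddf_alt.
by apply: eq_alt => i lt_it; rewrite ds_lt.
Qed.

(** The faces of [w] are killed one by one, from the highest index down, by subtracting s_t d_(t+1)
    w. The boundary does not change: the faces t and t+1 of the subtracted simplex coincide and
    cancel, the higher ones vanish, and the lower ones have alternating sum zero. *)
Lemma normalize_filler k (z : G k.+1) (w : G k.+2) :
  (forall i, (i <= k)%N -> d k i z = 0) -> V w -> bd w = z ->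
  exists2 w' : G k.+2, V w' & d k.+1 0 w' = z /\
    forall i, (0 < i <= k.+1)%N -> d k.+1 i w' = 0.
Proof.
move=> dz0 Vw bdw.
suff /(_ k.+1 (leqnn _)) [w' Vw' [bdw' w'0]] : forall m, (m <= k.+1)%N ->
    exists2 w' : G k.+2, V w' & bd w' = z /\
      forall i, (k.+1 - m < i <= k.+1)%N -> d k.+1 i w' = 0.
  exists w' => //; rewrite subnn in w'0; split=> //.
  move: bdw'; rewrite /bd altSl (@eq_alt _ _ _ (fun=> 0)); last first.
    by move=> i lt_i; rewrite w'0.
  by rewrite alt_const0 subr0.
elim=> [_|m IHm /[dup] lt_mk /ltnW/IHm {w Vw bdw}[w Vw [bdw w0]]].
  by exists w => //; split=> // i; lia.
have [t def_t] : exists t, (k.+1 - m = t.+1)%N by exists (k - m)%N; lia.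
have le_t : (t <= k)%N by lia.
rewrite def_t in w0; rewrite subnS def_t /=.
pose v := d k.+1 t.+1 w; pose u := s k t v.
have u0 i : (t.+1 < i <= k.+1)%N -> d k.+1 i u = 0.
  move=> /[dup] lt_i /andP[lt_ti le_ik]; rewrite /u ds_gt0 // /v.
  by rewrite -(dd lt_ti) // w0 ?raddf0 //; lia.
exists (w - u); first by apply: VB => //; apply/Vs/Vd.
split=> [|i /andP[lt_ti le_ik]]; rewrite raddfB /=; last first.
  have [->|ne_it] := eqVneq i t.+1; first by rewrite ds_eqS // subrr.
  by rewrite w0 ?u0 ?subrr //; lia.
rewrite bdw -[RHS]subr0; congr (_ - _).
rewrite /bd (@alt_trunc _ t.+2) //.
rewrite !altSr exprS mulN1r mulrNz ds_eqS // ds_eq // addrK alt_ds0 //.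
(* The alternating sum of the faces of [v] below t is d_t applied to the boundary of [w], that is,
   d_t z = 0. *)
rewrite -[RHS](dz0 t le_t) -bdw /bd (@alt_trunc _ t.+2 k.+2) //.
rewrite !altSr !raddfD !raddfMz raddf_alt /= (dd (ltnSn t)) //=.
rewrite exprS mulN1r mulrNz addrK.
by apply: eq_alt => i lt_it; rewrite /v (@dd k i t.+1) //; lia.
Qed.

Lemma exact_nexact : (forall k, exact_at k) -> forall k, nexact_at k.
Proof.
move=> ex [|k] z Vz dz0.
  have [w Vw bdw] := ex 0%N z Vz I; exists w => //; split=> [|i]; last by lia.
  by rewrite -bdw /bd altSl alt0 subr0.
have bdz : bd z = 0.
  by rewrite /bd (@eq_alt _ _ _ (fun=> 0)) ?alt_const0 // => i /dz0.
by have [w Vw bdw] := ex k.+1 z Vz bdz; apply: normalize_filler bdw.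
Qed.

(** Each cycle is homologous to one whose faces of positive index vanish. Being a cycle, the latter
    has vanishing 0th face as well, so the normalized hypothesis fills it. *)
Lemma nexact_exact : (forall k, nexact_at k) -> forall k, exact_at k.
Proof.
move=> nex [|k] z Vz cz.
  have [w Vw [dw _]] := nex 0%N z Vz I; exists w => //.
  by rewrite /bd altSl alt0 subr0.
suff /(_ k (leqnn _)) [z' [w [Vz' Vw bdw]] z'0] : forall m, (m <= k)%N ->
    exists2 z' : G k.+1, exists w, [/\ V z', V w & bd w = z - z'] &
      forall i, (k - m < i <= k)%N -> d k i z' = 0.
  have bdz' : bd z' = 0.
    have := bd_bd w; rewrite bdw raddfB /= cz => /eqP.
    by rewrite sub0r oppr_eq0 => /eqP.
  have [i le_ik|w' Vw' [dw' w'0]] := nex k.+1 z' Vz'.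
    case: i le_ik => [_|i le_ik]; last by apply: z'0; lia.
    move: bdz'; rewrite /bd altSl (@eq_alt _ _ _ (fun=> 0)) ?alt_const0 ?subr0 //.
    by move=> j lt_j; apply: z'0; lia.
  exists (w + w'); first exact: VD.
  rewrite raddfD /= bdw /bd altSl dw' (@eq_alt _ _ _ (fun=> 0)) => [|i lt_i].
    by rewrite alt_const0 subr0 subrK.
  by rewrite w'0.
elim=> [_|m IHm /[dup] lt_mk /ltnW/IHm [z' [w [Vz' Vw bdw]] z'0]].
  exists z; last by move=> i; lia.
  by exists 0; rewrite !subrr raddf0.
have [t def_t] : exists t, (k - m = t.+1)%N by exists (k - m).-1; lia.
have lt_t : (t < k)%N by lia.
rewrite def_t in z'0; rewrite subnS def_t /=.
have bdz' : bd z' = 0.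
  have := bd_bd w; rewrite bdw raddfB /= cz => /eqP.
  by rewrite sub0r oppr_eq0 => /eqP.
case: k z Vz cz z' w Vz' Vw bdw bdz' lt_t z'0 {IHm lt_mk def_t}
  => [//|k] z Vz cz z' w Vz' Vw bdw bdz' lt_t z'0.
pose v := d k.+1 t.+1 z'; pose u := s k t v.
have u0 i : (t.+1 < i <= k.+1)%N -> d k.+1 i u = 0.
  move=> /[dup] lt_i /andP[lt_ti le_ik]; rewrite /u ds_gt0 // /v.
  by rewrite -(dd lt_ti) // z'0 ?raddf0 //; lia.
exists (z' - u); last first.
  move=> i /andP[lt_ti le_ik]; rewrite raddfB /=.
  have [->|ne_it] := eqVneq i t.+1; first by rewrite ds_eqS // subrr.
  by rewrite z'0 ?u0 ?subrr //; lia.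
(* The boundary of this degenerate simplex is [u] up to sign, so that removing [u] from z' stays in
   the homology class. *)
pose y := s k.+1 t.+1 z'.
have bdy : bd y = u *~ (-1) ^+ t.
  rewrite /bd (@alt_trunc _ t.+3) //; last first.
    by move=> i lt_i; apply: ds_gt0; [lia|apply: z'0; lia].
  rewrite 2!altSr [_ ^+ t.+2]exprS mulN1r mulrNz ds_eqS // ds_eq // addrK.
  rewrite (@eq_alt _ _ _ (fun i => s k t (d k.+1 i z'))); last first.
    by move=> i lt_i; rewrite ds_lt.
  rewrite -raddf_alt /u /v -raddfMz; congr (s k t _).
  move: bdz'; rewrite /bd (@alt_trunc _ t.+2 k.+2) //.
  by rewrite altSr exprS mulN1r mulrNz => /eqP; rewrite subr_eq0 => /eqP.
exists (w + y *~ (-1) ^+ t); split.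
- by apply: VB => //; apply/Vs/Vd.
- apply: VD => //; rewrite -signr_odd; case: (odd t); last exact: Vs.
  by rewrite expr1 mulrNz mulr1z; apply/VN/Vs.
rewrite raddfD raddfMz /= bdw bdy -mulrzA -expr2 sqrr_sign mulr1z.
by rewrite opprB [RHS]addrA addrAC.
Qed.

(** Moore's argument that simplicial groups are Kan complexes fills all faces but the 0th. The
    defect at the 0th face is a normalized cycle, and exactness absorbs it, so whole boundaries can
    be filled and not only horns. *)
Lemma moore_filler k (x : nat -> G k.+1) :
  (forall k, nexact_at k) -> (forall i, V (x i)) ->
  (forall i j, (i < j)%N -> (j <= k.+1)%N -> d k i (x j) = d k j.-1 (x i)) ->
  exists2 w : G k.+2, V w & forall i, (i <= k.+1)%N -> d k.+1 i w = x i.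
Proof.
move=> nex Vx dx.
have /(_ k.+1 (leqnn _)) [w Vw w_x] : forall m, (m <= k.+1)%N ->
    exists2 w : G k.+2, V w &
      forall i, (k.+1 - m < i <= k.+1)%N -> d k.+1 i w = x i.
  elim=> [_|m IHm /[dup] lt_mk /ltnW/IHm [w Vw w_x]].
    by exists 0 => // i; lia.
  have [t def_t] : exists t, (k.+1 - m = t.+1)%N by exists (k - m)%N; lia.
  have le_t : (t <= k)%N by lia.
  rewrite def_t in w_x; rewrite subnS def_t /=.
  exists (w + s k t (x t.+1 - d k.+1 t.+1 w)).
    by apply: VD => //; apply/Vs/VB/Vd.
  move=> i /andP[lt_ti le_ik]; rewrite raddfD /=.
  have [->|ne_it] := eqVneq i t.+1; first by rewrite ds_eqS // addrC subrK.
  rewrite ds_gt0 ?addr0; [by rewrite w_x //; lia|lia|].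
  have lt_ti1 : (t.+1 < i)%N by lia.
  rewrite raddfB /= -(dd lt_ti1) // w_x ?lt_ti1 //.
  by apply/eqP; rewrite subr_eq0 (dx _ _ lt_ti1).
rewrite subnn in w_x.
pose z := x 0%N - d k.+1 0%N w.
have [|i le_ik|w' Vw' [dw' w'0]] := nex k.+1 z; first by apply/VB/Vd.
  have := @dd k 0%N i.+1 (ltn0Sn i) le_ik w; rewrite /= => dd0.
  by rewrite /z raddfB /= -dd0 w_x // (dx 0%N i.+1) // subrr.
exists (w + w'); first exact: VD.
move=> [|i] le_ik; rewrite raddfD /=; first by rewrite dw' addrC subrK.
by rewrite w_x // w'0 // addr0.
Qed.

(** An extra degeneracy on underlying sets: [h] is neither additive nor multiplicative in
    general. *)
Definition contraction (h : forall k, G k -> G k.+1) :=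
  [/\ forall k x, V x -> V (h k x), forall k x, V x -> d k 0 (h k x) = x
    & forall k i x, V x -> (i <= k)%N -> d k.+1 i.+1 (h k.+1 x) = h k (d k i x)].

(* The faces y, h (d_0 y), ..., h (d_k y) of the next simplex h y to be
   constructed are compatible, hence fillable. *)
Lemma exact_contraction :
  (forall k, exact_at k) -> exists h, contraction h.
Proof.
move=> /exact_nexact nex.
pose ok k (h : G k -> G k.+1) := [/\ forall x, V x -> V (h x),
  forall x, V x -> d k 0%N (h x) = x & forall i j x, V x ->
    (i < j <= k)%N -> d k i.+1 (h (d k j x)) = d k j (h (d k i x))].
have ex0 : exists h, @ok 0%N h.
  have /choice[h hP] (z : G 0%N) : exists w, V z -> V w /\ d 0%N 0%N w = z.
    have [Vz|nVz] := EM (V z); last by exists 0.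
    by have [w Vw [dw _]] := nex 0%N z Vz I; exists w.
  exists h; split=> [x /hP[]//|x /hP[]//|i j x _]; lia.
have exS k (h : {h | @ok k h}) : exists h' : {h' | @ok k.+1 h'},
    forall i x, V x -> (i <= k)%N -> d k.+1 i.+1 (sval h' x) = sval h (d k i x).
  case: h => h [Vh d0h dSh] /=.
  have /choice[h' h'P] (x : G k.+1) : exists w, V x ->
     [/\ V w, d k.+1 0%N w = x &
       forall i, (i <= k)%N -> d k.+1 i.+1 w = h (d k i x)].
    have [Vx|nVx] := EM (V x); last by exists 0.
    pose f i := if i is i'.+1 then h (d k i' x) else x.
    have [| [|i] [|j] //= | w Vw w_f] := @moore_filler k f nex.
    - by case=> [//|i]; apply/Vh/Vd.
    - by move=> _ le_j; rewrite d0h //; apply: Vd.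
    - by rewrite ltnS => lt_ij le_j; rewrite dSh // lt_ij.
    exists w => _; split=> //; first by rewrite w_f.
    by move=> i le_i; rewrite w_f.
  have ok' : @ok k.+1 h'.
    split=> [x /h'P[]//|x /h'P[]//|i j x Vx /andP[lt_ij le_jk]].
    have [_ _ ->] := h'P _ (@Vd _ j _ Vx); last by lia.
    have [_ _ dh'] := h'P _ (@Vd _ i _ Vx).
    case: j lt_ij le_jk => [//|j] lt_ij le_jk.
    by rewrite dh' // dd.
  by exists (exist _ h' ok') => i x Vx le_i; have [_ _ ->] := h'P x Vx.
have [h0 ok0] := ex0.
pose F := fix F k : {h | @ok k h} :=
  if k is k'.+1 return {h | @ok k h} then sval (cid (exS k' (F k')))
  else exist _ h0 ok0.
exists (fun k => sval (F k)); split=> [k|k|k i x Vx le_ik].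
- by case: (svalP (F k)).
- by case: (svalP (F k)).
- exact: (svalP (cid (exS k (F k)))).
Qed.

End Simplicial.

(** * Polynomial rings *)

Local Notation "1" := (@mone _) : monom_scope.
Local Notation "m1 * m2" := (mmul m1 m2) : monom_scope.
Notation mpol X := {malg int[{cmonom X}]}.

Lemma cmonom_ind (X : choiceType) (P : {cmonom X} -> Prop) :
  P 1%M -> (forall x m, P m -> P (ucm x * m)%M) -> forall m, P m.
Proof.
move=> P1 PM m; have [n] := ubnP (mdeg m); elim: n m => // n IHn m le_mn.
have [->//|m_neq1] := eqVneq m 1%M.
have [x mx] : exists x, m x != 0%N.
  apply: contrapT => /forallNP m0; case/eqP: m_neq1; apply/eqP/cmP => x.
  by rewrite cm1; apply/eqP/negPn/negP/m0.
have def_m : m = (ucm x * divcm m (ucm x))%M.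
  apply/eqP/cmP => y; rewrite cmM divcmE cmU.
  by have [<-|_] := eqVneq x y; [rewrite subnKC // lt0n|rewrite subn0].
rewrite def_m; apply: PM; apply: IHn.
by move: le_mn; rewrite {1}def_m mdegM mdegU.
Qed.

Lemma malgU_mul (X : choiceType) (R : nzRingType) (m1 m2 : {cmonom X}) :
  << (m1 * m2)%M >> = << m1 >> * << m2 >> :> {malg R[{cmonom X}]}.
Proof. by rewrite malgM_def fgmulUU mulr1. Qed.

(* Sealed, because unification must never look inside finitely supported
   functions. *)
HB.lock Definition mon (X : choiceType) (m : {cmonom X}) : mpol X := << m >>.
Canonical mon_unlock := Unlockable mon.unlock.

HB.lock Definition coef (X : choiceType) (m : {cmonom X}) (p : mpol X) : int :=
  p@_m.
Canonical coef_unlock := Unlockable coef.unlock.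

HB.lock Definition lin_ext (X : choiceType) (M : zmodType) (h : {cmonom X} -> M)
  (p : mpol X) : M := \sum_(m <- msupp p) h m *~ p@_m.
Canonical lin_ext_unlock := Unlockable lin_ext.unlock.

Section Monomials.
Variable X : choiceType.
Implicit Types (m : {cmonom X}) (p : mpol X).

Lemma coef_additive m : zmod_morphism (coef m).
Proof. by move=> p1 p2; rewrite !unlock mcoeffB. Qed.
HB.instance Definition _ m :=
  GRing.isZmodMorphism.Build _ _ (coef m) (coef_additive m).

Lemma coef_mon m1 m2 : coef m1 (mon m2) = (m2 == m1)%:R.
Proof. by rewrite coef.unlock mon.unlock mcoeffU1. Qed.

Lemma coefP p1 p2 : (forall m, coef m p1 = coef m p2) -> p1 = p2.
Proof. by move=> eq_p; apply/malgP => m; have := eq_p m; rewrite coef.unlock. Qed.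

Lemma mon1 : mon (1%M : {cmonom X}) = 1.
Proof. by rewrite mon.unlock mpolyC1E. Qed.

Lemma monM m1 m2 : mon (m1 * m2)%M = mon m1 * mon m2.
Proof. by rewrite mon.unlock malgU_mul. Qed.

Lemma mpolE p : p = \sum_(m <- msupp p) mon m *~ coef m p.
Proof.
rewrite {1}(monalgE p); apply: eq_bigr => m _; rewrite mon.unlock coef.unlock.
by rewrite -(raddfMz (mkmalgU m)) /= intz.
Qed.

Lemma mpol_ind (P : mpol X -> Prop) : P 0 ->
  (forall p1 p2, P p1 -> P p2 -> P (p1 + p2)) ->
  (forall m c, P (mon m *~ c)) -> forall p, P p.
Proof. by move=> P0 PD PU p; rewrite (mpolE p); elim/big_ind: _. Qed.

Section Ext.
Variables (M : zmodType) (h : {cmonom X} -> M).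

Lemma lin_ext_additive : zmod_morphism (lin_ext h).
Proof.
have extE p (E : {fset {cmonom X}}) : (msupp p `<=` E)%fset ->
    lin_ext h p = \sum_(m <- E) h m *~ p@_m.
  move=> sub_pE; rewrite lin_ext.unlock (big_fset_incl _ sub_pE) // => m _.
  by move=> /mcoeff_outdom->.
move=> p1 p2; pose E := (msupp p1 `|` msupp p2)%fset.
rewrite !(@extE _ E) ?fsubsetUl ?fsubsetUr ?msuppB_le // -sumrB.
by apply: eq_bigr => m _; rewrite mcoeffB mulrzBr.
Qed.
HB.instance Definition _ :=
  GRing.isZmodMorphism.Build _ _ (lin_ext h) lin_ext_additive.

Lemma lin_ext_mon m : lin_ext h (mon m) = h m.
Proof. by rewrite lin_ext.unlock mon.unlock msuppU1 big_seq_fset1 mcoeffUU mulr1z. Qed.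
End Ext.

Lemma additive_mpol_ext (M : zmodType) (f1 f2 : {additive mpol X -> M}) :
  (forall m, f1 (mon m) = f2 (mon m)) -> f1 =1 f2.
Proof.
move=> eq_f p; rewrite (mpolE p) (raddf_sum f1) (raddf_sum f2).
by apply: eq_bigr => m _; rewrite (raddfMz f1) (raddfMz f2) eq_f.
Qed.

Lemma zmod_mpol_ext (M : zmodType) (f1 f2 : mpol X -> M) :
  zmod_morphism f1 -> zmod_morphism f2 ->
  (forall m, f1 (mon m) = f2 (mon m)) -> f1 =1 f2.
Proof.
move=> f1B f2B; pose g1 := HB.pack_for {additive mpol X -> M} f1
  (GRing.isZmodMorphism.Build _ _ f1 f1B).
pose g2 := HB.pack_for {additive mpol X -> M} f2
  (GRing.isZmodMorphism.Build _ _ f2 f2B).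
exact: (@additive_mpol_ext M g1 g2).
Qed.

Lemma poly_varE (x : X) : poly_var x = mon (ucm x).
Proof. by rewrite ?coef.unlock ?mon.unlock. Qed.

Lemma rmorphism_mpol_ext (B : pzRingType) (f1 f2 : {rmorphism mpol X -> B}) :
  (forall x, f1 (mon (ucm x)) = f2 (mon (ucm x))) -> f1 =1 f2.
Proof.
move=> eq_f; suff eqU m : f1 (mon m) = f2 (mon m).
  exact: (additive_mpol_ext eqU).
elim/cmonom_ind: m => [|x m IHm]; first by rewrite mon1 !rmorph1.
by rewrite monM (rmorphM f1) (rmorphM f2) eq_f IHm.
Qed.
End Monomials.

HB.lock Definition monom_eval (X : choiceType) (B : comPzRingType) (f : X -> B)
  (m : {cmonom X}) : B := \prod_(x <- finsupp m) f x ^+ m x.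
Canonical monom_eval_unlock := Unlockable monom_eval.unlock.

Section Evaluation.
Variables (X : choiceType) (B : comPzRingType) (f : X -> B).

Lemma monom_evalM m1 m2 :
  monom_eval f (m1 * m2)%M = monom_eval f m1 * monom_eval f m2.
Proof.
have evalE (m : {cmonom X}) (E : {fset X}) : (finsupp m `<=` E)%fset ->
    monom_eval f m = \prod_(x <- E) f x ^+ m x.
  move=> sub_mE; rewrite monom_eval.unlock (big_fset_incl _ sub_mE) // => x _.
  by rewrite -cmE_eq0 => /eqP->.
pose E := (finsupp m1 `|` finsupp m2)%fset.
rewrite !(@evalE _ E) ?fsubsetUl ?fsubsetUr ?mdomD // -big_split.
by apply: eq_bigr => x _; rewrite cmM exprD.
Qed.

Lemma monom_eval1 : monom_eval f 1%M = 1.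
Proof. by rewrite monom_eval.unlock mdom1 big_seq_fset0. Qed.

Lemma monom_evalU x : monom_eval f (ucm x) = f x.
Proof. by rewrite monom_eval.unlock mdomU big_seq_fset1 cmUU expr1. Qed.

Definition poly_eval : mpol X -> B := lin_ext (monom_eval f).
HB.instance Definition _ := GRing.Additive.on poly_eval.

Lemma poly_eval_mon m : poly_eval (mon m) = monom_eval f m.
Proof. exact: lin_ext_mon. Qed.

Lemma poly_eval_multiplicative : monoid_morphism poly_eval.
Proof.
split=> [|p q]; first by rewrite -mon1 poly_eval_mon monom_eval1.
elim/mpol_ind: p => [|p1 p2 IH1 IH2|m1 c1].
- by rewrite mul0r raddf0 mul0r.
- by rewrite mulrDl !raddfD /= mulrDl -IH1 -IH2.
rewrite raddfMz /= !mulrzAl raddfMz /=; congr (_ *~ _).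
elim/mpol_ind: q => [|q1 q2 IH1 IH2|m2 c2].
- by rewrite mulr0 raddf0 mulr0.
- by rewrite mulrDr !raddfD /= mulrDr -IH1 -IH2.
rewrite raddfMz /= !mulrzAr raddfMz /=; congr (_ *~ _).
by rewrite -monM !poly_eval_mon monom_evalM.
Qed.
HB.instance Definition _ :=
  GRing.isMonoidMorphism.Build _ _ poly_eval poly_eval_multiplicative.

Lemma poly_eval_var x : poly_eval (poly_var x) = f x.
Proof. by rewrite poly_varE poly_eval_mon monom_evalU. Qed.
End Evaluation.

(** * Free pairs *)

Lemma idealN (A : comPzRingType) (I : ideal A) x : I x -> I (- x).
Proof. by move=> Ix; rewrite -mulN1r; apply: idealM. Qed.

Lemma idealB (A : comPzRingType) (I : ideal A) x y : I x -> I y -> I (x - y).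
Proof. by move=> Ix Iy; apply: idealD => //; apply: idealN. Qed.

Lemma ideal_sum (A : comPzRingType) (I : ideal A) J (r : seq J) (P : pred J) F :
  (forall j, P j -> I (F j)) -> I (\sum_(j <- r | P j) F j).
Proof. by move=> IF; elim/big_ind: _ => //; [apply: ideal0|apply: idealD]. Qed.

Lemma generated_min (A : comPzRingType) (S : A -> Prop) (I : ideal A) x :
  (forall y, S y -> I y) -> generated S x -> I x.
Proof.
move=> SI [n [c [s [Ss ->]]]]; apply: ideal_sum => i _.
exact/idealM/SI.
Qed.

Lemma generated_mem (A : comPzRingType) (S : A -> Prop) x : S x -> generated S x.
Proof.
move=> Sx; exists 1%N, (fun=> 1), (fun=> x); split=> //.
by rewrite big_ord1 mul1r.
Qed.

HB.lock Definition xvar (X Y : choiceType) (x : X) : pring (free_pair X Y) :=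
  poly_var (inl x).
Canonical xvar_unlock := Unlockable xvar.unlock.

HB.lock Definition yvar (X Y : choiceType) (y : Y) : pring (free_pair X Y) :=
  poly_var (inr y).
Canonical yvar_unlock := Unlockable yvar.unlock.

Arguments xvar {X} Y x.
Arguments yvar X {Y} y.

Section FreePair.
Variables (X Y : choiceType) (Q : ring_pair).

Lemma xvarE (x : X) : xvar Y x = mon (ucm (inl x)).
Proof. by rewrite xvar.unlock poly_varE. Qed.

Lemma yvarE (y : Y) : yvar X y = mon (ucm (inr y)).
Proof. by rewrite yvar.unlock poly_varE. Qed.

Lemma yvar_ideal y : pideal (free_pair X Y) (yvar X y).
Proof. by apply: generated_mem; exists y; rewrite yvar.unlock. Qed.

Lemma free_pair_ext (f1 f2 : pair_hom (free_pair X Y) Q) :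
  (forall x, f1 (xvar Y x) = f2 (xvar Y x)) ->
  (forall y, f1 (yvar X y) = f2 (yvar X y)) -> f1 = f2.
Proof.
move=> eq_x eq_y; apply/pair_hom_ext/rmorphism_mpol_ext => -[x|y].
  by rewrite -xvarE.
by rewrite -yvarE.
Qed.

Variables (f : X -> pring Q) (g : Y -> pring Q).
Hypothesis gQ : forall y, pideal Q (g y).

Definition var_image (v : (X + Y)%type) : pring Q :=
  match v with inl x => f x | inr y => g y end.

Lemma free_lift_subproof p :
  pideal (free_pair X Y) p -> pideal Q (poly_eval var_image p).
Proof.
case=> n [c [s [Ss ->]]]; rewrite raddf_sum; apply: ideal_sum => i _.
have [y ->] := Ss i.
by rewrite /= (rmorphM (poly_eval var_image)) /= poly_eval_var; apply/idealM/gQ.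
Qed.

Definition free_lift : pair_hom (free_pair X Y) Q :=
  @PairHom (free_pair X Y) Q (poly_eval var_image) free_lift_subproof.

Lemma free_lift_xvar x : free_lift (xvar Y x) = f x.
Proof. rewrite xvar.unlock; exact: poly_eval_var. Qed.

Lemma free_lift_yvar y : free_lift (yvar X y) = g y.
Proof. rewrite yvar.unlock; exact: poly_eval_var. Qed.
End FreePair.

(** The boolean lets every exactness statement cover the ring and the ideal at the same time. *)
Definition part (b : bool) (P : ring_pair) (x : pring P) : Prop :=
  if b then pideal P x else True.

Lemma part0 b P : part b (0 : pring P).
Proof. by case: b => //=; apply: ideal0. Qed.

Lemma partB b P (x y : pring P) : part b x -> part b y -> part b (x - y).
Proof. by case: b => //=; apply: idealB. Qed.

Lemma part_hom b P Q (f : pair_hom P Q) x : part b x -> part b (f x).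
Proof. by case: b => //=; apply: pair_homP. Qed.

(** * The bar construction *)

(** Reflecting membership into a boolean makes the ideal a [choiceType], hence an admissible set of
    variables. *)
Definition ielt (P : ring_pair) := {x : pring P | `[< pideal P x >]}.

Definition mk_ielt P (x : pring P) (Px : pideal P x) : ielt P :=
  exist _ x (asboolT Px).

Lemma ieltP P (x : ielt P) : pideal P (val x).
Proof. exact: asboolW (valP x). Qed.

Definition ielt_map P Q (f : pair_hom P Q) (x : ielt P) : ielt Q :=
  mk_ielt (pair_homP f (ieltP x)).

Definition bar (P : ring_pair) : ring_pair := free_pair (pring P) (ielt P).

Definition bar_eps P : pair_hom (bar P) P := free_lift id (@ieltP P).

(** Only functions are asked for: this is how a contraction of underlying sets becomes a morphism of
    pairs. *)
Definition bar_set P Q (h : pring P -> pring Q) (g : ielt P -> ielt Q) :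
    pair_hom (bar P) (bar Q) :=
  @free_lift _ _ (bar Q) (fun x => xvar _ (h x)) (fun y => yvar _ (g y))
    (fun y => yvar_ideal _ (g y)).

Definition bar_map P Q (f : pair_hom P Q) := bar_set f (ielt_map f).

Lemma pair_compE P Q S (g : pair_hom Q S) (f : pair_hom P Q) x :
  pair_comp g f x = g (f x).
Proof. by []. Qed.

Lemma bar_eps_x P x : bar_eps P (xvar _ x) = x.
Proof. exact: free_lift_xvar. Qed.

Lemma bar_eps_y P y : bar_eps P (yvar _ y) = val y.
Proof. exact: free_lift_yvar. Qed.

Lemma bar_set_x P Q (h : pring P -> pring Q) (g : ielt P -> ielt Q) x :
  bar_set h g (xvar _ x) = xvar _ (h x).
Proof. exact: free_lift_xvar. Qed.

Lemma bar_set_y P Q (h : pring P -> pring Q) (g : ielt P -> ielt Q) y :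
  bar_set h g (yvar _ y) = yvar _ (g y).
Proof. exact: free_lift_yvar. Qed.

Definition barE :=
  (pair_compE, bar_eps_x, bar_eps_y, bar_set_x, bar_set_y).

Lemma bar_set_comp P Q S h g h' g' :
  pair_comp (@bar_set Q S h' g') (@bar_set P Q h g) = bar_set (h' \o h) (g' \o g).
Proof.
by apply: free_pair_ext => x; rewrite !barE.
Qed.

Lemma eq_bar_set P Q (h h' : pring P -> pring Q) g g' : h =1 h' -> g =1 g' ->
  bar_set h g = bar_set h' g'.
Proof. by move=> /funext-> /funext->. Qed.

Lemma bar_set_id P : bar_set id id = pair_id (bar P).
Proof.
by apply: free_pair_ext => x; rewrite !barE.
Qed.

Lemma bar_mapM P Q S (f' : pair_hom Q S) (f : pair_hom P Q) :
  bar_map (pair_comp f' f) = pair_comp (bar_map f') (bar_map f).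
Proof.
by rewrite bar_set_comp; apply: eq_bar_set => // y; apply: val_inj.
Qed.

Lemma bar_map1 P : bar_map (pair_id P) = pair_id (bar P).
Proof.
by rewrite -bar_set_id; apply: eq_bar_set => // y; apply: val_inj.
Qed.

Lemma bar_eps_nat P Q (f : pair_hom P Q) :
  pair_comp (bar_eps Q) (bar_map f) = pair_comp f (bar_eps P).
Proof. by apply: free_pair_ext => x; rewrite !barE. Qed.

Fixpoint barn m (P : ring_pair) : ring_pair :=
  if m is m'.+1 then bar (barn m' P) else P.

Fixpoint barn_map m P Q (f : pair_hom P Q) : pair_hom (barn m P) (barn m Q) :=
  if m is m'.+1 return pair_hom (barn m P) (barn m Q)
  then bar_map (barn_map m' f) else f.

Lemma barn_mapM m P Q S (f' : pair_hom Q S) (f : pair_hom P Q) :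
  barn_map m (pair_comp f' f) = pair_comp (barn_map m f') (barn_map m f).
Proof. by elim: m => //= m ->; rewrite bar_mapM. Qed.

Fixpoint bar_face m i P : pair_hom (barn m.+1 P) (barn m P) :=
  match m return pair_hom (barn m.+1 P) (barn m P) with
  | 0 => bar_eps P
  | m'.+1 => if i is i'.+1 then bar_map (bar_face m' i' P)
             else bar_eps (barn m'.+1 P)
  end.

Lemma bar_face_nat m i P Q (f : pair_hom P Q) :
  pair_comp (bar_face m i Q) (barn_map m.+1 f)
  = pair_comp (barn_map m f) (bar_face m i P).
Proof.
elim: m i => [|m IHm] [|i] //=; rewrite ?bar_eps_nat //.
by rewrite -!bar_mapM IHm.
Qed.

Lemma bar_face_face m i j P : (i < j)%N -> (j <= m.+1)%N ->
  pair_comp (bar_face m i P) (bar_face m.+1 j P)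
  = pair_comp (bar_face m j.-1 P) (bar_face m.+1 i P).
Proof.
elim: m i j => [|m IHm] i [//|j] lt_ij le_jm.
  by case: i lt_ij => [|i] lt_ij; [case: j le_jm {lt_ij} => //= _; apply: bar_eps_nat|lia].
case: i lt_ij => [_|i lt_ij] /=; first exact: bar_eps_nat.
by case: j lt_ij le_jm => // j lt_ij le_jm; rewrite -!bar_mapM (IHm i j.+1).
Qed.

(** Free pairs are projective for the counit, since images of variables can be chosen at will. Each
    variable goes to the variable named after the element that it represents. *)
Lemma bar_section P X Y : isomorphic (P : pair_cat) (free_pair X Y : pair_cat) ->
  exists t : pair_hom P (bar P), pair_comp (bar_eps P) t = pair_id P.
Proof.
case=> f [g [gf fg]].
pose t : pair_hom (free_pair X Y) (bar P) := @free_lift X Y (bar P)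
  (fun x => xvar _ (g (xvar _ x)))
  (fun y => yvar _ (mk_ielt (pair_homP g (yvar_ideal X y))))
  (fun y => yvar_ideal _ _).
exists (pair_comp t f); rewrite pair_compA -[RHS]gf; congr pair_comp.
apply: free_pair_ext => x; rewrite pair_compE.
  by rewrite free_lift_xvar bar_eps_x.
by rewrite free_lift_yvar bar_eps_y.
Qed.

(** The section is inserted innermost, next to [P], and therefore splits the last face. *)
Fixpoint bar_extra m P (t : pair_hom P (bar P)) :
    pair_hom (barn m P) (barn m.+1 P) :=
  if m is m'.+1 return pair_hom (barn m P) (barn m.+1 P)
  then bar_map (bar_extra m' t) else t.

Lemma bar_extra_last m P (t : pair_hom P (bar P)) :
  pair_comp (bar_eps P) t = pair_id P ->
  pair_comp (bar_face m m P) (bar_extra m t) = pair_id (barn m P).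
Proof.
by move=> tK; elim: m => //= m IHm; rewrite -bar_mapM IHm bar_map1.
Qed.

Lemma bar_extra_face m i P (t : pair_hom P (bar P)) : (i <= m)%N ->
  pair_comp (bar_face m.+1 i P) (bar_extra m.+1 t)
  = pair_comp (bar_extra m t) (bar_face m i P).
Proof.
elim: m i => [|m IHm] [|i] // le_im; try exact: bar_eps_nat.
by rewrite /= -!bar_mapM; congr bar_map; apply: IHm.
Qed.

(** * Comparison of resolutions *)

Section ExtraDegeneracy.
Variables (G : nat -> zmodType) (d : forall k, nat -> {additive G k.+1 -> G k}).
Variables (V : forall k, G k -> Prop) (h : forall k, {additive G k -> G k.+1}).
Hypothesis VN : forall k (x : G k), V x -> V (- x).
Hypothesis Vh : forall k x, V x -> V (h k x).

Lemma exact_first_extra :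
  (forall k x, d k 0 (h k x) = x) ->
  (forall k i x, (i <= k)%N -> d k.+1 i.+1 (h k.+1 x) = h k (d k i x)) ->
  forall k, chain_exact (bd d) V k.
Proof.
move=> d0h dh [|k] z Vz cz; exists (h _ z); try exact: Vh; rewrite /bd altSl d0h.
  by rewrite alt0 subr0.
rewrite (@eq_alt _ _ _ (fun i => h k (d k i z))) => [|i lt_i]; last exact: dh.
by rewrite -raddf_alt [alt _ _]cz raddf0 subr0.
Qed.

Lemma exact_last_extra :
  (forall k x, d k k (h k x) = x) ->
  (forall k i x, (i <= k)%N -> d k.+1 i (h k.+1 x) = h k (d k i x)) ->
  forall k, chain_exact (bd d) V k.
Proof.
move=> dkh dh k z Vz cz.
have bdh : bd d (h k z) = z *~ (-1) ^+ k.
  rewrite /bd altSr dkh; case: k z Vz cz => [|k] z Vz cz; first by rewrite alt0 add0r.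
  rewrite (@eq_alt _ _ _ (fun i => h k (d k i z))) => [|i lt_i]; last exact: dh.
  by rewrite -raddf_alt [alt _ _]cz raddf0 add0r.
exists (h k z *~ (-1) ^+ k).
  rewrite -signr_odd; case: (odd k); last exact: Vh.
  by rewrite expr1 mulrNz mulr1z; apply/VN/Vh.
by rewrite raddfMz /= bdh -mulrzA -expr2 sqrr_sign mulr1z.
Qed.
End ExtraDegeneracy.

(* In a double complex with exact rows, the kernels Z_m of the horizontal
   differential sit in short exact sequences 0 -> Z_(m+1) -> D_(m+1) -> Z_m -> 0
   of columns, which allows dimension shifting. *)
Section DoubleComplex.
Variable D : nat -> nat -> zmodType.
Variables (dh : forall m k, {additive D m.+1 k -> D m k})
          (dv : forall m k, {additive D m k.+1 -> D m k}).
Variable V : forall m k, D m k -> Prop.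
Hypothesis VB : forall m k (x y : D m k), V x -> V y -> V (x - y).
Hypothesis Vh : forall m k x, V x -> V (dh m k x).
Hypothesis dhh : forall m k x, dh m k (dh m.+1 k x) = 0.
Hypothesis dvv : forall m k x, dv m k (dv m k.+1 x) = 0.
Hypothesis Vv : forall m k x, V x -> V (dv m k x).
Hypothesis dhv : forall m k x, dh m k (dv m.+1 k x) = dv m k (dh m k.+1 x).
Hypothesis row_exact : forall k m,
  @chain_exact (fun m => D m k) (fun m => dh m k) (fun m => @V m k) m.
Hypothesis column_exact : forall m k,
  @chain_exact (D m.+1) (dv m.+1) (@V m.+1) k.

Lemma first_column_exact k : @chain_exact (D 0%N) (dv 0%N) (@V 0%N) k.
Proof.
(* The claim is strengthened to the columns of horizontal cycles for all [m], because the induction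
   on [k] lifts [v] along its row and so passes from [m] to m+1. *)
suff kernel_exact m v : V v ->
    @cycle (fun m => D m k) (fun m => dh m k) m v -> @cycle (D m) (dv m) k v ->
    exists2 a, V a & dv m k a = v /\
      @cycle (fun m => D m k.+1) (fun m => dh m k.+1) m a.
  by move=> v Vv0 cv; have [a Va []] := kernel_exact 0%N v Vv0 I cv; exists a.
have cyc_dh m' k' (x : D m'.+1 k') :
    @cycle (fun m => D m k') (fun m => dh m k') m' (dh m' k' x).
  by case: m' x => [//|m'] x; apply: dhh.
elim: k m v => [|k IHk] m v Vv0 chv cvv; have [b Vb def_v] := row_exact Vv0 chv.
  have [c Vc def_b] := @column_exact m 0%N b Vb I.
  by exists (dh m 1%N c); [apply: Vh|rewrite -dhv def_b].
have [|||a Va [dva cha]] := IHk m.+1 (dv m.+1 k b); first exact: Vv.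
- by rewrite /= dhv def_v.
- by case: (k) b {Vb def_v} => [//|k'] b; apply: dvv.
have [||c Vc def_c] := @column_exact m k.+1 (b - a); first exact: VB.
  by rewrite /= raddfB /= dva subrr.
exists (dh m k.+2 c); first exact: Vh.
by rewrite -dhv def_c raddfB /= def_v cha subr0.
Qed.
End DoubleComplex.

(** Indices of faces and degeneracies are plain natural numbers, so that shifting them needs no
    casts; the identities are imposed in the meaningful range only. *)
Record aug_simplicial (C : category) := AugSimplicial {
  level :> nat -> C;
  dface : forall k, nat -> hom (level k.+1) (level k);
  dgen : forall k, nat -> hom (level k.+1) (level k.+2);
  dface_dface : forall k i j, (i < j)%N -> (j <= k.+1)%N ->
    compose (dface k i) (dface k.+1 j) = compose (dface k j.-1) (dface k.+1 i);
  dface_dgen_lt : forall k i j, (i < j)%N -> (j <= k.+1)%N ->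
    compose (dface k.+2 i) (dgen k.+1 j) = compose (dgen k j.-1) (dface k.+1 i);
  dface_dgen : forall k j, (j <= k)%N ->
    compose (dface k.+1 j) (dgen k j) = idc (level k.+1);
  dfaceS_dgen : forall k j, (j <= k)%N ->
    compose (dface k.+1 j.+1) (dgen k j) = idc (level k.+1);
  dface_dgen_gt : forall k i j, (j.+1 < i)%N -> (i <= k.+2)%N ->
    compose (dface k.+2 i) (dgen k.+1 j) = compose (dgen k j) (dface k.+1 i.-1) }.

Definition map_aug (C D : category) (F : functor C D) (X : aug_simplicial C) :
  aug_simplicial D.
Proof.
apply: (@AugSimplicial D (fun k => F (X k)) (fun k i => fmap F (dface X k i))
  (fun k i => fmap F (dgen X k i))) => *; rewrite -!fmapM.
- by congr fmap; apply: dface_dface.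
- by congr fmap; apply: dface_dgen_lt.
- by rewrite dface_dgen ?fmap1.
- by rewrite dfaceS_dgen ?fmap1.
- by congr fmap; apply: dface_dgen_gt.
Defined.

Definition hom_fun (P Q : pair_cat) (f : hom P Q) : {additive pring P -> pring Q} :=
  pair_fun f.

Lemma hom_fun_part b (P Q : pair_cat) (f : hom P Q) x :
  part b x -> part b (hom_fun f x).
Proof. exact: part_hom. Qed.

Lemma hom_fun_comp (P Q S : pair_cat) (g : hom Q S) (f : hom P Q) x :
  hom_fun (compose g f) x = hom_fun g (hom_fun f x).
Proof. by []. Qed.

Section PairLevels.
Variable X : aug_simplicial pair_cat.

Definition dX k i := hom_fun (dface X k i).
Definition sX k i := hom_fun (dgen X k i).

Lemma dX_dX k i j : (i < j)%N -> (j <= k.+1)%N ->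
  forall x, dX k i (dX k.+1 j x) = dX k j.-1 (dX k.+1 i x).
Proof. by move=> ltij lej x; rewrite -!hom_fun_comp dface_dface. Qed.

Lemma dX_sX_lt k i j : (i < j)%N -> (j <= k.+1)%N ->
  forall x, dX k.+2 i (sX k.+1 j x) = sX k j.-1 (dX k.+1 i x).
Proof. by move=> ltij lej x; rewrite -!hom_fun_comp dface_dgen_lt. Qed.

Lemma dX_sX k j : (j <= k)%N -> forall x, dX k.+1 j (sX k j x) = x.
Proof. by move=> lej x; rewrite -!hom_fun_comp dface_dgen. Qed.

Lemma dXS_sX k j : (j <= k)%N -> forall x, dX k.+1 j.+1 (sX k j x) = x.
Proof. by move=> lej x; rewrite -!hom_fun_comp dfaceS_dgen. Qed.

Lemma dX_sX_gt k i j : (j.+1 < i)%N -> (i <= k.+2)%N ->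
  forall x, dX k.+2 i (sX k.+1 j x) = sX k j (dX k.+1 i.-1 x).
Proof. by move=> ltij lej x; rewrite -!hom_fun_comp dface_dgen_gt. Qed.

Definition aug_group k : zmodType := pring (X k).

Definition aug_exact b := forall k,
  chain_exact (@bd aug_group dX) (fun k => @part b (X k)) k.
End PairLevels.

Lemma aug_contraction b (X : aug_simplicial pair_cat) : aug_exact X b ->
  exists h, @contraction (aug_group X) (@dX X) (fun k => @part b (X k)) h.
Proof.
move=> ex; apply: exact_contraction ex => *.
- exact: dX_dX.
- exact: dX_sX_lt.
- exact: dX_sX.
- exact: dXS_sX.
- exact: dX_sX_gt.
- exact: partB.
- exact: part0.
- exact: part_hom.
- exact: part_hom.
Qed.

Lemma alt_exchange (M : zmodType) m n (a : nat -> nat -> M) :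
  alt m (fun i => alt n (fun j => a i j)) = alt n (fun j => alt m (fun i => a i j)).
Proof.
rewrite /alt (eq_bigr _ (fun i _ => mulrz_suml _ _ _ _)) exchange_big /=.
apply: eq_bigr => j _; rewrite mulrz_suml; apply: eq_bigr => i _.
by rewrite mulrzAC.
Qed.

Section Comparison.
Variable F : functor pair_cat pair_cat.

Definition Fmap (P Q : ring_pair) (f : pair_hom P Q) :
    {additive pring (F P) -> pring (F Q)} :=
  hom_fun (fmap F (f : @hom pair_cat P Q)).

Lemma FmapM (P Q S : ring_pair) (g : pair_hom Q S) (f : pair_hom P Q) x :
  Fmap g (Fmap f x) = Fmap (pair_comp g f) x.
Proof. by rewrite /Fmap -hom_fun_comp -fmapM. Qed.

Lemma Fmap1 (P : ring_pair) x : Fmap (pair_id P) x = x.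
Proof. by rewrite /Fmap -[pair_id P]/(idc (P : pair_cat)) fmap1. Qed.

Lemma Fmap_part b (P Q : ring_pair) (f : pair_hom P Q) x :
  part b x -> part b (Fmap f x).
Proof. exact: hom_fun_part. Qed.

Definition bar_group (P : ring_pair) m : zmodType := pring (F (barn m P)).

Definition bar_diff (P : ring_pair) m i :
    {additive bar_group P m.+1 -> bar_group P m} := Fmap (bar_face m i P).

Definition bar_exact b (P : ring_pair) := forall m,
  chain_exact (@bd (bar_group P) (@bar_diff P)) (fun m => @part b (F (barn m P))) m.

Lemma free_bar_exact b P X Y :
  isomorphic (P : pair_cat) (free_pair X Y : pair_cat) -> bar_exact b P.
Proof.
case/bar_section => t tK m.
apply: (@exact_last_extra (bar_group P) (@bar_diff P) _
  (fun m => Fmap (bar_extra m t))) => [k x|k x|k x|k i x le_ik].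
- by move=> bx; rewrite -sub0r; apply: partB => //; apply: part0.
- exact: Fmap_part.
- by rewrite /bar_diff FmapM bar_extra_last // Fmap1.
- by rewrite /bar_diff !FmapM bar_extra_face.
Qed.

Variable X : aug_simplicial pair_cat.
Hypothesis X_free : forall k, exists A B : choiceType,
  isomorphic (X k.+1) (free_pair A B : pair_cat).
Hypothesis X_exact : forall b, aug_exact X b.

Let D m k : zmodType := pring (F (barn m (X k))).
Let eh m k i : {additive D m.+1 k -> D m k} := Fmap (bar_face m i (X k)).
Let ev m k i : {additive D m k.+1 -> D m k} := Fmap (barn_map m (dface X k i)).
Let dh m k : {additive D m.+1 k -> D m k} :=
  @bd (fun m => D m k) (fun m i => eh m k i) m.
Let dv m k : {additive D m k.+1 -> D m k} :=
  @bd (D m) (fun k i => ev m k i) k.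

Let dhv m k x : dh m k (dv m.+1 k x) = dv m k (dh m k.+1 x).
Proof.
transitivity (alt m.+1 (fun i => alt k.+1 (fun j => eh m k i (ev m.+1 k j x)))).
  by apply: eq_alt => i _; rewrite -raddf_alt.
rewrite alt_exchange; apply: eq_alt => j _; rewrite raddf_alt.
by apply: eq_alt => i _; rewrite /eh /ev !FmapM bar_face_nat.
Qed.

Let dhh m k x : dh m k (dh m.+1 k x) = 0.
Proof.
apply: (@bd_bd (fun m => D m k)) => k' i j lt_ij le_j y.
by rewrite /eh !FmapM bar_face_face.
Qed.

Let dvv m k x : dv m k (dv m k.+1 x) = 0.
Proof.
apply: (@bd_bd (D m)) => k' i j lt_ij le_j y.
rewrite /ev !FmapM -!barn_mapM.
by rewrite (dface_dface X lt_ij le_j : pair_comp _ _ = pair_comp _ _).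
Qed.

(** After one application of [bar] the contraction of the resolution consists of morphisms of pairs,
    which survive [F]. The contraction [h] of the rings and the contraction [g] of the ideals are
    chosen independently and need not agree: elements of the ring and of the ideal name separate
    variables of [bar]. *)
Let column_exact b m k :
  @chain_exact (D m.+1) (dv m.+1) (fun k => @part b (F (barn m.+1 (X k)))) k.
Proof.
have [h [_ d0h dSh]] := aug_contraction (@X_exact false).
have [g [Vg d0g dSg]] := aug_contraction (@X_exact true).
pose g' k (x : ielt (X k)) : ielt (X k.+1) := mk_ielt (Vg k _ (ieltP x)).
pose c := fix c m k : pair_hom (barn m.+1 (X k)) (barn m.+1 (X k.+1)) :=
  if m is m'.+1 return pair_hom (barn m.+1 (X k)) (barn m.+1 (X k.+1))
  then bar_map (c m' k) else bar_set (h k) (@g' k).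
have c0 k' : pair_comp (barn_map m.+1 (dface X k' 0)) (c m k') = pair_id _.
  elim: m => [|m' IHm] /=; last by rewrite -bar_mapM IHm bar_map1.
  rewrite bar_set_comp -bar_set_id; apply: eq_bar_set => x; first exact: d0h.
  by apply: val_inj; apply: d0g; apply: ieltP.
have cS k' i : (i <= k')%N ->
    pair_comp (barn_map m.+1 (dface X k'.+1 i.+1)) (c m k'.+1) =
    pair_comp (c m k') (barn_map m.+1 (dface X k' i)).
  move=> le_ik; elim: m {c0} => [|m' IHm] /=; last by rewrite -!bar_mapM IHm.
  rewrite !bar_set_comp; apply: eq_bar_set => x; first exact: dSh.
  by apply: val_inj; apply: dSg => //; apply: ieltP.
apply: (@exact_first_extra (D m.+1) (fun k i => ev m.+1 k i) _
  (fun k => Fmap (c m k))) => [k' x|k' x|k' i x le_ik].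
- exact: Fmap_part.
- by rewrite /ev FmapM c0 Fmap1.
- by rewrite /ev !FmapM cS.
Qed.

Let row_exact b k m :
  @chain_exact (fun m => D m k.+1) (fun m => dh m k.+1)
    (fun m => @part b (F (barn m (X k.+1)))) m.
Proof. by have [A [B X_iso]] := X_free k; apply: free_bar_exact X_iso m. Qed.

Let part_dh b m k x : part b x -> part b (dh m k x).
Proof.
move=> bx; apply: alt_closed => [||i]; [exact: part0|exact: partB|].
exact: Fmap_part.
Qed.

Let part_dv b m k x : part b x -> part b (dv m k x).
Proof.
move=> bx; apply: alt_closed => [||i]; [exact: part0|exact: partB|].
exact: Fmap_part.
Qed.

(** In the double complex F(barn m (X k)), the part m = 0 is [F] of the resolution and the part k =
    0 is the bar construction. Where k is positive, the bar direction is exact since X k is free;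
    where m is positive, the other direction is exact by the set-level contractions. Both
    implications are the same lemma with the two directions exchanged. *)
Lemma comparison b : aug_exact (map_aug F X) b <-> bar_exact b (X 0%N).
Proof.
split=> ex k; last first.
  apply: (@first_column_exact D dh dv (fun m k => @part b (F (barn m (X k))))) => //.
  - by move=> *; apply: partB.
  - exact: part_dh.
  - exact: part_dv.
  - by case=> [|k'] m; [exact: (ex m)|exact: (@row_exact b k' m)].
apply: (@first_column_exact (fun k m => D m k) (fun k m => dv m k)
  (fun k m => dh m k) (fun k m => @part b (F (barn m (X k))))) => //.
- by move=> *; apply: partB.
- by move=> *; apply: part_dv.
- by move=> *; apply: part_dh.
- by case=> [|m] k'; [exact: (ex k')|exact: (@column_exact b m k')].
Qed.
End Comparison.

(** * Koszul complexes *)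

Section KoszulHomotopy.
Variables (B : comPzRingType) (r : nat) (f : 'I_r -> B).
Local Notation sgn i S := ((-1) ^+ #|[set j in S | (j < i)%N]|).
Implicit Types (x y : koszul B r) (S : {set 'I_r}).

Lemma koszul_d_additive : zmod_morphism (@koszul_d B r f).
Proof.
move=> x y; apply/ffunP => S; rewrite !ffunE -sumrB; apply: eq_bigr => i _.
by rewrite !ffunE mulrBr.
Qed.
HB.instance Definition _ :=
  GRing.isZmodMorphism.Build _ _ (@koszul_d B r f) koszul_d_additive.

Lemma sgn_setU1 (i k : 'I_r) S : k \notin S ->
  sgn i (k |: S) = (-1) ^+ (k < i)%N * sgn i S :> B.
Proof.
move=> kS; rewrite -exprD; congr (_ ^+ _).
case: ltnP => [lt_ki|le_ik].
  rewrite (_ : [set j in k |: S | _] = k |: [set j in S | (j < i)%N]).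
    by rewrite cardsU1 inE (negPf kS).
  apply/setP => j; rewrite !inE; have [->|] := eqVneq j k; first by rewrite lt_ki.
  by [].
rewrite add0n; congr (#|pred_of_set _|); apply/setP => j; rewrite !inE.
have [->|//] := eqVneq j k.
by rewrite ltnNge le_ik (negPf kS).
Qed.

(** The terms indexed by (i, k) and (k, i) are opposite: exactly one of the two orders of removal
    picks up an extra sign. *)
Lemma koszul_dd x : koszul_d f (koszul_d f x) = 0.
Proof.
apply/ffunP => S; rewrite !ffunE.
pose a (i k : 'I_r) : B := sgn i S * f i * (sgn k (i |: S) * f k * x (k |: (i |: S))).
pose c (i k : 'I_r) := (i \notin S) && (k \notin i |: S).
have c_sym i k : c i k = c k i.
  by rewrite /c !inE !negb_or (eq_sym i); case: (k == i); case: (i \in S); case: (k \in S).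
have a_sym i k : c i k -> a i k = - a k i.
  rewrite /c !inE negb_or => /and3P[iS ne_ki kS].
  rewrite /a setUCA !sgn_setU1 //.
  have -> : (-1) ^+ (i < k)%N = - (-1) ^+ (k < i)%N :> B.
    by case: ltngtP (ne_ki) => [||/val_inj->]; rewrite ?eqxx ?opprK.
  by ring.
transitivity (\sum_i \sum_(k | c i k) a i k).
  rewrite big_mkcond /=; apply: eq_bigr => i _; rewrite ffunE /c.
  by case: ifP => _; rewrite ?big_pred0_eq // big_distrr.
transitivity (\sum_i \sum_(k | c i k && (k < i)%N) a i k +
              \sum_i \sum_(k | c i k && ~~ (k < i)%N) a i k).
  by rewrite -big_split; apply: eq_bigr => i _; rewrite (bigID (fun k : 'I_r => (k < i)%N)).
apply/eqP; rewrite addrC addr_eq0 -sumrN; apply/eqP.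
rewrite (exchange_big_dep xpredT) //=; apply: eq_bigr => k _.
rewrite -sumrN; apply: eq_big => [i|i /andP[cik _]]; last by rewrite a_sym.
rewrite c_sym -leqNgt leq_eqVlt -[_ == _ :> nat]/(i == k) /c.
by case: eqP => [->|_] //=; rewrite !inE eqxx andbF ltnn andbF.
Qed.

Variable D : 'I_r -> {additive B -> B}.
Hypothesis D_f : forall i b, D i (f i * b) = b.
Hypothesis D_comm : forall i j b, i != j -> D i (f j * b) = f j * D i b.

(** [D i] is division by [f i], and [E i] is its remainder. *)
Let E i b := b - f i * D i b.

Let E_additive i : zmod_morphism (E i).
Proof. by move=> a b; rewrite /E raddfB; ring. Qed.
HB.instance Definition _ i := GRing.isZmodMorphism.Build _ _ (E i) (E_additive i).

Let h i x : koszul B r :=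
  [ffun S : {set 'I_r} => if i \in S then sgn i S * D i (x (S :\ i)) else 0].

Let retr i x : koszul B r :=
  [ffun S : {set 'I_r} => if i \in S then 0 else E i (x S)].

(** [h i] is a homotopy between the identity and the retraction onto chains that avoid [i] and have
    remainders mod [f i] as coefficients. The term with d applied before [h] drops out on cycles. *)
Let koszul_d_h i x : koszul_d f x = 0 -> koszul_d f (h i x) = x - retr i x.
Proof.
move=> dx0; apply/ffunP => S; rewrite !ffunE; case: ifPn => iS; last first.
  rewrite (bigD1 i) //= big1 => [|k /andP[kS ne_ki]].
    rewrite ffunE setU11 setU1K // sgn_setU1 // ltnn mul1r addr0.
    by rewrite /E subKr mulrCA !mulrA -expr2 sqrr_sign mul1r.
  by rewrite ffunE !inE eq_sym (negPf ne_ki) (negPf iS) mulr0.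
rewrite subr0; pose T := S :\ i.
have iT : i \notin T by rewrite !inE eqxx.
have defS : S = i |: T by rewrite setD1K.
(* Dividing the cycle condition at T by [f i] expresses the coefficient at S through those at k |: T
   for k outside S. *)
have /ffunP/(_ T)/(congr1 (D i)) := dx0; rewrite !ffunE (bigD1 i) //= -defS.
rewrite raddfD raddf0 raddf_sum /= -mulrA raddfMsign /= D_f => /eqP.
rewrite addr_eq0 => /eqP sxS.
have -> : x S = sgn i T * (sgn i T * x S).
  by rewrite mulrA -expr2 sqrr_sign mul1r.
rewrite sxS -sumrN big_distrr /=; apply: eq_big => [k|k kS].
  rewrite /T !inE.
  by case: eqVneq => [->|_] /=; rewrite ?iS ?andbF ?andbT.
have ne_ki : k != i by apply: contraNneq kS => ->.
have kT : k \notin T by rewrite /T !inE (negPf kS) andbF.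
rewrite ffunE !inE iS orbT.
have -> : (k |: S) :\ i = k |: T.
  by apply/setP => j; rewrite !inE; case: (eqVneq j k) => [->|_] //=; rewrite ne_ki.
have sS (j : 'I_r) : sgn j S = (-1) ^+ (i < j)%N * sgn j T :> B by rewrite defS sgn_setU1.
rewrite sgn_setU1 // !sS ltnn mul1r.
have -> : (-1) ^+ (i < k)%N = - (-1) ^+ (k < i)%N :> B.
  by case: ltngtP (ne_ki) => [||/val_inj->]; rewrite ?eqxx ?opprK.
rewrite -[_ * (D i _)]mulrA; set s1 := (-1) ^+ (k < i)%N.
have s1s1 : s1 * s1 = 1 :> B by rewrite -expr2 sqrr_sign.
transitivity (- (s1 * s1 * (sgn i T * sgn k T * f k * D i (x (k |: T))))).
  by ring.
rewrite s1s1 mul1r -!mulrA (raddfMsign (D i)) /= D_comm 1?eq_sym //.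
by rewrite mulrN.
Qed.

Let koszul_d_retr i x : koszul_d f x = 0 -> koszul_d f (retr i x) = 0.
Proof.
move=> dx0; rewrite -[retr i x](subKr x) -koszul_d_h // raddfB /= dx0 koszul_dd.
exact: subrr.
Qed.

(** Retracting along all indices in turn moves a cycle, within its homology class, to one that
    vanishes on every nonempty set; in positive degree this is zero. *)
Lemma koszul_regular_divisible : koszul_regular f.
Proof.
move=> p x p_gt0 deg_x dx0.
suff [y deg_y [z [deg_z dz0 z0 def_x]]] : exists2 y, koszul_degree p.+1 y &
    exists z, [/\ koszul_degree p z, koszul_d f z = 0,
      forall i S, i \in enum 'I_r -> i \in S -> z S = 0 & x = koszul_d f y + z].
  exists y => //; rewrite def_x [z](_ : _ = 0) ?addr0 //.
  apply/ffunP => S; rewrite ffunE; have [->|[i iS]] := set_0Vmem S.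
    by apply: deg_z; rewrite cards0 eq_sym -lt0n.
  by apply: z0 iS; rewrite mem_enum.
elim: (enum 'I_r) => [|i l [y deg_y [z [deg_z dz0 z0 def_x]]]].
  exists 0; first by move=> S _; rewrite ffunE.
  by exists x; split=> //; rewrite raddf0 add0r.
exists (y + h i z).
  move=> S neS; rewrite !ffunE deg_y // add0r; case: ifPn => // iS.
  rewrite deg_z ?raddf0 ?mulr0 //.
  by apply: contraNneq neS => <-; rewrite (cardsD1 i S) iS.
exists (retr i z); split.
- move=> S neS; rewrite ffunE deg_z //; case: ifP => // _; exact: raddf0.
- exact: koszul_d_retr.
- move=> j S; rewrite inE => /predU1P[->|jl] jS; rewrite ffunE ?jS //.
  by rewrite (z0 j) // raddf0 if_same.
- by rewrite raddfD /= koszul_d_h // def_x addrA subrK.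
Qed.
End KoszulHomotopy.

(* Both the resolution and, in positive degrees, the Koszul complexes are
   exact; this is the staircase argument in their double complex. *)
Section Staircase.
Variables (B : nat -> comPzRingType) (r : nat) (f : forall k, 'I_r -> B k).
Variable d : forall k, {additive B k.+1 -> B k}.
Hypothesis d_f : forall k i b, d k (f k.+1 i * b) = f k i * d k b.
Hypothesis dd : forall k b, d k (d k.+1 b) = 0.
Hypothesis d_exact : forall k, chain_exact d (fun _ _ => True) k.
Hypothesis f_regular : forall k, koszul_regular (f k).

Let dK k (x : koszul (B k.+1) r) : koszul (B k) r := [ffun S => d k (x S)].

Let dK_koszul_d k x : dK (koszul_d (f k.+1) x) = koszul_d (f k) (dK x).
Proof.
apply/ffunP => S; rewrite !ffunE raddf_sum; apply: eq_bigr => i _.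
by rewrite -!mulrA raddfMsign /= d_f ffunE.
Qed.

Let dK_exact k p (x : koszul (B k) r) : koszul_degree p x ->
  (forall S, cycle d (x S)) -> exists2 y, koszul_degree p y & dK y = x.
Proof.
move=> deg_x cx.
have /choice[y yP] S : exists b, d k b = x S /\ (#|S| != p -> b = 0).
  have [eqp|nep] := eqVneq #|S| p.
    by have [b _ db] := @d_exact k (x S) I (cx S); exists b.
  by exists 0; rewrite raddf0 deg_x.
exists [ffun S => y S] => [S|]; first by rewrite ffunE; case: (yP S).
by apply/ffunP => S; rewrite !ffunE; case: (yP S).
Qed.

Lemma koszul_stairs k p (v : koszul (B k) r) : koszul_degree p v ->
  (if k is k'.+1 return koszul (B k) r -> Prop then fun v => exists2 u,
     koszul_degree p.+1 u & koszul_d (f k') u = dK v else fun=> True) v ->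
  exists2 a, koszul_degree p a & exists2 b, koszul_degree p.+1 b &
    v = dK a + koszul_d (f k) b.
Proof.
elim: k p v => [|k IHk] p v deg_v cv.
  have [a deg_a def_v] := dK_exact deg_v (fun=> I).
  exists a => //; exists 0; first by move=> S _; rewrite ffunE.
  by rewrite raddf0 addr0.
have [u deg_u du] := cv.
have [|a deg_a [b deg_b def_u]] := IHk p.+1 u deg_u.
  case: k IHk v deg_v cv u deg_u du => [//|k] IHk v deg_v cv u deg_u du.
  (* One level down, the image of [u] is a Koszul cycle of positive degree p+1, so regularity
     provides the next stair. *)
  have [||w deg_w dw] := @f_regular k p.+1 (dK u) (ltn0Sn p).
  - by move=> S neS; rewrite ffunE deg_u // raddf0.
  - by rewrite -dK_koszul_d du; apply/ffunP => S; rewrite !ffunE dd.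
  by exists w.
have [||c deg_c def_c] := @dK_exact k.+1 p (v - koszul_d (f k.+1) a).
- move=> S neS; rewrite !ffunE deg_v // big1 ?subr0 // => i iS.
  by rewrite deg_a ?mulr0 // cardsU1 iS eqSS.
- move=> S; have /ffunP/(_ S) := du; rewrite def_u raddfD /= koszul_dd addr0 -dK_koszul_d.
  by rewrite !ffunE raddfB => <-; rewrite subrr.
exists c => //; exists a => //; by rewrite def_c subrK.
Qed.

Definition span k (x : B k) : Prop := exists b : 'I_r -> B k, x = \sum_i f k i * b i.

(** The bottom p = 0 of the staircase: since the levels are exact and the sequences regular, the
    complex of quotients by the span of [f] is exact too. *)
Lemma cycle_mod_span k (v : B k) :
  (if k is k'.+1 return B k -> Prop then fun v => span (d k' v) else fun=> True) v ->
  exists a, span (v - d k a).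
Proof.
pose at0 k (b : B k) : koszul (B k) r := [ffun S => if S == set0 then b else 0].
pose at1 k (b : 'I_r -> B k) : koszul (B k) r :=
  [ffun S => \sum_(i | S == [set i]) b i].
have at1E k' b i : at1 k' b [set i] = b i.
  rewrite ffunE (big_pred1 i) // => j; apply/eqP/eqP => [/set1_inj->//|->//].
have koszul_d_set0 k' (x : koszul (B k') r) :
    koszul_d (f k') x set0 = \sum_i f k' i * x [set i].
  rewrite ffunE; apply: eq_big => [i|i _]; first by rewrite inE.
  rewrite setU0 (_ : [set j in set0 | _] = set0) ?cards0 ?mul1r //.
  by apply/setP => j; rewrite !inE.
move=> cv; have [||a deg_a [b deg_b def_v]] := @koszul_stairs k 0 (at0 k v).
- by move=> S; rewrite cards_eq0 ffunE => /negPf->.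
- case: k v cv => [//|k] v [b def_dv]; exists (at1 k b).
    move=> S neS; rewrite ffunE big1 // => i /eqP defS.
    by rewrite defS cards1 in neS.
  apply/ffunP => S; have [->|S_neq0] := eqVneq S set0.
    rewrite koszul_d_set0 !ffunE eqxx def_dv; apply: eq_bigr => i _.
    by rewrite at1E.
  rewrite !ffunE (negPf S_neq0) raddf0 big1 // => i iS.
  rewrite ffunE big1 ?mulr0 // => j /eqP/setP eqS.
  have [l lS] := set0Pn _ S_neq0; have := eqS i; have := eqS l.
  rewrite !inE eqxx lS orbT => /esym/eqP eqlj /esym/eqP eqij.
  by rewrite eqij -eqlj lS in iS.
exists (a set0), (fun i => b [set i]).
have /ffunP/(_ set0) := def_v; rewrite !ffunE eqxx => ->.
by rewrite addrC addKr -koszul_d_set0 ffunE.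
Qed.
End Staircase.

(** * The bar resolution over a polynomial ring *)

Lemma generated_span (A : comPzRingType) r (f : 'I_r -> A) x :
  generated (fun y => exists i, y = f i) x <->
  exists b : 'I_r -> A, x = \sum_i f i * b i.
Proof.
split=> [[n [c [s [Ss ->]]]]|[b ->]]; last first.
  by exists r, b, f; split=> [i|]; [exists i|apply: eq_bigr => i _; rewrite mulrC].
have /choice[j sE] i : exists j, s i = f j by apply: Ss.
exists (fun k => \sum_(i | j i == k) c i).
under [RHS]eq_bigr do rewrite big_distrr /=.
rewrite (exchange_big_dep xpredT) //=; apply: eq_bigr => i _.
by rewrite (big_pred1 (j i)) // sE mulrC.
Qed.

(** * Division by a variable and Koszul-regularity of the variables *)

Section Division.
Variables (X : choiceType) (r : nat).
Local Notation P := (pring (free_pair X 'I_r)).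

Definition ydiv (i : 'I_r) : P -> P :=
  lin_ext (fun m => if m (inr i) == 0%N then 0 else mon (divcm m (ucm (inr i)))).
HB.instance Definition _ i := GRing.Additive.on (ydiv i).

Lemma ydiv_mon i (m : {cmonom (X + 'I_r)%type}) : ydiv i (mon m) =
  if m (inr i) == 0%N then 0 else mon (divcm m (ucm (inr i))).
Proof. exact: lin_ext_mon. Qed.

Lemma ydivK i b : ydiv i (yvar X i * b) = b.
Proof.
pose g b' : P := ydiv i (yvar X i * b').
apply: (@zmod_mpol_ext _ _ g id) => // [b1 b2|m].
  by rewrite /g mulrBr raddfB.
rewrite /g yvarE -monM ydiv_mon cmM cmU eqxx /=; congr mon.
by apply/eqP/cmP => v; rewrite divcmE cmM addKn.
Qed.

Lemma ydiv_comm i j b : i != j -> ydiv i (yvar X j * b) = yvar X j * ydiv i b.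
Proof.
move=> ne_ij; pose g1 b' : P := ydiv i (yvar X j * b').
pose g2 b' : P := yvar X j * ydiv i b'.
apply: (@zmod_mpol_ext _ _ g1 g2) => [b1 b2|b1 b2|m].
- by rewrite /g1 mulrBr raddfB.
- by rewrite /g2 raddfB mulrBr.
rewrite /g1 /g2 yvarE -monM !ydiv_mon cmM cmU.
rewrite (inj_eq inr_inj) [j == i]eq_sym (negPf ne_ij) add0n.
case: eqP => [_|/eqP mi]; first by rewrite mulr0.
rewrite -monM; congr mon; apply/eqP/cmP => v; rewrite divcmE !cmM divcmE addnBA //.
by rewrite cmU; case: eqP => // <-; rewrite lt0n.
Qed.

Lemma yvar_koszul_regular : koszul_regular (@yvar X 'I_r).
Proof.
apply: (@koszul_regular_divisible _ _ _ (fun i => ydiv i)).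
  exact: ydivK.
exact: ydiv_comm.
Qed.
End Division.

Section PolyBar.
Variable r : nat.

Definition ybar (P : ring_pair) : ring_pair := free_pair (pring P) 'I_r.

Definition ybar_map P Q (f : pring P -> pring Q) : pair_hom (ybar P) (ybar Q) :=
  @free_lift _ _ (ybar Q) (fun x => xvar _ (f x)) (fun i => yvar _ i)
    (fun i => yvar_ideal _ i).

Definition ybar_eps P (y : 'I_r -> pring P) (yP : forall i, pideal P (y i)) :
  pair_hom (ybar P) P := free_lift id yP.

Definition ybar_dup P : pair_hom (ybar P) (ybar (ybar P)) :=
  @free_lift _ _ (ybar (ybar P)) (fun x => xvar _ (xvar _ x)) (fun i => yvar _ i)
    (fun i => yvar_ideal _ i).

Lemma ybar_map_x P Q (f : pring P -> pring Q) x :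
  ybar_map f (xvar _ x) = xvar _ (f x).
Proof. exact: free_lift_xvar. Qed.

Lemma ybar_map_y P Q (f : pring P -> pring Q) i :
  ybar_map f (yvar _ i) = yvar _ i.
Proof. exact: free_lift_yvar. Qed.

Lemma ybar_eps_x P y yP x : @ybar_eps P y yP (xvar _ x) = x.
Proof. exact: free_lift_xvar. Qed.

Lemma ybar_eps_y P y yP i : @ybar_eps P y yP (yvar _ i) = y i.
Proof. exact: free_lift_yvar. Qed.

Lemma ybar_dup_x P x : ybar_dup P (xvar _ x) = xvar _ (xvar _ x).
Proof. exact: free_lift_xvar. Qed.

Lemma ybar_dup_y P i : ybar_dup P (yvar _ i) = yvar _ i.
Proof. exact: free_lift_yvar. Qed.

Definition ybarE := (pair_compE, ybar_map_x, ybar_map_y, ybar_eps_x, ybar_eps_y,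
  ybar_dup_x, ybar_dup_y).

Lemma ybar_mapM P Q S (g : pair_hom Q S) (f : pair_hom P Q) :
  pair_comp (ybar_map g) (ybar_map f) = ybar_map (pair_comp g f).
Proof. by apply: free_pair_ext => x; rewrite !ybarE. Qed.

Lemma ybar_map1 P : ybar_map (pair_id P) = pair_id (ybar P).
Proof. by apply: free_pair_ext => x; rewrite !ybarE. Qed.

Variables (A : comPzRingType) (I : ideal A) (f : 'I_r -> A).
Hypothesis fI : forall i, I (f i).

(** The bar construction for algebras over Z[y]: each level is the polynomial ring over Z[y] on the
    underlying set of the previous level. The variables y are kept and not taken as new
    generators. *)
Fixpoint yres k : ring_pair := if k is k'.+1 then ybar (yres k') else RingPair I.

(** The structure of a Z[y]-algebra on each level, preserved by all faces and degeneracies. *)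
Definition ypoint k : 'I_r -> pring (yres k) :=
  if k is k'.+1 return 'I_r -> pring (yres k) then fun i => yvar _ i else f.

Lemma ypointP k i : pideal (yres k) (ypoint k i).
Proof. by case: k => [|k]; [apply: fI|apply: yvar_ideal]. Qed.

Fixpoint yface k i : pair_hom (yres k.+1) (yres k) :=
  match k return pair_hom (yres k.+1) (yres k) with
  | 0 => ybar_eps (ypointP 0)
  | k'.+1 => if i is i'.+1 then ybar_map (yface k' i')
             else ybar_eps (ypointP k'.+1)
  end.

Fixpoint ydgen k i : pair_hom (yres k.+1) (yres k.+2) :=
  match k return pair_hom (yres k.+1) (yres k.+2) with
  | 0 => ybar_dup (yres 0)
  | k'.+1 => if i is i'.+1 then ybar_map (ydgen k' i') else ybar_dup (yres k'.+1)
  end.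

Lemma yface_point k i j : yface k i (ypoint k.+1 j) = ypoint k j.
Proof. by case: k i => [|k] [|i]; rewrite ?ybar_eps_y ?ybar_map_y. Qed.

Lemma yfaceSS k i : yface k.+1 i.+1 = ybar_map (yface k i).
Proof. by []. Qed.

Lemma ydgenSS k i : ydgen k.+1 i.+1 = ybar_map (ydgen k i).
Proof. by []. Qed.

Lemma yface0 k : yface k 0 = ybar_eps (ypointP k).
Proof. by case: k. Qed.

Lemma ydgen0 k : ydgen k 0 = ybar_dup (yres k).
Proof. by case: k. Qed.

Lemma ybar_eps_nat k k' (g : pair_hom (yres k) (yres k')) :
  (forall j, g (ypoint k j) = ypoint k' j) ->
  pair_comp (ybar_eps (ypointP k')) (ybar_map g) = pair_comp g (ybar_eps (ypointP k)).
Proof. by move=> g_y; apply: free_pair_ext => x; rewrite !ybarE ?g_y. Qed.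

Lemma ybar_dup_nat P Q (g : pair_hom P Q) :
  pair_comp (ybar_dup Q) (ybar_map g) = pair_comp (ybar_map (ybar_map g)) (ybar_dup P).
Proof. by apply: free_pair_ext => x; rewrite !ybarE. Qed.

Lemma yface_yface k i j : (i < j)%N -> (j <= k.+1)%N ->
  pair_comp (yface k i) (yface k.+1 j) = pair_comp (yface k j.-1) (yface k.+1 i).
Proof.
elim: k i j => [|k IHk] i [//|j] lt_ij le_jk.
  case: i lt_ij => [|i] lt_ij; last by lia.
  by case: j le_jk {lt_ij} => // _; apply: (@ybar_eps_nat 1 0 (yface 0 0)) => l; apply: (@yface_point 0 0).
case: i lt_ij => [_|i lt_ij].
  by apply: (@ybar_eps_nat k.+2 k.+1) => l; apply: (@yface_point k.+1).
case: j lt_ij le_jk => // j lt_ij le_jk.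
by rewrite !yfaceSS !ybar_mapM (IHk i j.+1).
Qed.

Lemma yface_ydgen k j : (j <= k)%N ->
  pair_comp (yface k.+1 j) (ydgen k j) = pair_id (yres k.+1).
Proof.
elim: k j => [|k IHk] [|j] // le_jk; last first.
  by rewrite yfaceSS ydgenSS ybar_mapM (IHk j) // ybar_map1.
all: rewrite yface0 ydgen0; apply: free_pair_ext => x; rewrite pair_compE.
all: by rewrite ?ybar_dup_x ?ybar_dup_y ?ybar_eps_x ?ybar_eps_y.
Qed.

Lemma yfaceS_ydgen k j : (j <= k)%N ->
  pair_comp (yface k.+1 j.+1) (ydgen k j) = pair_id (yres k.+1).
Proof.
elim: k j => [|k IHk] [|j] // le_jk; last first.
  by rewrite yfaceSS ydgenSS ybar_mapM (IHk j) // ybar_map1.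
all: rewrite yfaceSS yface0 ydgen0; apply: free_pair_ext => x; rewrite pair_compE.
all: by rewrite ?ybar_dup_x ?ybar_dup_y ?ybar_map_x ?ybar_map_y ?ybar_eps_x.
Qed.

Lemma yface_ydgen_lt k i j : (i < j)%N -> (j <= k.+1)%N ->
  pair_comp (yface k.+2 i) (ydgen k.+1 j) = pair_comp (ydgen k j.-1) (yface k.+1 i).
Proof.
have dgen_point k' i' l : ydgen k' i' (ypoint k'.+1 l) = ypoint k'.+2 l.
  by case: k' i' => [|k'] [|i']; rewrite ?ybar_dup_y ?ybar_map_y.
elim: k i j => [|k IHk] [|i] [|j] // lt_ij le_jk.
- by apply: (@ybar_eps_nat 1 2); apply: dgen_point.
- by move: lt_ij le_jk; lia.
- by apply: (@ybar_eps_nat k.+2 k.+3); apply: dgen_point.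
case: j lt_ij le_jk => // j lt_ij le_jk.
by rewrite !yfaceSS !ydgenSS !ybar_mapM (IHk i j.+1).
Qed.

Lemma yface_ydgen_gt k i j : (j.+1 < i)%N -> (i <= k.+2)%N ->
  pair_comp (yface k.+2 i) (ydgen k.+1 j) = pair_comp (ydgen k j) (yface k.+1 i.-1).
Proof.
elim: k i j => [|k IHk] [|[|i]] [|j] // lt_ji le_ik.
- by case: i lt_ji le_ik => // _ _; apply/esym/ybar_dup_nat.
- by move: lt_ji le_ik; lia.
- by apply/esym/ybar_dup_nat.
by rewrite !yfaceSS !ydgenSS !ybar_mapM (IHk i.+1 j).
Qed.

Definition yres_aug : aug_simplicial pair_cat :=
  @AugSimplicial pair_cat yres yface ydgen yface_yface yface_ydgen_lt
    yface_ydgen yfaceS_ydgen yface_ydgen_gt.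

Definition ybd k : {additive pring (yres k.+1) -> pring (yres k)} :=
  (@bd (aug_group yres_aug) (@dX yres_aug) k :
    {additive aug_group yres_aug k.+1 -> aug_group yres_aug k}).

(* On normalized cycles z |-> [z] - [0] serves as an extra degeneracy. *)
Lemma yres_exact_ring : aug_exact yres_aug false.
Proof.
apply: nexact_exact.
- exact: dX_dX.
- exact: dX_sX_lt.
- exact: dX_sX.
- exact: dXS_sX.
- exact: dX_sX_gt.
- by move=> *; apply: partB.
- by move=> *; apply: part0.
- by move=> *; apply: part_hom.
- by move=> *; apply: part_hom.
move=> k z _ dz0; exists (xvar _ z - xvar _ 0 : pring (yres k.+1)) => //.
split=> [|[//|i] le_ik]; rewrite raddfB /= /dX /hom_fun /=.
  by rewrite yface0 !ybar_eps_x subr0.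
case: k z dz0 le_ik => [//|k] z dz0 le_ik.
by rewrite !ybar_map_x [yface k i z]dz0 // rmorph0 subrr.
Qed.

Hypothesis f_generates : forall x, I x <-> generated (fun y => exists i, y = f i) x.
Hypothesis f_regular : koszul_regular f.

Lemma yres_idealP k x : pideal (yres k) x <-> span ypoint x.
Proof.
case: k x => [|k] x /=; first by rewrite f_generates generated_span.
have -> : (fun p => exists i, p = poly_var (inr i)) =
          (fun p => exists i, p = yvar (pring (yres k)) i).
  by rewrite yvar.unlock.
exact: generated_span.
Qed.

Lemma ybd_ybd k z : ybd k (ybd k.+1 z) = 0.
Proof. by apply: bd_bd; apply: dX_dX. Qed.

Lemma ybd_point k i b : ybd k (ypoint k.+1 i * b) = ypoint k i * ybd k b.
Proof.
rewrite /ybd /= /bd /alt big_distrr; apply: eq_bigr => j _.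
by rewrite /dX /hom_fun /= rmorphM yface_point mulrzAr.
Qed.

Lemma yres_cycle_mod_ideal k (v : pring (yres k)) :
  (if k is k'.+1 return pring (yres k) -> Prop
   then fun v => pideal (yres k') (ybd k' v) else fun=> True) v ->
  exists a, pideal (yres k) (v - ybd k a).
Proof.
move=> cv; have [||a av] := @cycle_mod_span (fun k => pring (yres k)) r ypoint
    ybd ybd_point ybd_ybd yres_exact_ring _ k v.
- by case=> [|k']; [apply: f_regular|apply: yvar_koszul_regular].
- by case: k v cv => [//|k] v /yres_idealP.
by exists a; apply/yres_idealP.
Qed.

(** A filler in the ring is a cycle modulo the ideal, hence a boundary modulo the ideal; subtracting
    that boundary moves the filler into the ideal. *)
Lemma yres_exact_ideal : aug_exact yres_aug true.
Proof.
move=> k z Iz cz; have [w _ def_z] := @yres_exact_ring k z Logic.I cz.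
have [|a Iwa] := @yres_cycle_mod_ideal k.+1 w; first by rewrite /ybd /= def_z.
exists (w - ybd k.+1 a) => //.
have := raddfB (ybd k) w (ybd k.+1 a); rewrite ybd_ybd subr0 => ->.
exact: def_z.
Qed.
End PolyBar.

(** * Weighted monomial ideals *)

Lemma generated_hom (A B : comPzRingType) (g : {rmorphism A -> B}) S T x :
  (forall y, S y -> generated T (g y)) -> generated S x -> generated T (g x).
Proof.
move=> ST [n [c [s [Ss ->]]]]; rewrite raddf_sum.
apply: (@ideal_sum _ (ideal_span T)) => i _.
by rewrite /= (rmorphM g); apply: (@idealM _ (ideal_span T)); apply: ST.
Qed.

Section Weighted.
Variable r : nat.
Local Notation expo := {ffun 'I_r -> nat}.
Implicit Types (a b : expo).

Definition ypow (B : comPzRingType) (y : 'I_r -> B) a : B := \prod_i y i ^+ a i.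

(** For the weights [cap N] this is G_N. General weights are allowed so that an induction can change
    them one monomial at a time. *)
Definition weighted (B : comPzRingType) (y : 'I_r -> B) (c : expo -> nat) : ideal B :=
  ideal_span (fun z => exists a, z = ypow y a *+ c a).

Lemma weighted_ypow (B : comPzRingType) (y : 'I_r -> B) c a : weighted y c (ypow y a *+ c a).
Proof. by apply: generated_mem; exists a. Qed.

Lemma weighted_sub (B : comPzRingType) (y : 'I_r -> B) c c' x :
  (forall a, c' a %| c a)%N -> weighted y c x -> weighted y c' x.
Proof.
move=> c'c; apply: generated_min => _ [a ->].
have /dvdnP[n ->] := c'c a; rewrite mulnC mulrnA -mulr_natl.
exact/idealM/weighted_ypow.
Qed.

Lemma ypow_hom (B B' : comPzRingType) (y : 'I_r -> B) (y' : 'I_r -> B')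
  (g : {rmorphism B -> B'}) a : (forall i, g (y i) = y' i) ->
  g (ypow y a) = ypow y' a.
Proof.
by move=> gy; rewrite rmorph_prod; apply: eq_bigr => i _; rewrite rmorphXn gy.
Qed.

Lemma weighted_hom (B B' : comPzRingType) (y : 'I_r -> B) (y' : 'I_r -> B')
  (g : {rmorphism B -> B'}) c x : (forall i, g (y i) = y' i) ->
  weighted y c x -> weighted y' c (g x).
Proof.
move=> gy; apply: generated_hom => _ [a ->].
by rewrite rmorphMn (ypow_hom _ gy); apply: generated_mem; exists a.
Qed.

Lemma ypowS (B : comPzRingType) (y : 'I_r -> B) a i :
  y i * ypow y a = ypow y [ffun j => (i == j) + a j]%N.
Proof.
rewrite /ypow (bigD1 i) //= [RHS](bigD1 i) //= mulrA -exprS ffunE eqxx; congr (_ * _).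
by apply: eq_bigr => j ne_ji; rewrite ffunE eq_sym (negPf ne_ji).
Qed.

(** One step of the filtration: lowering the weight at [a] to 1 adds only multiples of y^a to the
    ideal. *)
Lemma weighted_split (B : comPzRingType) (y : 'I_r -> B) c a x :
  weighted y (fun a' => if a' == a then 1%N else c a') x ->
  exists v, weighted y c (x - ypow y a * v).
Proof.
case=> m [g [s [Ss ->]]]; elim/big_ind: _ => [|x1 x2 [v1 cv1] [v2 cv2]|i _].
- by exists 0; rewrite mulr0 subrr; apply: ideal0.
- by exists (v1 + v2); rewrite mulrDr opprD addrACA; apply: idealD.
have [a' ->] := Ss i; case: eqP => [->|_].
  by exists (g i); rewrite mulr1n mulrC subrr; apply: ideal0.
by exists 0; rewrite mulr0 subr0; apply: idealM; apply: weighted_ypow.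
Qed.

Lemma weighted_ypow_span (B : comPzRingType) (y : 'I_r -> B) c a (g : 'I_r -> B) :
  (forall i, c [ffun j => (i == j) + a j]%N = 1%N) ->
  weighted y c (ypow y a * \sum_i y i * g i).
Proof.
move=> c1; rewrite mulr_sumr; apply: ideal_sum => i _.
rewrite (_ : _ * _ = g i * (y i * ypow y a)); last by ring.
apply: idealM; rewrite ypowS.
by have := weighted_ypow y c [ffun j => (i == j) + a j]%N; rewrite c1.
Qed.

Section MonomialCoefficient.
Variables (B : comPzRingType) (y : 'I_r -> B) (D : 'I_r -> {additive B -> B}).
Hypothesis D_y : forall i p, D i (y i * p) = p.
Hypothesis D_comm : forall i j p, i != j -> D i (y j * p) = y j * D i p.

Definition ydivs (l : seq 'I_r) a (p : B) : B :=
  foldr (fun i => iter (a i) (D i)) p l.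

Lemma ydivs_additive l a : zmod_morphism (ydivs l a).
Proof.
move=> p q; elim: l => //= i l ->; elim: (a i) => //= n ->.
by rewrite raddfB.
Qed.
HB.instance Definition _ l a := GRing.isZmodMorphism.Build _ _ (ydivs l a)
  (ydivs_additive l a).

Lemma iter_D_comm m n i j p : i != j ->
  iter m (D j) (y i ^+ n * p) = y i ^+ n * iter m (D j) p.
Proof.
move=> ne_ij.
have ydiv_commX q : D j (y i ^+ n * q) = y i ^+ n * D j q.
  elim: n => [|n IHn]; first by rewrite !expr0 !mul1r.
  by rewrite exprS -!mulrA D_comm 1?eq_sym //; congr (_ * _); apply: IHn.
elim: m => [//|m IHm]; rewrite !iterS -ydiv_commX; congr (D j _); exact: IHm.
Qed.

Lemma ydivs_comm l a i n p : i \notin l ->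
  ydivs l a (y i ^+ n * p) = y i ^+ n * ydivs l a p.
Proof.
elim: l => [//|j l IHl]; rewrite inE negb_or => /andP[ne_ij il].
transitivity (iter (a j) (D j) (y i ^+ n * ydivs l a p)).
  by congr iter; apply: IHl.
exact: iter_D_comm.
Qed.

Lemma iter_D_y n i p : iter n (D i) (y i ^+ n * p) = p.
Proof.
elim: n p => [|n IHn] p; first by rewrite expr0 mul1r.
by rewrite iterSr exprS -mulrA D_y.
Qed.

Lemma ydivsK l a p : uniq l -> ydivs l a (\prod_(i <- l) y i ^+ a i * p) = p.
Proof.
elim: l p => [|i l IHl] p /=; first by rewrite big_nil mul1r.
case/andP=> il ul; rewrite big_cons -mulrA ydivs_comm // IHl //.
exact: iter_D_y.
Qed.

Lemma ydivs_excess l a i p : uniq l -> i \in l ->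
  exists q, ydivs l a (y i ^+ (a i).+1 * p) = y i * q.
Proof.
elim: l => //= j l IHl /andP[jl ul]; rewrite inE.
have [eq_ij _|ne_ij /= il] := eqVneq i j.
  rewrite -eq_ij in jl *.
  exists (ydivs l a p); rewrite ydivs_comm // exprSr -mulrA.
  exact: iter_D_y.
have [q ->] := IHl ul il; exists (iter (a j) (D j) q).
by elim: (a j) => //= n ->; rewrite D_comm 1?eq_sym.
Qed.

Variables (rho : {rmorphism B -> B}) (J : ideal B).
Hypothesis rho_y : forall i, rho (y i) = 0.
Hypothesis rho_mod : forall p, J (p - rho p).

(* rho \o ydivs is the coefficient of the monomial y^a. *)
Lemma weighted_ypow_coef c a p :
  (forall b, (forall i, b i <= a i)%N -> (c a %| c b)%N) ->
  weighted y c (ypow y a * p) ->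
  exists u, J (p - u *+ c a).
Proof.
move=> c_anti; pose kappa q := rho (ydivs (enum 'I_r) a q).
have kappaK : kappa (ypow y a * p) = rho p.
  by rewrite /kappa /ypow -big_enum ydivsK // enum_uniq.
suff div_kappa q : weighted y c q -> exists u, kappa q = u *+ c a.
  case/div_kappa => u; rewrite kappaK => def_u; exists u.
  by rewrite -def_u; apply: rho_mod.
case=> n [f [s [Ss ->]]]; have kappa0 : kappa 0 = 0 by rewrite /kappa !raddf0.
elim/big_ind: _ => [|q1 q2 [u1 e1] [u2 e2]|i _].
- by exists 0; rewrite mul0rn.
- by exists (u1 + u2); rewrite /kappa !raddfD /= -/(kappa q1) e1 -/(kappa q2) e2 mulrnDl.
have [b ->] := Ss i; have [le_ba|] := boolP [forall j, (b j <= a j)%N].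
  have /dvdnP[k ->] := c_anti b (forallP le_ba).
  rewrite mulrnAr mulrnA; exists (kappa (f i * ypow y b *+ k)).
  by rewrite /kappa !raddfMn.
rewrite negb_forall => /existsP[j]; rewrite -ltnNge => lt_ab; exists 0.
rewrite mul0rn mulrnAr /kappa !raddfMn /=.
have -> : f i * ypow y b = y j ^+ (a j).+1 * (y j ^+ (b j - (a j).+1) *
    (f i * \prod_(k | k != j) y k ^+ b k)).
  rewrite mulrA -exprD subnKC // /ypow (bigD1 j) //=; ring.
have [|q' ->] := @ydivs_excess (enum 'I_r) a j (y j ^+ (b j - (a j).+1) *
    (f i * \prod_(k | k != j) y k ^+ b k)) (enum_uniq _); first by rewrite mem_enum.
by rewrite (rmorphM rho) rho_y mul0r mul0rn.
Qed.
End MonomialCoefficient.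

Section Free.
Variable X : choiceType.
Local Notation P := (pring (free_pair X 'I_r)).
Local Notation y := (@yvar X 'I_r).

Definition yzero : {rmorphism P -> P} := poly_eval (fun v : X + 'I_r =>
  match v with inl x => xvar 'I_r x | inr _ => 0 end).

Lemma yzero_x x : yzero (xvar _ x) = xvar _ x.
Proof. by rewrite {1}xvar.unlock; apply: poly_eval_var. Qed.

Lemma yzero_y i : yzero (y i) = 0.
Proof. by rewrite yvar.unlock; apply: poly_eval_var. Qed.

Lemma yzero_mod (p : P) : pideal (free_pair X 'I_r) (p - yzero p).
Proof.
pose J := pideal (free_pair X 'I_r).
elim/mpol_ind: p => [|p1 p2 IH1 IH2|m c].
- by rewrite rmorph0 subrr; apply: ideal0.
- by rewrite rmorphD opprD addrACA; apply: idealD.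
suff Jm : J (mon m - yzero (mon m)).
  by rewrite (raddfMz yzero) -mulrzBl -mulrzr mulrC; apply: idealM.
elim/cmonom_ind: m {c} => [|v m IHm].
  by rewrite mon1 (rmorph1 yzero) subrr; apply: ideal0.
rewrite monM; case: v => [x|i].
  by rewrite -xvarE (rmorphM yzero) yzero_x -mulrBr; apply: idealM.
rewrite -yvarE (rmorphM yzero) yzero_y mul0r subr0 mulrC; apply: idealM.
exact: yvar_ideal.
Qed.

Lemma ideal_yzero p : pideal (free_pair X 'I_r) p <-> yzero p = 0.
Proof.
split=> [[n [c [s [Ss ->]]]]|yp0]; last by rewrite -[p]subr0 -yp0; apply: yzero_mod.
rewrite raddf_sum big1 // => i _; have [j ->] := Ss i.
have := yzero_y j; rewrite yvar.unlock => yz.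
by rewrite /= (rmorphM yzero) yz mulr0.
Qed.

Lemma mpol_torsion_free (Z : choiceType) (p : mpol Z) n :
  (0 < n)%N -> p *+ n = 0 -> p = 0.
Proof.
move=> n_gt0 pn0; apply: coefP => m; rewrite raddf0.
have /eqP := congr1 (coef m) pn0; rewrite raddfMn raddf0 mulrn_eq0.
by rewrite (gtn_eqF n_gt0) => /eqP.
Qed.

Lemma ideal_torsion_free (p : P) n : (0 < n)%N ->
  pideal (free_pair X 'I_r) (p *+ n) -> pideal (free_pair X 'I_r) p.
Proof.
move=> n_gt0 /ideal_yzero; rewrite rmorphMn => /(mpol_torsion_free n_gt0) ?.
exact/ideal_yzero.
Qed.

End Free.

Lemma yvar_ypow_coef X c a p :
  (forall b, (forall i, b i <= a i)%N -> (c a %| c b)%N) ->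
  weighted (@yvar X 'I_r) c (ypow (@yvar X 'I_r) a * p) ->
  exists u, pideal (free_pair X 'I_r) (p - u *+ c a).
Proof.
move=> c_anti; apply: (@weighted_ypow_coef _ _ (fun i => ydiv i) _ _ (yzero X)) => //.
- exact: ydivK.
- exact: ydiv_comm.
- exact: yzero_y.
- exact: yzero_mod.
Qed.
End Weighted.

Lemma descent_identity (B : comPzRingType) (w a v b u : B) n :
  w - a * b = (w - a * v) + (a * (v - b - u *+ n) + u * (a *+ n)).
Proof. by rewrite -(mulr_natr u) -(mulr_natr a); ring. Qed.

(** * Acyclicity of weighted monomial ideals in the bar resolution *)

Section WeightedExact.
Variables (r : nat) (A : comPzRingType) (I : ideal A) (f : 'I_r -> A).
Hypothesis fI : forall i, I (f i).
Hypothesis f_generates : forall x, I x <-> generated (fun y => exists i, y = f i) x.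
Hypothesis f_regular : koszul_regular f.
Local Notation expo := {ffun 'I_r -> nat}.
Local Notation Y := (@yres r A I).
Local Notation ypt := (@ypoint r A I f).
Local Notation ybd := (@ybd r A I f fI).

Lemma ybd_ideal k x : pideal (Y k.+1) x -> pideal (Y k) (ybd k x).
Proof.
move=> Ix; apply: alt_closed => [|x' y'|i]; first exact: ideal0.
  exact: idealB.
exact: pair_homP.
Qed.

Lemma ybd_weighted k c x : weighted (ypt k.+1) c x -> weighted (ypt k) c (ybd k x).
Proof.
move=> cx; apply: alt_closed => [|x' y'|i]; first exact: ideal0.
  exact: idealB.
by apply: weighted_hom cx => j; apply: yface_point.
Qed.

Lemma ybd_ypow k a v : ybd k (ypow (ypt k.+1) a * v) = ypow (ypt k) a * ybd k v.
Proof.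
rewrite /ybd /= /bd /alt big_distrr; apply: eq_bigr => j _.
rewrite /dX /hom_fun /= rmorphM mulrzAr; congr (_ * _ *~ _).
by apply: ypow_hom => i; apply: yface_point.
Qed.

(* Modulo the ideal, Y is torsion free and acyclic in positive degrees, hence
   modulo the ideal and n it is acyclic in degrees at least 2. *)
Lemma yres_cycle_mod_ideal_nat k n (v : pring (Y k.+3)) u : (0 < n)%N ->
  pideal (Y k.+2) (ybd k.+2 v - u *+ n) ->
  exists v' u', pideal (Y k.+3) (v - ybd k.+3 v' - u' *+ n).
Proof.
move=> n_gt0 Ivu.
have Iu : pideal (Y k.+1) (ybd k.+1 u).
  have := idealN (ybd_ideal Ivu); rewrite raddfB raddfMn /= ybd_ybd sub0r opprK.
  exact: ideal_torsion_free.
have [u' Iu'] := @yres_cycle_mod_ideal _ _ _ _ fI f_generates f_regular k.+2 u Iu.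
have Iv : pideal (Y k.+2) (ybd k.+2 (v - u' *+ n)).
  have -> : ybd k.+2 (v - u' *+ n) =
      (ybd k.+2 v - u *+ n) + n%:R * (u - ybd k.+2 u').
    by rewrite raddfB raddfMn mulr_natl mulrnBl addrA subrK.
  exact/idealD/idealM.
have [v' Iv'] := @yres_cycle_mod_ideal _ _ _ _ fI f_generates f_regular k.+3 _ Iv.
by exists v', u'; rewrite addrAC.
Qed.

(** Induction on the number of weights different from 1, removing an exponent [a] of maximal degree.
    Maximality has two uses: every y_i y^a already has weight 1, so y^a times (y) stays in the
    ideal, and the weights remain antitone after the one at [a] is lowered. *)
Lemma weighted_exact (c : expo -> nat) (l : seq expo) :
  (forall a, 0 < c a)%N ->
  (forall a b : expo, (forall i, a i <= b i)%N -> (c b %| c a)%N) ->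
  (forall a, c a != 1%N -> a \in l) ->
  forall k (z : pring (Y k.+2)), weighted (ypt k.+2) c z -> ybd k.+1 z = 0 ->
  exists2 w : pring (Y k.+3), weighted (ypt k.+3) c w & ybd k.+2 w = z.
Proof.
have [n] := ubnP (size [seq a <- l | c a != 1%N]); elim: n c => // n IHn c le_cn.
move=> c_gt0 c_anti cl k z cz bz.
(* If all weights are 1, the monomial with exponent 0 makes the ideal the whole ring, which is
   exact. *)
have [[b bl cb]|noc] := EM (exists2 b, b \in l & c b != 1%N); last first.
  have [w _ def_z] := @yres_exact_ring _ _ _ _ fI k.+2 z Logic.I bz.
  exists w => //; have := weighted_ypow (ypt k.+3) c [ffun=> 0%N].
  have -> : c [ffun=> 0%N] = 1%N.
    apply/eqP; apply: contrapT => /negP c0; case: noc; exists [ffun=> 0%N] => //.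
    exact: cl.
  rewrite /ypow big1 => [|i _]; last by rewrite ffunE.
  by move/(idealM w); rewrite mulr1.
pose deg (a : expo) := (\sum_i a i)%N.
have [a al [ca max_a]] : exists2 a, a \in l & c a != 1%N /\
    forall a', (deg a < deg a')%N -> c a' = 1%N.
  pose s := [seq a <- l | c a != 1%N].
  have bs : b \in s by rewrite mem_filter cb.
  have [a as_ max_a] : exists2 a, a \in s & forall a', a' \in s -> (deg a' <= deg a)%N.
    elim: s {bs}(ex_intro (fun b => b \in s) b bs) => [[]//|a s IHs _].
    case: s IHs => [_|a2 s IHs].
      by exists a; rewrite ?inE // => a'; rewrite inE => /eqP->.
    have [|a3 a3s max_a3] := IHs; first by exists a2; rewrite inE eqxx.
    have [le_a|lt_a] := leqP (deg a) (deg a3).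
      exists a3; first by rewrite inE a3s orbT.
      by move=> a'; rewrite inE => /predU1P[->//|]; apply: max_a3.
    exists a; first by rewrite inE eqxx.
    move=> a'; rewrite inE => /predU1P[->//|/max_a3 le_a'].
    exact: leq_trans le_a' (ltnW lt_a).
  move: as_; rewrite mem_filter => /andP[ca al]; exists a => //; split=> // a' lt_a.
  apply/eqP; apply: contraLR lt_a => ca'; rewrite -leqNgt; apply: max_a.
  by rewrite mem_filter ca' cl.
pose c' a' := if a' == a then 1%N else c a'.
have c'_anti (a1 a2 : expo) : (forall i, a1 i <= a2 i)%N -> (c' a2 %| c' a1)%N.
  move=> le_a12; rewrite /c'; have [_|ne2] := eqVneq a2 a; first exact: dvd1n.
  have [eq1|_] := eqVneq a1 a; last exact: c_anti.
  rewrite eq1 in le_a12; rewrite max_a //.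
  have le_deg : (deg a <= deg a2)%N by apply: leq_sum.
  rewrite ltn_neqAle le_deg andbT; apply: contra_neqN ne2 => /eqP eq_deg.
  apply/ffunP => i; apply/eqP; rewrite eqn_leq le_a12 andbT leqNgt.
  apply/negP => lt_i; move: eq_deg; rewrite /deg => /eqP.
  rewrite eqn_leq leqNgt; case/andP=> _; apply/negP; rewrite -ltnNge.
  rewrite (bigD1 i) //= [X in (_ < X)%N](bigD1 i) //= -addSn leq_add //.
  by apply: leq_sum.
have [||||w c'w def_z] := IHn c' _ _ c'_anti _ k z _ bz.
- rewrite (_ : filter _ _ = filter (predC1 a) [seq a' <- l | c a' != 1%N]).
    rewrite ltnS in le_cn; apply: leq_trans le_cn.
    set s := [seq a' <- l | _]; rewrite size_filter ltn_neqAle count_size andbT.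
    rewrite -all_count; apply/allPn; exists a; first by rewrite /s mem_filter ca.
    by rewrite /= eqxx.
  rewrite -filter_predI; apply: eq_filter => a' /=; rewrite /c'.
  by case: (a' == a).
- by move=> a'; rewrite /c'; case: (a' == a).
- by move=> a'; rewrite /c'; case: (a' == a) => //; apply: cl.
- apply: weighted_sub cz => a'; rewrite /c'.
  by case: (a' == a) => //; apply: dvd1n.
have [v c_w] : exists v, weighted (ypt k.+3) c (w - ypow (ypt k.+3) a * v).
  exact: weighted_split c'w.
(* This element differs from [z] by the boundary of w - y^a v, so it lies in the ideal. Reading off
   its coefficient at y^a shows that [v] is a cycle modulo (y) and [c a]. *)
have cav : weighted (ypt k.+2) c (ypow (ypt k.+2) a * ybd k.+2 v).
  have := idealB cz (ybd_weighted c_w).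
  by rewrite raddfB /= def_z ybd_ypow subKr.
have [|u Iu] := yvar_ypow_coef _ cav; first by move=> a' le_a'; apply: c_anti.
have [v' [u' Iv']] := yres_cycle_mod_ideal_nat (c_gt0 a) Iu.
exists (w - ybd k.+3 (ypow (ypt k.+4) a * v')); last first.
  by rewrite raddfB /= ybd_ybd subr0.
rewrite ybd_ypow; set ya := ypow _ a; set t := v - _ - _ in Iv'.
(* The three summands lie in the ideal for separate reasons: the first by the choice of [v], the
   second since [t] is in (y) and every y_i y^a has weight 1, the third as a multiple of a
   generator. *)
have -> : w - ya * ybd k.+3 v' = (w - ya * v) + (ya * t + u' * (ya *+ c a)).
  exact: descent_identity.
apply: idealD => //; apply: idealD; last by apply: idealM; apply: weighted_ypow.
have /(yres_idealP f_generates) [g ->] := Iv'.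
apply: weighted_ypow_span => i; rewrite max_a // /deg.
rewrite (bigD1 i) //= [X in (_ < X)%N](bigD1 i) //= ffunE eqxx -addSn leq_add //.
by apply: leq_sum => j _; rewrite ffunE leq_addl.
Qed.
End WeightedExact.

(** * Divided powers *)

(** The quotient is the coefficient in [pd_comp]; it counts the partitions of a set of m(n+1)
    elements into [m] blocks of size n+1. *)
Lemma dvdn_fact_comp m n : (m`! * n.+1`! ^ m %| (m * n.+1)`!)%N.
Proof.
elim: m => [|m IHm]; first by rewrite mul0n.
have le_n : (n.+1 <= m.+1 * n.+1)%N by rewrite mulSn leq_addr.
have binE : ('C(m.+1 * n.+1, n.+1) = m.+1 * 'C((m.+1 * n.+1).-1, n))%N.
  apply/eqP; rewrite -(eqn_pmul2l (ltn0Sn n)) -mul_bin_diag mulnA.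
  by rewrite [(n.+1 * m.+1)%N]mulnC.
rewrite -(bin_fact le_n) binE factS expnS.
have -> : (m.+1 * n.+1 - n.+1 = m * n.+1)%N by rewrite mulSn addKn.
have [k ->] := dvdnP IHm.
apply/dvdnP; exists ('C((m.+1 * n.+1).-1, n) * k)%N; lia.
Qed.

Section RationalPD.
Variables (B : comPzRingType) (I : ideal B) (v : nat -> B).
Hypothesis vK : forall n, n`!%:R * v n = 1.

Definition rational_gamma n x := v n * x ^+ n.

Lemma v_bin m n : v m * v n = v (m + n)%N *+ 'C(m + n, m).
Proof.
have := bin_fact (leq_addr n m); rewrite addKn => fact_mn.
rewrite -[LHS]mul1r -(vK (m + n)) -fact_mn !natrM -[RHS]mulr_natr.
transitivity (v (m + n)%N * 'C(m + n, m)%:R * (m`!%:R * v m) * (n`!%:R * v n)).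
  by ring.
by rewrite !vK !mulr1.
Qed.

Lemma rational_pd : is_pd_structure I rational_gamma.
Proof.
have v0 : v 0 = 1 by have := vK 0; rewrite fact0 mul1r.
split=> [x _|x _|n x Ix|n x y _ _|n a x _|m n x _|m n x _]; rewrite /rational_gamma.
- by rewrite v0 mulr1.
- by have := vK 1; rewrite mul1r => ->; rewrite mul1r expr1.
- by apply: idealM; rewrite exprS mulrC; apply: idealM.
- rewrite addrC exprDn mulr_sumr; apply: eq_bigr => i _.
  have le_in : (i <= n)%N by rewrite -ltnS.
  have := v_bin i (n - i); rewrite subnKC // => vv.
  transitivity ((v i * v (n - i)%N) * (x ^+ i * y ^+ (n - i))); last by ring.
  by rewrite vv mulrnAr mulrnAl; congr (_ * _ *+ _); rewrite mulrC.
- by rewrite exprMn mulrCA.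
- transitivity ((v m * v n) * x ^+ (m + n)); first by rewrite exprD; ring.
  by rewrite v_bin mulrnAl.
rewrite exprMn -exprM mulrA -mulrnAl [(n.+1 * m)%N]mulnC; congr (_ * _).
have [q fact_q] := dvdnP (dvdn_fact_comp m n).
rewrite fact_q mulnK ?muln_gt0 ?expn_gt0 ?fact_gt0 //.
rewrite -[LHS]mul1r -(vK (m * n.+1)) fact_q !natrM natrX -[RHS]mulr_natr.
transitivity (v (m * n.+1)%N * q%:R * (m`!%:R * v m) * (n.+1`!%:R * v n.+1) ^+ m).
  by rewrite exprMn; ring.
by rewrite !vK expr1n !mulr1.
Qed.
End RationalPD.

(** A test object: maps into it detect which elements lie in the ideal of a free pair. *)
Lemma zero_ideal_pd (B : comPzRingType) (I : ideal B) : (forall x, I x -> x = 0) ->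
  is_pd_structure I (fun n x => if n is 0 then 1 else if n is 1 then x else 0).
Proof.
move=> I0; split=> [//|//|[|n] x Ix //|n x y /I0-> /I0->|n a x /I0->|m n x /I0->|m n x /I0->].
- exact: ideal0.
- rewrite big_ord_recl subn0 mul1r addr0 big1 ?addr0 => [|i _]; first by case: n => [|[]].
  by rewrite lift0; case: (i : nat) => [|j] /=; rewrite mul0r.
- by case: n => [|[|n]]; rewrite ?mulr0 ?expr0 ?mulr1.
- case: m => [|m]; first by rewrite mul1r add0n bin0.
  have m0 : (if m is 0 then 0 else 0) = 0 :> B by case: m.
  by rewrite addSn /= m0 mul0r; case: (m + n)%N => [|?]; rewrite mul0rn.
by case: m => [|[|m]] //; case: n => [|n]; rewrite ?mul0rn.
Qed.

Record subring (B : comPzRingType) := Subring {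
  in_subring :> B -> Prop;
  subring1 : in_subring 1;
  subringB : forall x y, in_subring x -> in_subring y -> in_subring (x - y);
  subringM : forall x y, in_subring x -> in_subring y -> in_subring (x * y) }.

Section SubringType.
Variables (B : comPzRingType) (S : subring B).

Definition subring_pred : {pred B} := fun x => `[< S x >].

Lemma subring_predP x : reflect (S x) (x \in subring_pred).
Proof. exact: asboolP. Qed.

Lemma subring_pred_closed : subring_closed subring_pred.
Proof.
split=> [|x y /subring_predP Sx /subring_predP Sy|x y /subring_predP Sx /subring_predP Sy];
  apply/subring_predP; [exact: subring1|exact: subringB|exact: subringM].
Qed.
Definition subring_type := {x : B | x \in subring_pred}.
HB.instance Definition _ := SubChoice.on subring_type.
HB.instance Definition _ := 
  GRing.SubChoice_isSubComPzRing.Build B subring_pred subring_type subring_pred_closed.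

Definition subring_val : {rmorphism subring_type -> B} := val.
End SubringType.

(** * Generation of the PD-envelope by divided powers *)

Section Envelope.
Variables (Env : functor pair_cat pd_pair_cat) (adj : left_adjoint Env forget_pd).

Definition env (P : ring_pair) : pd_pair := Env P.
Definition ering (P : ring_pair) : comPzRingType := pring (pd_base (env P)).
Definition eideal (P : ring_pair) : ideal (ering P) := pideal (pd_base (env P)).
Definition egamma (P : ring_pair) n : ering P -> ering P := @gamma (env P) n.
Definition eta (P : ring_pair) : pair_hom P (pd_base (env P)) := unit_at adj P.

Lemma env_lift (P : ring_pair) (D : pd_pair) (g : pair_hom P (pd_base D)) :
  exists h : pd_hom (env P) D, forall x, h (eta P x) = g x.
Proof.
have [h [hg _]] := unit_univ adj (c := P) (d := D) g.
by exists h => x; rewrite -hg.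
Qed.

Lemma env_ext (P : ring_pair) (D : pd_pair) (h1 h2 : pd_hom (env P) D) :
  (forall x, h1 (eta P x) = h2 (eta P x)) -> h1 =1 h2.
Proof.
move=> eq_h; have [h [_ h_uniq]] :=
  unit_univ adj (c := P) (d := D) (pair_comp (pd_fun h2) (eta P)).
suff -> : h1 = h2 by [].
by rewrite -(h_uniq h1) ?(h_uniq h2) //; apply: pair_hom_ext.
Qed.

Lemma eta_ideal P x : pideal P x -> eideal P (eta P x).
Proof. exact: pair_homP. Qed.

Section Generation.
Variables (P : ring_pair) (r : nat) (y : 'I_r -> pring P).
Hypothesis yP : forall i, pideal P (y i).
Hypothesis P_y : forall x, pideal P x -> exists b, x = \sum_i y i * b i.
Variable S : subring (ering P).
Hypothesis S_eta : forall p, S (eta P p).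
Hypothesis S_gamma : forall n i, S (egamma n (eta P (y i))).

Let T : comPzRingType := subring_type S.
Let vT : {rmorphism T -> ering P} := subring_val S.

Let mkT x (Sx : S x) : T := exist _ x (introT (subring_predP S x) Sx).

Let T_gens (t : T) := exists i n, vT t = egamma n.+1 (eta P (y i)).
Let KT : ideal T := ideal_span T_gens.

Let gen_ideal n i : eideal P (egamma n.+1 (eta P (y i))).
Proof. exact/(pd_ideal (gammaP (env P)))/eta_ideal. Qed.

Let KT_ideal t : KT t -> eideal P (vT t).
Proof.
case=> n [c [s [Ss ->]]]; rewrite rmorph_sum; apply: ideal_sum => i _.
have [j [m e]] := Ss i; rewrite rmorphM e.
exact/idealM/gen_ideal.
Qed.

Let KT_gamma n (t : T) : KT t -> exists2 t' : T, KT t' & vT t' = egamma n.+1 (vT t).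
Proof.
have pdP := gammaP (env P).
pose W (t : T) := KT t /\ forall n, exists2 t' : T, KT t' & vT t' = egamma n.+1 (vT t).
suff KW t0 : KT t0 -> W t0 by move=> /KW[_]; apply.
case=> m [c [s [Ss ->]]]; elim/big_ind: _ => [|t1 t2 [K1 W1] [K2 W2]|i _].
- split=> [|k]; first exact: ideal0.
  exists 0; first exact: ideal0.
  rewrite rmorph0; have := pdM pdP k.+1 0 (@ideal0 _ (eideal P)).
  by rewrite mulr0 expr0n mul0r /egamma => ->.
- split=> [|k]; first exact: idealD.
  (* The index 0 is exceptional, as the 0th divided power is 1 and need not lie in the ideal. In
     each term of the addition formula at least one of the two indices is positive. *)
  have /choice[u uP] j : exists t', vT t' = egamma j (vT t1) /\ (0 < j -> KT t')%N.
    case: j => [|j]; last by have [t' Kt' e] := W1 j; exists t'.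
    by exists 1; rewrite rmorph1 [egamma _ _](pd0 pdP) //; apply: KT_ideal.
  have /choice[w wP] j : exists t', vT t' = egamma j (vT t2) /\ (0 < j -> KT t')%N.
    case: j => [|j]; last by have [t' Kt' e] := W2 j; exists t'.
    by exists 1; rewrite rmorph1 [egamma _ _](pd0 pdP) //; apply: KT_ideal.
  exists (\sum_(j < k.+2) u j * w (k.+1 - j)%N).
    apply: ideal_sum => j _; case: (posnP j) => [->|j_gt0].
      by apply: idealM; case: (wP (k.+1 - 0)%N) => _; apply.
    by rewrite mulrC; apply: idealM; case: (uP j) => _; apply.
  rewrite rmorph_sum rmorphD [RHS](pdD pdP); try exact: KT_ideal.
  apply: eq_bigr => j _; rewrite rmorphM.
  by have [-> _] := uP j; have [-> _] := wP (k.+1 - j)%N.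
have [j [l e]] := Ss i; have Ksi : KT (s i) by apply: generated_mem.
split=> [|k]; first exact: idealM.
rewrite rmorphM e [egamma _ _](pdM pdP); last exact: gen_ideal.
rewrite -/(egamma _ _) [egamma k.+1 _](pd_comp pdP); last exact: eta_ideal.
set q := (_ %/ _)%N; set l' := (k.+1 * l.+1)%N.
(* The divided power of a multiple of a generator, computed by [pdM] and then [pd_comp], is again a
   multiple of a generator, of index (k+1)(l+1). *)
exists (c i ^+ k.+1 * (mkT (S_gamma l' j) *+ q)).
  rewrite mulrnAr -mulr_natl; do 2!apply: idealM.
  by apply: generated_mem; exists j, (l'.-1); rewrite prednK // muln_gt0.
by rewrite rmorphM rmorphXn rmorphMn.
Qed.
Let vT_inj : injective vT.
Proof. exact: val_inj. Qed.

Let T_pd : exists2 g : nat -> T -> T, is_pd_structure KT g &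
  forall n t, KT t -> vT (g n t) = egamma n (vT t).
Proof.
have pdP := gammaP (env P).
have /choice[g gP] n : exists g : T -> T, forall t, KT t -> vT (g t) = egamma n (vT t).
  suff /choice[g gP] (t : T) : exists t', KT t -> vT t' = egamma n (vT t) by exists g.
  have [Kt|nKt] := EM (KT t); last by exists 0.
  case: n => [|n]; last by have [t' _ e] := KT_gamma n Kt; exists t'.
  by exists 1 => _; rewrite rmorph1 [RHS](pd0 pdP) //; apply: KT_ideal.
have gK n t : KT t -> KT (g n.+1 t).
  by move=> Kt; have [t' Kt' e] := KT_gamma n Kt; rewrite (vT_inj (etrans (gP _ _ Kt) (esym e))).
exists g => //; split=> [t Kt|t Kt|n t Kt|n t u Kt Ku|n a t Kt|m n t Kt|m n t Kt].
- by apply: vT_inj; rewrite gP // rmorph1 [LHS](pd0 pdP) //; apply: KT_ideal.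
- by apply: vT_inj; rewrite gP // [LHS](pd1 pdP) //; apply: KT_ideal.
- exact: gK.
- apply: vT_inj; rewrite gP; last exact: idealD.
  rewrite rmorphD rmorph_sum [LHS](pdD pdP); try exact: KT_ideal.
  by apply: eq_bigr => i _; rewrite rmorphM !gP.
- apply: vT_inj; rewrite gP; last exact: idealM.
  by rewrite !rmorphM rmorphXn gP // [LHS](pdM pdP) //; apply: KT_ideal.
- apply: vT_inj; rewrite rmorphM rmorphMn !gP //.
  by rewrite [LHS](pd_mul pdP) //; apply: KT_ideal.
apply: vT_inj; rewrite rmorphMn !gP //; last exact: gK.
by rewrite [LHS](pd_comp pdP) //; apply: KT_ideal.
Qed.

(** The subring [S], with the ideal generated by the divided powers of the y_i, is itself a PD-pair
    under [P]. The map to it given by the universal property, followed by the inclusion, is the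
    identity by uniqueness; hence [S] and that ideal are everything. *)
Lemma env_generation : (forall e, S e) /\
  forall e, eideal P e ->
    generated (fun z => exists i n, z = egamma n.+1 (eta P (y i))) e.
Proof.
have [g g_pd gE] := T_pd.
pose D := @PDPair (RingPair KT) g g_pd.
pose toT p : T := mkT (S_eta p).
have toT_hom : {g : {rmorphism pring P -> T} | forall p, vT (g p) = eta P p}.
  have toTB : zmod_morphism toT.
    by move=> p q; apply: vT_inj; rewrite rmorphB -[LHS]/(eta P _) rmorphB.
  have toTM : monoid_morphism toT.
    by split=> [|p q]; apply: vT_inj; rewrite ?rmorph1 ?rmorphM -[LHS]/(eta P _) ?rmorph1 ?rmorphM.
  pose toTr := HB.pack_for {rmorphism pring P -> T} toT
    (GRing.isZmodMorphism.Build _ _ toT toTB) (GRing.isMonoidMorphism.Build _ _ toT toTM).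
  by exists toTr.
have [tT tTE] := toT_hom.
have tT_ideal x : pideal P x -> pideal (pd_base D) (tT x).
  case/P_y => b ->; rewrite rmorph_sum; apply: ideal_sum => i _.
  rewrite rmorphM mulrC; apply: idealM; apply: generated_mem; exists i, 0%N.
  by rewrite tTE [RHS](pd1 (gammaP (env P))) //; apply: eta_ideal.
have [h hE] := @env_lift P D (@PairHom P (RingPair KT) tT tT_ideal).
pose incl : pd_hom D (env P) := @PDHom D (env P)
  (@PairHom (RingPair KT) (pd_base (env P)) vT KT_ideal) gE.
have vh (e : ering P) : vT (pair_fun (pd_fun h) e : T) = e.
  apply: (@env_ext P (env P) (pd_hom_comp incl h) (pd_id (env P))) => x /=.
  by rewrite hE; apply: tTE.
split=> [e|e Je]; first by rewrite -(vh e); apply/subring_predP; apply: valP.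
rewrite -(vh e); have := pair_homP h Je; apply: generated_hom => t [i [n e_t]].
by apply: generated_mem; exists i, n.
Qed.
End Generation.
End Envelope.

(** * The envelope of a free pair *)

Lemma pd_pow (D : pd_pair) n x : pideal (pd_base D) x ->
  x ^+ n = @gamma D n x *+ n`!.
Proof.
move=> Dx; have pdP := gammaP D; elim: n => [|n IHn]; first by rewrite (pd0 pdP).
rewrite exprSr IHn mulrnAl -{2}(pd1 pdP Dx) (pd_mul pdP) // addn1 binSn.
by rewrite -mulrnA factS.
Qed.

Section GammaPowers.
Variables (Env : functor pair_cat pd_pair_cat) (adj : left_adjoint Env forget_pd).
Variables (P : ring_pair) (r : nat) (y : 'I_r -> pring P).
Hypothesis yP : forall i, pideal P (y i).
Local Notation expo := {ffun 'I_r -> nat}.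

Definition gpow (a : expo) : ering Env P :=
  \prod_i egamma (a i) (eta adj P (y i)).

Definition efact (a : expo) : nat := (\prod_i (a i)`!)%N.

Lemma efact_gt0 a : (0 < efact a)%N.
Proof. by apply: prodn_gt0 => i; apply: fact_gt0. Qed.

Lemma prod_mulrn (B : comPzRingType) (J : finType) (F : J -> B) (n : J -> nat) :
  \prod_j (F j *+ n j) = (\prod_j F j) *+ (\prod_j n j)%N.
Proof.
rewrite -[RHS]mulr_natr natr_prod -big_split /=; apply: eq_bigr => j _.
by rewrite mulr_natr.
Qed.

Lemma eta_ypow a : eta adj P (ypow y a) = gpow a *+ efact a.
Proof.
rewrite rmorph_prod /gpow /efact -prod_mulrn; apply: eq_bigr => i _.
by rewrite rmorphXn /= pd_pow //; apply: pair_homP.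
Qed.

Lemma gpowM a b : gpow a * gpow b =
  gpow [ffun i => a i + b i]%N *+ (\prod_i 'C(a i + b i, a i))%N.
Proof.
rewrite /gpow -big_split -prod_mulrn; apply: eq_bigr => i _; rewrite ffunE.
by apply: (pd_mul (gammaP (env Env P))); apply: pair_homP.
Qed.

Definition cap (N : nat) (a : expo) : nat := (N %/ gcdn N (efact a))%N.

(** Hence N' G_N is contained in G_(N N'), as needed for common denominators. *)
Lemma cap_mul N N' a : (cap (N * N') a %| cap N a * N')%N.
Proof.
have g_gt0 : (0 < gcdn N (efact a))%N by rewrite gcdn_gt0 efact_gt0 orbT.
have g'_gt0 : (0 < gcdn (N * N') (efact a))%N by rewrite gcdn_gt0 efact_gt0 orbT.
have gg' : (gcdn N (efact a) %| gcdn (N * N') (efact a))%N.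
  by rewrite dvdn_gcd dvdn_gcdr dvdn_mulr // dvdn_gcdl.
rewrite /cap -(dvdn_pmul2r g_gt0) mulnAC divnK ?dvdn_gcdl //.
rewrite -[X in (_ %| X)%N](divnK (dvdn_gcdl (N * N') (efact a))).
exact: dvdn_mul.
Qed.

(* y^a is a! times the divided power, and cap N a is the least factor that makes
   a! divisible by N. *)
Lemma weighted_lift N g : weighted y (cap N) g -> exists e, eta adj P g = e *+ N.
Proof.
case=> n [c [s [Ss ->]]]; rewrite rmorph_sum.
elim/big_ind: _ => [|x1 x2 [e1 ->] [e2 ->]|i _].
- by exists 0; rewrite mul0rn.
- by exists (e1 + e2); rewrite mulrnDl.
have [a ->] := Ss i; rewrite rmorphM rmorphMn eta_ypow -mulrnA.
have -> : (efact a * cap N a = efact a %/ gcdn N (efact a) * N)%N.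
  have : (0 < gcdn N (efact a))%N by rewrite gcdn_gt0 efact_gt0 orbT.
  rewrite /cap; move: (gcdn N _) (dvdn_gcdl N (efact a)) (dvdn_gcdr N (efact a)).
  by move=> t /dvdnP[p ->] /dvdnP[q ->] t_gt0; rewrite !mulnK //; lia.
by rewrite mulrnA mulrnAr; eexists.
Qed.
End GammaPowers.

(** The polynomial ring over the rationals, reduced to inverses of factorials and coefficient
    functionals. *)
Lemma rational_polynomials (Z : choiceType) : exists (B : comPzRingType)
    (v : nat -> B) (var : Z -> B) (cf : {cmonom Z} -> {additive B -> rat}),
  (forall n, n`!%:R * v n = 1) /\
  forall m m', cf m' (monom_eval var m) = (m == m')%:R.
Proof.
exists {malg rat[{cmonom Z}]}, (fun n => malgC (n`!%:R^-1 : rat)),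
  (fun z => << ucm z >>), (fun m => mcoeff m); split=> [n|m m'].
  by rewrite -mpolyC_nat -mpolyCM mulfV ?mpolyC1E // pnatr_eq0 -lt0n fact_gt0.
rewrite (_ : monom_eval _ m = << m >>); first by rewrite /= mcoeffU1.
elim/cmonom_ind: m => [|z m IHm]; first by rewrite monom_eval1 mpolyC1E.
transitivity (<< ucm z >> * << m >> : {malg rat[{cmonom Z}]}).
  by rewrite monom_evalM monom_evalU; congr (_ * _); exact: IHm.
by rewrite malgU_mul.
Qed.

Lemma common_denominator (B C : pzRingType) (g : {rmorphism B -> C}) b1 b2 c1 c2
  N1 N2 : g b1 = c1 *+ N1 -> g b2 = c2 *+ N2 ->
  g (N2%:R * b1 + N1%:R * b2) = (c1 + c2) *+ (N1 * N2).
Proof.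
move=> e1 e2; rewrite rmorphD !rmorphM !rmorph_nat e1 e2 mulrnDl !mulr_natl.
by rewrite -!mulrnA [(N2 * N1)%N]mulnC.
Qed.

Section FreeEnvelope.
Variables (Env : functor pair_cat pd_pair_cat) (adj : left_adjoint Env forget_pd).
Variables (X : choiceType) (r : nat).
Local Notation P := (free_pair X 'I_r).
Local Notation E := (ering Env P).
Local Notation y := (@yvar X 'I_r).
Local Notation expo := {ffun 'I_r -> nat}.
Local Notation monomial := {cmonom (X + 'I_r)%type}.
Local Notation gp := (gpow adj y).

Let yP i : pideal P (y i) := yvar_ideal X i.

(** Setting the y_i to 1 strips a monomial of its Y part. This separates the X part, which the
    envelope keeps, from the part that acquires divided powers. *)
Definition yone : {rmorphism pring P -> pring P} := poly_eval (fun v : X + 'I_r =>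
  match v with inl x => xvar 'I_r x | inr _ => 1 end).

Lemma yone_x x : yone (xvar _ x) = xvar _ x.
Proof. by rewrite {1}xvar.unlock; apply: poly_eval_var. Qed.

Lemma yone_y i : yone (y i) = 1.
Proof. by rewrite yvar.unlock; apply: poly_eval_var. Qed.

Definition yexp (m : monomial) : expo := [ffun i => m (inr i)].

Lemma yexpM m1 m2 : yexp (m1 * m2)%M = [ffun i => yexp m1 i + yexp m2 i]%N.
Proof. by apply/ffunP => i; rewrite !ffunE cmM. Qed.

Lemma yexp1 : yexp 1%M = [ffun=> 0%N].
Proof. by apply/ffunP => i; rewrite !ffunE cm1. Qed.

Lemma yexp_x x : yexp (ucm (inl x)) = [ffun=> 0%N].
Proof. by apply/ffunP => i; rewrite !ffunE cmU. Qed.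

Lemma yexp_y i : yexp (ucm (inr i)) = [ffun j => (i == j) : nat].
Proof. by apply/ffunP => j; rewrite !ffunE cmU. Qed.

Lemma ypow0 : ypow y [ffun=> 0%N] = 1.
Proof. by rewrite /ypow big1 // => i _; rewrite ffunE expr0. Qed.

Lemma mon_yone (m : monomial) : mon m = yone (mon m) * ypow y (yexp m).
Proof.
elim/cmonom_ind: m => [|v m IHm].
  by rewrite mon1 (rmorph1 yone) mul1r yexp1 ypow0.
rewrite monM (rmorphM yone) {1}IHm yexpM; case: v => [x|i].
  rewrite -xvarE yone_x yexp_x mulrA; congr (_ * ypow _ _).
  by apply/ffunP => i; rewrite !ffunE.
rewrite -yvarE yone_y yexp_y mul1r mulrCA ypowS; congr (_ * ypow _ _).
by apply/ffunP => j; rewrite !ffunE.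
Qed.

(** The expected basis of the envelope, a divided power algebra over Z[X]: the image of x^b y^a is
    x^b times the divided powers of the y_i with exponents [a]. The domain of [L] serves as the free
    abelian group on monomials, and [L] is additive but not multiplicative. *)
Definition Lmon (m : monomial) : E := eta adj P (yone (mon m)) * gp (yexp m).
Definition L : {additive pring P -> E} := lin_ext Lmon.

Lemma L_mon m : L (mon m) = Lmon m.
Proof. exact: lin_ext_mon. Qed.

Lemma gp0 : gp [ffun=> 0%N] = 1.
Proof.
rewrite /gpow big1 // => i _; rewrite ffunE.
by apply: (pd0 (gammaP (env Env P))); apply: pair_homP.
Qed.

Lemma LmonM m1 m2 : exists n, Lmon m1 * Lmon m2 = Lmon (m1 * m2)%M *+ n.
Proof.
exists (\prod_i 'C(yexp m1 i + yexp m2 i, yexp m1 i))%N.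
rewrite /Lmon mulrACA gpowM // mulrnAr yexpM monM (rmorphM yone) rmorphM.
by [].
Qed.

Lemma L_eta_mon m : eta adj P (mon m) = Lmon m *+ efact (yexp m).
Proof. by rewrite {1}mon_yone rmorphM eta_ypow // mulrnAr. Qed.

Let image (e : E) := exists p, e = L p.

Let image1 : image 1.
Proof.
exists (mon 1%M); rewrite L_mon /Lmon mon1 yexp1 gp0 (rmorph1 yone) rmorph1.
by rewrite mulr1.
Qed.

Let imageB e1 e2 : image e1 -> image e2 -> image (e1 - e2).
Proof. by move=> [p1 ->] [p2 ->]; exists (p1 - p2); rewrite raddfB. Qed.

Let imageMz e (c : int) : image e -> image (e *~ c).
Proof. by move=> [p ->]; exists (p *~ c); rewrite raddfMz. Qed.

Let imageD e1 e2 : image e1 -> image e2 -> image (e1 + e2).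
Proof. by move=> [p1 ->] [p2 ->]; exists (p1 + p2); rewrite raddfD. Qed.

Let image0 : image 0.
Proof. by exists 0; rewrite raddf0. Qed.

Let imageM e1 e2 : image e1 -> image e2 -> image (e1 * e2).
Proof.
move=> [p1 ->] [p2 ->]; elim/mpol_ind: p1 => [|p p' IH IH'|m c].
- by rewrite raddf0 mul0r.
- by rewrite raddfD mulrDl; apply: imageD.
rewrite raddfMz mulrzAl; apply: imageMz; rewrite (L_mon m).
elim/mpol_ind: p2 => [|p p' IH IH'|m' c'].
- by rewrite raddf0 mulr0.
- by rewrite raddfD mulrDr; apply: imageD.
rewrite raddfMz mulrzAr; apply: imageMz; rewrite (L_mon m').
have [n ->] := LmonM m m'; rewrite pmulrn; apply: imageMz.
by exists (mon (m * m')%M); rewrite L_mon.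
Qed.

Let image_eta p : image (eta adj P p).
Proof.
elim/mpol_ind: p => [|p p' IH IH'|m c]; first by rewrite raddf0.
  by rewrite raddfD; apply: imageD.
rewrite raddfMz; apply: imageMz; rewrite /= L_eta_mon pmulrn.
by apply: imageMz; exists (mon m); rewrite L_mon.
Qed.

Let image_gamma n i : image (egamma n (eta adj P (y i))).
Proof.
pose m := iter n (fun m : monomial => (ucm (inr i) * m)%M) 1%M.
have ym : yexp m = [ffun j => (i == j) * n]%N.
  rewrite /m; elim: (n) => [|k IHk] /=.
    by rewrite yexp1; apply/ffunP => j; rewrite !ffunE muln0.
  by rewrite yexpM IHk yexp_y; apply/ffunP => j; rewrite !ffunE mulnS.
have y1 : yone (mon m) = 1.
  rewrite /m; elim: (n) => [|k IHk]; first by rewrite mon1 (rmorph1 yone).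
  by rewrite iterS monM (rmorphM yone) -yvarE yone_y mul1r.
exists (mon m); rewrite L_mon /Lmon y1 rmorph1 mul1r ym /gpow (bigD1 i) //=.
rewrite ffunE eqxx mul1n big1 ?mulr1 // => j ne_ji; rewrite ffunE eq_sym (negPf ne_ji).
by apply: (pd0 (gammaP (env Env P))); apply: pair_homP.
Qed.

Lemma L_surj e : exists p, e = L p.
Proof.
pose S := Subring image1 imageB imageM.
have [|gen _] := @env_generation Env adj P r y yP _ S image_eta image_gamma.
  move=> x; rewrite -generated_span; congr generated; rewrite yvar.unlock.
  by [].
exact: (gen e).
Qed.

Lemma L_inj p : L p = 0 -> p = 0.
Proof.
have [B [v [var [cf [vK cfE]]]]] := rational_polynomials (X + 'I_r)%type.
pose D := @PDPair (RingPair (ideal_span (fun z => exists i, z = var (inr i)))) _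
  (rational_pd _ vK).
have var_ideal i : pideal (pd_base D) (var (inr i)) by apply: generated_mem; exists i.
pose g : pair_hom P (pd_base D) := @free_lift X 'I_r (pd_base D)
  (fun x => var (inl x)) (fun i => var (inr i)) var_ideal.
have gE m : g (mon m) = monom_eval var m.
  rewrite [LHS]poly_eval_mon; congr (monom_eval _ m).
  by apply/funext => -[].
have [h hE] := env_lift adj g.
(* In rational polynomials the image of [L] at a monomial is that monomial divided by the factorial
   of its Y exponents, so the coefficients of [p] can be recovered from [L p]. *)
pose psi m' (q : pring P) : rat := cf m' (h (L q)).
have psi_mon m m' : psi m' (mon m) *+ efact (yexp m) = (m == m')%:R.
  by rewrite -cfE -gE -hE L_eta_mon /psi L_mon !raddfMn.
have psiE m' : (fun q => psi m' q *+ efact (yexp m')) =1 (fun q => (coef m' q)%:~R).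
  apply: zmod_mpol_ext => [q1 q2|q1 q2|m].
  - by rewrite /psi !raddfB mulrnBl.
  - by rewrite raddfB rmorphB.
  rewrite coef_mon; have [<-|ne_m] := eqVneq m m'; first by rewrite psi_mon eqxx.
  have /eqP := psi_mon m m'; rewrite (negPf ne_m) mulrn_eq0.
  by rewrite (gtn_eqF (efact_gt0 _)) => /eqP->; rewrite mul0rn.
move=> Lp0; apply: coefP => m; rewrite raddf0; apply/eqP.
by rewrite -(intr_eq0 rat) -[_%:~R]psiE /psi Lp0 !raddf0 mul0rn.
Qed.

(** In the monomial basis and its image under [L], the unit is diagonal with the nonzero entries
    a!. *)
Lemma eta_free_inj (q : pring P) : eta adj P q = 0 -> q = 0.
Proof.
pose M := fun m : monomial => mon m *+ efact (yexp m).
have etaE : eta adj P q = L (lin_ext M q).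
  apply: (@zmod_mpol_ext _ _ (eta adj P) (fun q => L (lin_ext M q))) => [a b|a b|m].
  - exact: rmorphB.
  - by rewrite raddfB /= (raddfB L).
  by rewrite lin_ext_mon /M (raddfMn L) (L_mon m) -L_eta_mon.
rewrite etaE => /L_inj p0; apply: coefP => m; rewrite raddf0.
have : coef m (lin_ext M q) = coef m q *+ efact (yexp m).
  apply: (@zmod_mpol_ext _ _ (fun q => coef m (lin_ext M q))
    (fun q => coef m q *+ efact (yexp m))) => [a b|a b|m'].
  - by rewrite raddfB /= raddfB.
  - by rewrite raddfB mulrnBl.
  rewrite lin_ext_mon /M raddfMn /= coef_mon.
  by case: eqP => [->//|_]; rewrite !mul0rn.
rewrite p0 raddf0 => /esym/eqP; rewrite mulrn_eq0 (gtn_eqF (efact_gt0 _)).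
by move/eqP.
Qed.

Lemma env_free_torsion_free (e : E) n : (0 < n)%N -> e *+ n = 0 -> e = 0.
Proof.
have [p ->] := L_surj e; move=> n_gt0; rewrite -raddfMn => /L_inj.
by move/(mpol_torsion_free n_gt0)->; rewrite raddf0.
Qed.

Lemma env_free_denominator (e : E) : exists N g,
  [/\ (0 < N)%N, weighted y (cap N) g & eta adj P g = e *+ N].
Proof.
have [p ->] := L_surj e; elim/mpol_ind: p => [|p1 p2 IH1 IH2|m c].
- exists 1%N, 0; split=> //; first exact: ideal0.
  by rewrite !raddf0 mul0rn.
- have [N1 [g1 [N1_gt0 c1 e1]]] := IH1; have [N2 [g2 [N2_gt0 c2 e2]]] := IH2.
  have capM N N' g' : (0 < N)%N -> weighted y (cap N) g' ->
      weighted y (cap (N * N')) (N'%:R * g').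
    move=> N_gt0 [n [a [s [Ss ->]]]]; rewrite mulr_sumr; apply: ideal_sum => i _.
    have [b ->] := Ss i; rewrite mulrCA; apply: idealM.
    have /dvdnP[q cap_q] := cap_mul N N' b.
    rewrite mulr_natl -mulrnA cap_q [(q * _)%N]mulnC mulrnA -mulr_natl.
    apply: idealM.
    exact: weighted_ypow.
  exists (N1 * N2)%N, (N2%:R * g1 + N1%:R * g2); split.
  + by rewrite muln_gt0 N1_gt0.
  + by apply: idealD; [apply: capM|rewrite mulnC; apply: capM].
  by rewrite (raddfD L); apply: common_denominator.
exists (efact (yexp m)), (mon m *~ c); split; first exact: efact_gt0.
  have := weighted_ypow y (cap (efact (yexp m))) (yexp m).
  rewrite {2}/cap gcdnn divnn efact_gt0 mulr1n => /(idealM (yone (mon m) *~ c)).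
  by rewrite mulrzAl -mon_yone.
by rewrite !raddfMz /= L_eta_mon (L_mon m) !pmulrn mulrzAC.
Qed.

(** Surjectivity of the map that the unit induces between the quotients by the ideals: a basis
    element with a positive Y exponent lies in the PD-ideal. *)
Lemma env_free_mod_ideal (e : E) : exists q, eideal Env P (e - eta adj P q).
Proof.
have [p ->] := L_surj e; elim/mpol_ind: p => [|p1 p2 [q1 J1] [q2 J2]|m c].
- exists 0; rewrite (raddf0 L) (rmorph0 (eta adj P)) subrr.
  exact: (@ideal0 _ (eideal Env P)).
- exists (q1 + q2); rewrite (raddfD L) (rmorphD (eta adj P)) opprD addrACA.
  exact: idealD.
suff [q Jq] : exists q, eideal Env P (Lmon m - eta adj P q).
  exists (q *~ c); rewrite (raddfMz L) (raddfMz (eta adj P)) (L_mon m) -mulrzBl.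
  rewrite -mulrzr mulrC.
  exact: idealM.
have [m0|[i mi]] : (yexp m = [ffun=> 0%N]) \/ exists i, yexp m i != 0%N.
- have [ex|nex] := EM (exists i, yexp m i != 0%N); first by right.
  left; apply/ffunP => i; rewrite [RHS]ffunE; apply/eqP/negPn/negP => mi.
  by apply: nex; exists i.
- exists (yone (mon m)); rewrite /Lmon m0 gp0 mulr1 subrr; exact: ideal0.
exists 0; rewrite (rmorph0 (eta adj P)) subr0 /Lmon /gpow (bigD1 i) //= mulrCA mulrC.
apply: idealM; case: (yexp m i) mi => // n _.
apply: (pd_ideal (gammaP (env Env P))); exact: pair_homP.
Qed.

(** Injectivity of the same map: the endomorphism killing the y_i extends to the envelope because
    the zero ideal carries a PD-structure. *)
Lemma eta_ideal_free q : eideal Env P (eta adj P q) -> pideal P q.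
Proof.
pose Z : ideal (pring P) := ideal_span (fun z => z = 0).
have Z0 x : Z x -> x = 0.
  by case=> n [c [s [Ss ->]]]; rewrite big1 // => i _; rewrite Ss mulr0.
pose D := @PDPair (RingPair Z) _ (zero_ideal_pd Z0).
have gZ x : pideal P x -> pideal (pd_base D) (yzero r X x).
  by move/ideal_yzero->; apply: generated_mem.
have [h hE] := env_lift adj (D := D) (@PairHom P (RingPair Z) (yzero r X) gZ).
by move=> Jq; apply/ideal_yzero; have /Z0 := pair_homP h Jq; rewrite hE.
Qed.
End FreeEnvelope.

(** * Quotient rings *)

Section QuotientRing.
Local Open Scope quotient_scope.
Variables (B : comPzRingType) (K : ideal B).

Definition eqmod_ideal (x y : B) : bool := `[< K (x - y) >].

Lemma eqmod_idealP x y : reflect (K (x - y)) (eqmod_ideal x y).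
Proof. exact: asboolP. Qed.

Lemma eqmod_ideal_equiv : equiv_class_of eqmod_ideal.
Proof.
split=> [x|x y|y x z].
- by apply/eqmod_idealP; rewrite subrr; apply: ideal0.
- by apply/eqmod_idealP/eqmod_idealP => /idealN; rewrite opprB.
move=> /eqmod_idealP Kxy /eqmod_idealP Kyz; apply/eqmod_idealP.
by rewrite -[x](subrK y) -addrA; apply: idealD.
Qed.
Canonical eqmod_ideal_rel := EquivRelPack eqmod_ideal_equiv.
Canonical eqmod_ideal_direct := defaultEncModRel eqmod_ideal.

Definition qring := {eq_quot eqmod_ideal}.
HB.instance Definition _ := EqQuotient.on qring.
HB.instance Definition _ := Choice.on qring.

Definition qpi (x : B) : qring := \pi_qring x.

Lemma qpiP x y : qpi x = qpi y <-> K (x - y).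
Proof. by split=> [/eqmodP/eqmod_idealP|Kxy]; last exact/eqmodP/eqmod_idealP. Qed.

Lemma qpi_ind (P : qring -> Prop) : (forall x, P (qpi x)) -> forall c, P c.
Proof. by move=> Pq c; rewrite -[c]reprK; apply: Pq. Qed.

Lemma qpi_repr x : K (repr (qpi x) - x).
Proof. by apply/qpiP; rewrite /qpi reprK. Qed.

Definition qadd (c d : qring) := qpi (repr c + repr d).
Definition qopp (c : qring) := qpi (- repr c).
Definition qmul (c d : qring) := qpi (repr c * repr d).

Lemma qaddE x y : qadd (qpi x) (qpi y) = qpi (x + y).
Proof.
by apply/qpiP; rewrite opprD addrACA; apply: idealD; apply: qpi_repr.
Qed.

Lemma qoppE x : qopp (qpi x) = qpi (- x).
Proof. by apply/qpiP; rewrite -opprD; apply/idealN/qpi_repr. Qed.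

Lemma qmulE x y : qmul (qpi x) (qpi y) = qpi (x * y).
Proof.
apply/qpiP; set x' := repr _; set y' := repr _.
have -> : x' * y' - x * y = x' * (y' - y) + y * (x' - x) by ring.
by apply: idealD; apply: idealM; apply: qpi_repr.
Qed.

Lemma qaddA : associative qadd.
Proof.
by elim/qpi_ind => x; elim/qpi_ind => y; elim/qpi_ind => z; rewrite !qaddE addrA.
Qed.
Lemma qaddC : commutative qadd.
Proof. by elim/qpi_ind => x; elim/qpi_ind => y; rewrite !qaddE addrC. Qed.
Lemma qadd0 : left_id (qpi 0) qadd.
Proof. by elim/qpi_ind => x; rewrite qaddE add0r. Qed.
Lemma qaddN : left_inverse (qpi 0) qopp qadd.
Proof. by elim/qpi_ind => x; rewrite qoppE qaddE addNr. Qed.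
HB.instance Definition _ := GRing.isZmodule.Build qring qaddA qaddC qadd0 qaddN.

Lemma qmulA : associative qmul.
Proof.
by elim/qpi_ind => x; elim/qpi_ind => y; elim/qpi_ind => z; rewrite !qmulE mulrA.
Qed.
Lemma qmulC : commutative qmul.
Proof. by elim/qpi_ind => x; elim/qpi_ind => y; rewrite !qmulE mulrC. Qed.
Lemma qmul1 : left_id (qpi 1) qmul.
Proof. by elim/qpi_ind => x; rewrite qmulE mul1r. Qed.
Lemma qmulDl : left_distributive qmul +%R.
Proof.
elim/qpi_ind => x; elim/qpi_ind => y; elim/qpi_ind => z.
by rewrite -[_ + _]/(qadd _ _) -[RHS]/(qadd _ _) !(qaddE, qmulE) mulrDl.
Qed.
HB.instance Definition _ := GRing.Zmodule_isComPzRing.Build qring qmulA qmulC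
  qmul1 qmulDl.

Lemma qpiB : zmod_morphism qpi.
Proof.
move=> x y; rewrite -[RHS]/(qadd (qpi x) (qopp (qpi y))).
by rewrite qoppE qaddE.
Qed.
Lemma qpiM : monoid_morphism qpi.
Proof. by split=> // x y; rewrite -[RHS]/(qmul _ _) qmulE. Qed.
HB.instance Definition _ := GRing.isZmodMorphism.Build B qring qpi qpiB.
HB.instance Definition _ := GRing.isMonoidMorphism.Build B qring qpi qpiM.

Lemma qpi_eq0 x : qpi x = 0 <-> K x.
Proof. by rewrite -[x in K x]subr0 -qpiP. Qed.
End QuotientRing.

(* g is a homomorphism only modulo K. *)
Lemma quotient_pd (D : pd_pair) (K : ideal (pring (pd_base D))) :
  (forall n x x', pideal (pd_base D) x -> pideal (pd_base D) x' -> K (x - x') ->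
    K (@gamma D n x - @gamma D n x')) ->
  exists (Q : pd_pair) (p : pd_hom D Q),
    (forall x, p x = 0 <-> K x) /\
    forall (R : ring_pair) (g : pring R -> pring (pd_base D)),
      (forall a b, K (g (a - b) - (g a - g b))) ->
      (forall a b, K (g (a * b) - g a * g b)) -> K (g 1 - 1) ->
      (forall a, pideal R a -> exists2 x, pideal (pd_base D) x & K (g a - x)) ->
      exists h : pair_hom R (pd_base Q), forall a, h a = p (g a).
Proof.
move=> K_gamma; have pdP := gammaP D; set J := pideal (pd_base D) in K_gamma *.
pose pi : {rmorphism _ -> qring K} := qpi K.
have piP x y : pi x = pi y <-> K (x - y) by apply: qpiP.
pose JQ (c : qring K) := exists2 x, J x & c = pi x.
have JQ0 : JQ 0 by exists 0; [apply: ideal0|rewrite rmorph0].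
have JQD c d : JQ c -> JQ d -> JQ (c + d).
  by move=> [x Jx ->] [y Jy ->]; exists (x + y); [apply: idealD|rewrite rmorphD].
have JQM a c : JQ c -> JQ (a * c).
  elim/qpi_ind: a => a [x Jx ->]; exists (a * x); first exact: idealM.
  by rewrite (rmorphM pi).
pose IQ := Ideal JQ0 JQD JQM.
have /choice[gq gqP] (nc : nat * qring K) : exists e, forall x, J x -> nc.2 = pi x ->
    e = pi (@gamma D nc.1 x).
  case: nc => n c /=; have [[x Jx c_x]|nJ] := EM (JQ c); last first.
    by exists 0 => x Jx c_x; case: nJ; exists x.
  by exists (pi (@gamma D n x)) => x' Jx' c_x'; apply/piP/K_gamma => //; apply/piP; rewrite -c_x.
have gqE n x : J x -> gq (n, pi x) = pi (@gamma D n x) by move=> Jx; apply: (gqP (n, pi x)).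
have Q_pd : is_pd_structure IQ (fun n c => gq (n, c)).
  split=> [_ [x Jx ->]|_ [x Jx ->]|n _ [x Jx ->]|n _ _ [x Jx ->] [y Jy ->]|
           n a _ [x Jx ->]|m n _ [x Jx ->]|m n _ [x Jx ->]].
  - by rewrite gqE // (pd0 pdP) // rmorph1.
  - by rewrite gqE // (pd1 pdP).
  - by rewrite gqE //; exists (@gamma D n.+1 x) => //; apply: (pd_ideal pdP).
  - rewrite -rmorphD gqE; last exact: idealD.
    rewrite (pdD pdP) // rmorph_sum; apply: eq_bigr => i _.
    by rewrite rmorphM !gqE.
  - elim/qpi_ind: a => a; rewrite -[qpi K a]/(pi a) -rmorphM gqE; last exact: idealM.
    by rewrite (pdM pdP) // rmorphM rmorphXn gqE.
  - by rewrite !gqE // -rmorphM (pd_mul pdP) // rmorphMn.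
  rewrite gqE // gqE; last exact: (pd_ideal pdP).
  by rewrite (pd_comp pdP) // rmorphMn gqE.
pose Q := @PDPair (RingPair IQ) _ Q_pd.
have piJ x : J x -> JQ (pi x) by exists x.
pose p : pd_hom D Q := @PDHom D Q (@PairHom (pd_base D) (RingPair IQ) pi piJ)
  (fun n x Jx => esym (gqE n x Jx)).
exists Q, p; split=> [x|R g gB gM g1 gI]; first exact: qpi_eq0.
pose g' a : qring K := pi (g a).
have g'B : zmod_morphism g' by move=> a b; rewrite /g' -rmorphB; apply/piP.
have g'M : monoid_morphism g'.
  by split=> [|a b]; rewrite /g' -?rmorphM -?(rmorph1 pi); apply/piP.
pose gr := HB.pack_for {rmorphism pring R -> qring K} g'
  (GRing.isZmodMorphism.Build _ _ g' g'B) (GRing.isMonoidMorphism.Build _ _ g' g'M).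
have grI a : pideal R a -> IQ (gr a).
  by move/gI => [x Jx Kx]; exists x => //; apply/piP.
by exists (@PairHom R (RingPair IQ) gr grI).
Qed.

(** * The envelope of the bar resolution *)

Definition pd_ring_functor (Env : functor pair_cat pd_pair_cat) :
  functor pair_cat pair_cat := comp_functor forget_pd Env.

Section EnvelopeExact.
Variables (Env : functor pair_cat pd_pair_cat) (adj : left_adjoint Env forget_pd).
Variables (r : nat) (A : comPzRingType) (I : ideal A) (f : 'I_r -> A).
Hypothesis fI : forall i, I (f i).
Hypothesis f_generates : forall x, I x <-> generated (fun y => exists i, y = f i) x.
Hypothesis f_regular : koszul_regular f.
Local Notation expo := {ffun 'I_r -> nat}.
Local Notation Y := (@yres r A I).
Local Notation ypt := (@ypoint r A I f).
Local Notation ybd := (@ybd r A I f fI).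
Local Notation F := (pd_ring_functor Env).
Local Notation E k := (ering Env (Y k)).
Local Notation J k := (eideal Env (Y k)).
Local Notation ZY := (map_aug F (yres_aug fI)).

Let eta k : pair_hom (Y k) (pd_base (env Env (Y k))) := eta adj (Y k).

Definition zface k i : pd_hom (env Env (Y k.+1)) (env Env (Y k)) :=
  fmap Env (yface fI k i : @hom pair_cat (Y k.+1) (Y k)).

Definition zbd k : {additive E k.+1 -> E k} :=
  (@bd (aug_group ZY) (@dX ZY) k : {additive aug_group ZY k.+1 -> aug_group ZY k}).

Lemma zface_eta k i x : zface k i (eta k.+1 x) = eta k (yface fI k i x).
Proof.
by have := unit_nat adj (yface fI k i : @hom pair_cat (Y k.+1) (Y k)) => /(congr1 (fun h : pair_hom _ _ => h x)).
Qed.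

Lemma zbdE k z : zbd k z = alt k.+1 (fun i => zface k i z).
Proof. by []. Qed.

Lemma zbd_eta k x : zbd k (eta k.+1 x) = eta k (ybd k x).
Proof.
transitivity (alt k.+1 (fun i => eta k (yface fI k i x))).
  by apply: eq_alt => i _; apply: zface_eta.
by apply: esym; apply: raddf_alt.
Qed.

Lemma zbd_zbd k z : zbd k (zbd k.+1 z) = 0.
Proof. by apply: (@bd_bd (aug_group ZY)); apply: dX_dX. Qed.

Lemma zbd_ideal k z : J k.+1 z -> J k (zbd k z).
Proof.
move=> Jz; rewrite zbdE; apply: alt_closed => [|x y|i]; first exact: ideal0.
  exact: idealB.
exact: pair_homP.
Qed.

(** An exponent that is at least N makes a! divisible by N; only the box of exponents below N
    remains. *)
Lemma cap_support N : (0 < N)%N -> exists l : seq expo,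
  forall a, cap N a != 1%N -> a \in l.
Proof.
move=> N_gt0; exists [seq [ffun i => val (b i)] | b : {ffun 'I_r -> 'I_N}] => a capN.
have lt_aN i : (a i < N)%N.
  rewrite ltnNge; apply: contra capN => le_Na; rewrite /cap.
  have /gcdn_idPl-> : (N %| efact a)%N.
    apply: (@dvdn_trans (a i)`!); last by rewrite /efact (bigD1 i) //= dvdn_mulr.
    by apply: dvdn_fact; rewrite N_gt0.
  by rewrite divnn N_gt0.
apply/imageP; exists [ffun i => Ordinal (lt_aN i)] => //.
by apply/ffunP => i; rewrite !ffunE.
Qed.

(** Clearing the denominator moves the cycle into G_N, where it bounds. The filler is divisible by N
    in the envelope, and torsion-freeness cancels N. Level k+2 has simplicial degree k+1, so this
    covers all positive degrees. *)
Lemma zbd_exact_high k (z : E k.+2) : zbd k.+1 z = 0 ->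
  exists w : E k.+3, zbd k.+2 w = z.
Proof.
move=> bz; have [N [g [N_gt0 cg eta_g]]] : exists N (g : pring (Y k.+2)),
    [/\ (0 < N)%N, weighted (ypt k.+2) (cap N) g & eta k.+2 g = z *+ N].
  exact: env_free_denominator.
have bg : ybd k.+1 g = 0.
  suff : eta k.+1 (ybd k.+1 g) = 0 by apply: eta_free_inj.
  by rewrite -zbd_eta [eta _ g]eta_g raddfMn /= bz mul0rn.
have [l lP] := cap_support N_gt0.
have [||w cw bw] := @weighted_exact r A I f fI f_generates f_regular (cap N) l _ _ lP k g cg bg.
- move=> a; rewrite divn_gt0; last by rewrite gcdn_gt0 N_gt0.
  by apply: dvdn_leq => //; apply: dvdn_gcdl.
- move=> a b le_ab.
  have efact_ab : (efact a %| efact b)%N.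
    rewrite /efact; elim/big_rec2: _ => [|i m n _ mn]; first exact: dvdnn.
    by apply: dvdn_mul => //; rewrite -(bin_fact (le_ab i)) mulnCA dvdn_mulr.
  have gcd_ab : (gcdn N (efact a) %| gcdn N (efact b))%N.
    by rewrite dvdn_gcd dvdn_gcdl (dvdn_trans (dvdn_gcdr _ _) efact_ab).
  have gb_gt0 : (0 < gcdn N (efact b))%N by rewrite gcdn_gt0 N_gt0.
  rewrite /cap -(dvdn_pmul2r gb_gt0) divnK ?dvdn_gcdl //.
  rewrite -[X in (X %| _)%N](divnK (dvdn_gcdl N (efact a))).
  exact: dvdn_mul.
have [e eta_w] := weighted_lift adj (@ypointP r A I f fI k.+3) cw.
exists e; apply/eqP; rewrite -subr_eq0; apply/eqP.
apply: (env_free_torsion_free adj N_gt0); rewrite mulrnBl -raddfMn /= -eta_w.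
by rewrite [zbd _ _]zbd_eta bw [X in X - _]eta_g subrr.
Qed.

Lemma zbd0 z : zbd 0 z = zface 0 0 z.
Proof. by rewrite zbdE altSl alt0 subr0. Qed.

Let f_span x : I x -> exists b, x = \sum_i f i * b i.
Proof. by move/f_generates; rewrite generated_span. Qed.

Let zgamma k n i : egamma n (eta k (ypt k i)) = zface k 0 (egamma n (eta k.+1 (ypt k.+1 i))).
Proof.
rewrite [RHS](pd_homP (zface k 0)); last exact/pair_homP/ypointP.
by rewrite zface_eta yface_point.
Qed.

Let image0 : subring (E 0).
Proof.
apply: (@Subring (E 0) (fun e => exists z, zface 0 0 z = e)).
- by exists 1; rewrite rmorph1.
- by move=> _ _ [x <-] [y <-]; exists (x - y); rewrite rmorphB.
- by move=> _ _ [x <-] [y <-]; exists (x * y); rewrite rmorphM.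
Defined.

(** [Y 0] need not be free, so no basis of its envelope is available. Generators suffice: elements
    of A and divided powers of the f_i lift to level 1, so the image of the face is a subring to
    which [env_generation] applies. *)
Let generation0 : (forall e, image0 e) /\ forall e, J 0 e ->
    generated (fun z => exists i n, z = egamma n.+1 (eta 0 (f i))) e.
Proof.
apply: (env_generation (adj := adj) (P := Y 0) fI f_span) => [p|n i].
  have [q _ bq] := @yres_exact_ring _ _ _ _ fI 0 p Logic.I Logic.I.
  exists (eta 1 q); rewrite -zbd0 zbd_eta; congr (eta 0 _); exact: bq.
by exists (egamma n (eta 1 (ypt 1 i))); rewrite -zgamma.
Qed.

Lemma zbd_surj (e : E 0) : exists z, zbd 0 z = e.
Proof.
by have [z ze] := generation0.1 e; exists z; rewrite zbd0.
Qed.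

Lemma zbd_surj_ideal (e : E 0) : J 0 e -> exists2 z, J 1 z & zbd 0 z = e.
Proof.
move/generation0.2 => [n [c [s [Ss ->]]]]; elim/big_ind: _ => [|x y [u Ju <-] [v Jv <-]|i _].
- by exists 0; [apply: ideal0|rewrite raddf0].
- by exists (u + v); [apply: idealD|rewrite raddfD].
have [j [m ->]] := Ss i; have [w <-] := zbd_surj (c i).
exists (w * egamma m.+1 (eta 1 (ypt 1 j))).
  apply/idealM/(pd_ideal (gammaP (env Env (Y 1)))); exact/pair_homP/ypointP.
by rewrite !zbd0 rmorphM -zgamma.
Qed.

(** Modulo their ideals the envelope and the bar resolution agree at these levels, and the latter
    quotient is exact; so [w] can be moved into the PD-ideal by subtracting a boundary. *)
Lemma zbd_into_ideal k (w : E k.+2) : J k.+1 (zbd k.+1 w) ->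
  exists2 w', J k.+2 w' & zbd k.+1 w' = zbd k.+1 w.
Proof.
move=> Jbw; have [q Jwq] : exists q : pring (Y k.+2), J k.+2 (w - eta k.+2 q).
  exact: env_free_mod_ideal.
have Jbq : J k.+1 (eta k.+1 (ybd k.+1 q)).
  rewrite -zbd_eta; have := idealB Jbw (zbd_ideal Jwq).
  by rewrite [zbd _ (w - _)]raddfB subKr.
have Ibq : pideal (Y k.+1) (ybd k.+1 q) by apply: eta_ideal_free Jbq.
have [a Iqa] := @yres_cycle_mod_ideal _ _ _ _ fI f_generates f_regular k.+2 q Ibq.
exists (w - zbd k.+2 (eta k.+3 a)).
  rewrite zbd_eta (_ : _ - _ = (w - eta k.+2 q) + eta k.+2 (q - ybd k.+2 a)).
    by apply: idealD => //; apply: pair_homP.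
  by rewrite rmorphB addrA subrK.
by rewrite raddfB /= zbd_zbd subr0.
Qed.

Lemma zbd_exact_low (z : E 1) : zbd 0 z = 0 -> exists w, zbd 1 w = z.
Proof.
pose K0 (x : E 1) := exists t, zbd 1 t = x.
have zbd1E t : zbd 1 t = zface 1 0 t - zface 1 1 t.
  by rewrite zbdE !altSl alt0 subr0.
pose s0 : pd_hom (env Env (Y 1)) (env Env (Y 2)) :=
  fmap Env (ydgen r I 0 0 : @hom pair_cat (Y 1) (Y 2)).
have d0s0 x : zface 1 0 (s0 x) = x.
  exact: (@dX_sX ZY 0 0 (leqnn _) x).
have d1s0 x : zface 1 1 (s0 x) = x.
  exact: (@dXS_sX ZY 0 0 (leqnn _) x).
have K00 : K0 0 by exists 0; rewrite raddf0.
have K0D x y : K0 x -> K0 y -> K0 (x + y).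
  by move=> [t <-] [u <-]; exists (t + u); rewrite raddfD.
(* Multiplying a filler by the degenerate simplex on [a] multiplies both of its faces by [a]. *)
have K0M a x : K0 x -> K0 (a * x).
  move=> [t <-]; exists (s0 a * t); rewrite !zbd1E !rmorphM d0s0 d1s0.
  by rewrite mulrBr.
pose K : ideal (E 1) := Ideal K00 K0D K0M.
have K_gamma n x x' : J 1 x -> J 1 x' -> K (x - x') ->
    K (egamma n x - egamma n x').
  move=> Jx Jx' [t bt]; have [|t' Jt' bt'] := @zbd_into_ideal 0 t.
    by rewrite bt; apply: idealB.
  rewrite bt zbd1E in bt'.
  (* A 1-simplex in the PD-ideal with faces [x] and x'. Its divided powers connect those of [x] and
     x', because faces are PD-morphisms. *)
  pose u := s0 (x' - zface 1 1 t') + t'.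
  have Ju : J 2 u.
    apply: idealD => //; apply: pair_homP; apply: idealB => //.
    exact: pair_homP.
  have d0u : zface 1 0 u = x by rewrite rmorphD d0s0 addrAC -addrA bt' addrC subrK.
  have d1u : zface 1 1 u = x' by rewrite rmorphD d1s0 subrK.
  exists (egamma n u); rewrite zbd1E; congr (_ - _).
    by rewrite -[in RHS]d0u; apply: (pd_homP (zface 1 0)).
  by rewrite -[in RHS]d1u; apply: (pd_homP (zface 1 1)).
have [Q [p [pK p_lift]]] := @quotient_pd (env Env (Y 1)) K K_gamma.
have K_eta q : ybd 0 q = 0 -> K (eta 1 q).
  move=> bq; have [t _ bt] := @yres_exact_ring _ _ _ _ fI 1 q Logic.I bq.
  by exists (eta 2 t); rewrite zbd_eta; congr (eta 1 _).
(* A set-theoretic section of the augmentation that maps I into the ideal. It becomes a homomorphism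
   modulo K, since two lifts of one element differ by a boundary. *)
have /choice[g gP] a : exists q : pring (Y 1), ybd 0 q = a /\ (I a -> pideal (Y 1) q).
  have [Ia|nIa] := EM (I a).
    have [q Iq bq] := @yres_exact_ideal _ _ _ _ fI f_generates f_regular 0 a Ia Logic.I.
    by exists q.
  by have [q _ bq] := @yres_exact_ring _ _ _ _ fI 0 a Logic.I Logic.I; exists q.
have ybd0 q : ybd 0 q = yface fI 0 0 q.
  transitivity (alt 1 (fun i => yface fI 0 i q)); first by [].
  by rewrite altSl alt0 subr0.
have bg a : ybd 0 (g a) = a by case: (gP a).
have [||||h hE] := p_lift (Y 0) (fun a => eta 1 (g a)).
- move=> a b; rewrite -!rmorphB; apply: K_eta.
  rewrite (raddfB (ybd 0)) (raddfB (ybd 0)) !bg.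
  exact: subrr.
- move=> a b; rewrite -rmorphM -rmorphB; apply: K_eta.
  rewrite (raddfB (ybd 0)) bg [X in _ - X]ybd0 rmorphM -!ybd0 !bg.
  exact: subrr.
- rewrite -(rmorph1 (eta 1)) -rmorphB; apply: K_eta.
  rewrite (raddfB (ybd 0)) bg [X in _ - X]ybd0 rmorph1.
  exact: subrr.
- move=> a Ia; exists (eta 1 (g a)); last by rewrite subrr; apply: ideal0.
  by apply: pair_homP; case: (gP a) => _; apply.
have [H HE] := env_lift adj (D := Q) h.
(* Thus the quotient map by K factors through the augmentation, and whatever the augmentation kills
   lies in K. *)
have Hp (e : E 1) : H (zface 0 0 e) = p e.
  apply: (@env_ext Env adj (Y 1) Q (pd_hom_comp H (zface 0 0)) p) => q.
  rewrite -[LHS]/(H (zface 0 0 (eta 1 q))) zface_eta -ybd0 HE hE.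
  apply/eqP; rewrite -subr_eq0 -rmorphB; apply/eqP/pK.
  by rewrite -rmorphB; apply: K_eta; rewrite raddfB /= bg subrr.
move=> bz; apply/pK; rewrite -Hp -zbd0 bz.
by rewrite rmorph0.
Qed.

Lemma env_yres_exact b : aug_exact ZY b.
Proof.
have ring_exact : forall k (z : E k), cycle zbd z -> exists w, zbd k w = z.
  case=> [|[|k]] z; first by move=> _; apply: zbd_surj.
    exact: zbd_exact_low.
  exact: zbd_exact_high.
case: b => k z Vz cz; last by have [w bw] := ring_exact k z cz; exists w.
case: k z Vz cz => [|k] z Vz cz; first exact: zbd_surj_ideal.
have [w bw] := ring_exact k.+1 z cz.
by have [|w' Jw' bw'] := @zbd_into_ideal k w; [rewrite bw|exists w' => //; rewrite -bw].
Qed.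
End EnvelopeExact.

(** * Simplicial resolutions *)

(** For i at most n this is the surjection that takes the value i twice; the minimum only matters
    for larger i, where it keeps values in range. *)
Lemma monotone_codegen n (i : nat) :
  monotone [ffun j : 'I_n.+2 => inord (minn n (unbump i j)) : 'I_n.+1].
Proof.
apply/forallP => j; apply/forallP => k; apply/implyP => le_jk.
by rewrite !ffunE !inordK ?ltnS ?geq_minl // /unbump; lia.
Qed.

Definition codegen n i : simplex_hom n.+1 n := Sub _ (monotone_codegen n i).
Definition cof n i : simplex_hom n n.+1 := coface (inord i).

Lemma cofE n i j : (i <= n.+1)%N -> val (val (cof n i) j) = bump i j.
Proof. by move=> le_in; rewrite /= ffunE /= inordK. Qed.

Lemma codegenE n i j : (i <= n)%N -> val (val (codegen n i) j) = unbump i j.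
Proof.
move=> le_in; rewrite /= ffunE inordK ?ltnS ?geq_minl //.
by apply/minn_idPr; have := ltn_ord j; rewrite /unbump; lia.
Qed.

Lemma simplex_hom_ext m n (a b : simplex_hom m n) :
  (forall j, val (val a j) = val (val b j)) -> a = b.
Proof. by move=> eq_ab; apply/val_inj/ffunP => j; apply/val_inj/eq_ab. Qed.

Lemma simplex_compE m n p (b : simplex_hom n p) (a : simplex_hom m n) j :
  val (simplex_comp b a) j = val b (val a j).
Proof. by rewrite ffunE. Qed.

Lemma cof_cof n i j : (i < j)%N -> (j <= n.+2)%N ->
  simplex_comp (cof n.+1 j) (cof n i) = simplex_comp (cof n.+1 i) (cof n j.-1).
Proof.
move=> lt_ij le_jn; apply: simplex_hom_ext => x.
by rewrite !simplex_compE !cofE; try lia; rewrite /bump; lia.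
Qed.

Lemma codegen_cof_lt n i j : (i < j)%N -> (j <= n.+1)%N ->
  simplex_comp (codegen n.+1 j) (cof n.+1 i) = simplex_comp (cof n i) (codegen n j.-1).
Proof.
move=> lt_ij le_jn; apply: simplex_hom_ext => x.
by rewrite !simplex_compE codegenE ?cofE ?codegenE; try lia; rewrite /bump /unbump; lia.
Qed.

Lemma codegen_cof n j : (j <= n)%N ->
  simplex_comp (codegen n j) (cof n j) = simplex_id n.
Proof.
move=> le_jn; apply: simplex_hom_ext => x.
rewrite simplex_compE codegenE // cofE; last by lia.
by rewrite [RHS]/= ffunE /bump /unbump; lia.
Qed.

Lemma codegen_cofS n j : (j <= n)%N ->
  simplex_comp (codegen n j) (cof n j.+1) = simplex_id n.
Proof.
move=> le_jn; apply: simplex_hom_ext => x.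
rewrite simplex_compE codegenE // cofE; last by lia.
by rewrite [RHS]/= ffunE /bump /unbump; lia.
Qed.

Lemma codegen_cof_gt n i j : (j.+1 < i)%N -> (i <= n.+2)%N ->
  simplex_comp (codegen n.+1 j) (cof n.+1 i) = simplex_comp (cof n i.-1) (codegen n j).
Proof.
move=> lt_ji le_in; apply: simplex_hom_ext => x.
by rewrite !simplex_compE codegenE ?cofE ?codegenE; try lia; rewrite /bump /unbump; lia.
Qed.

(** [sphere] constrains all faces of smaller dimension; this factorization reduces them to faces of
    codimension one. *)
Lemma simplex_hom_factor m n (a : simplex_hom m n.+1) : (m < n.+1)%N ->
  exists i (b : simplex_hom m n), a = simplex_comp (coface i) b.
Proof.
move=> lt_mn; have [i ai] : exists i, forall j, val a j != i.
  apply: contrapT => /forallNP all_i.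
  have a_surj i : i \in codom (val a).
    apply: contrapT => ni; apply: (all_i i) => j; apply: contra_notN ni => /eqP<-.
    exact: codom_f.
  have := max_card (mem (codom (val a))).
  have := leq_image_card (val a) (mem 'I_m.+1); rewrite card_ord.
  have -> : #|image (val a) (mem 'I_m.+1)| = n.+2.
    by rewrite (eq_card (B := 'I_n.+2)) ?card_ord // => i; rewrite a_surj.
  by lia.
have /choice[b bE] j : exists k, val a j = lift i k.
  have ai' : i != val a j by rewrite eq_sym.
  by have [k -> _] := unlift_some ai'; exists k.
have b_mono : monotone [ffun j => b j].
  apply/forallP => j; apply/forallP => k; apply/implyP => le_jk; rewrite !ffunE.
  have /forallP/(_ j)/forallP/(_ k)/implyP/(_ le_jk) := valP a.
  by rewrite !bE /= leq_bump2.
exists i, (Sub _ b_mono); apply: simplex_hom_ext => j.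
by rewrite simplex_compE bE /= !ffunE.
Qed.

Section AugmentedResolution.
Variables (C : category) (X : simplicial C) (P : C).
Variable u : nat_trans X (const_functor _ P).

Definition aug_level k : C := if k is n.+1 then X n else P.

Definition aug_face k i : hom (aug_level k.+1) (aug_level k) :=
  match k return hom (aug_level k.+1) (aug_level k) with
  | 0 => u 0%N
  | n.+1 => @fmap _ _ X n.+1 n (cof n i)
  end.

Definition aug_dgen k i : hom (aug_level k.+1) (aug_level k.+2) :=
  @fmap _ _ X k k.+1 (codegen k i).

Let XM a b c (g : simplex_hom b a) (h : simplex_hom c b) :
  compose (@fmap _ _ X b c h) (@fmap _ _ X a b g) = @fmap _ _ X a c (simplex_comp g h).
Proof. by rewrite -fmapM. Qed.

Definition aug_of : aug_simplicial C.
Proof.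
apply: (@AugSimplicial C aug_level aug_face aug_dgen).
- move=> [|k] i j lt_ij le_jk; last by rewrite /= !XM cof_cof.
  by rewrite !(ncompP u).
- by move=> k i j lt_ij le_jk; rewrite /= !XM codegen_cof_lt.
- by move=> k j le_jk; rewrite /= XM codegen_cof //; apply: fmap1.
- by move=> k j le_jk; rewrite /= XM codegen_cofS //; apply: fmap1.
- by move=> k i j lt_ji le_ik; rewrite /= !XM codegen_cof_gt.
Defined.
End AugmentedResolution.

Lemma aug_nexact b (X : aug_simplicial pair_cat) : aug_exact X b ->
  forall k, @nexact_at (aug_group X) (@dX X) (fun k => @part b (X k)) k.
Proof.
move=> ex; apply: exact_nexact ex => *.
- exact: dX_dX.
- exact: dX_sX_lt.
- exact: dX_sX.
- exact: dXS_sX.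
- exact: dX_sX_gt.
- exact: partB.
- exact: part_hom.
- exact: part_hom.
Qed.

Lemma aug_exact_of_nexact b (X : aug_simplicial pair_cat) :
  (forall k, @nexact_at (aug_group X) (@dX X) (fun k => @part b (X k)) k) ->
  aug_exact X b.
Proof.
move=> nex; apply: nexact_exact nex => *.
- exact: dX_dX.
- exact: dX_sX_lt.
- exact: dX_sX.
- exact: dXS_sX.
- exact: dX_sX_gt.
- exact: partB.
- exact: part0.
- exact: part_hom.
- exact: part_hom.
Qed.

Lemma aug_filler b (X : aug_simplicial pair_cat) k (x : nat -> pring (X k.+1)) :
  aug_exact X b -> (forall i, part b (x i)) ->
  (forall i j, (i < j)%N -> (j <= k.+1)%N -> dX X k i (x j) = dX X k j.-1 (x i)) ->
  exists2 w : pring (X k.+2), part b w & forall i, (i <= k.+1)%N -> dX X k.+1 i w = x i.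
Proof.
move=> /aug_nexact nex; apply: (@moore_filler (aug_group X)) nex => *.
- exact: dX_dX.
- exact: dXS_sX.
- exact: dX_sX_gt.
- exact: partB.
- exact: part0.
- exact: part_hom.
- exact: part_hom.
Qed.

Lemma const_simplex (C : category) (c P : C) m n (a : simplex_hom m n) (w : hom c P) :
  @fmap _ _ (comp_functor (hom_functor c) (const_functor (opposite simplex_cat) P))
    n m a w = w.
Proof. exact: comp1c. Qed.

(** * From weak equivalence to exactness *)

Section WeakToExact.
Variables (X : simplicial pair_cat) (P : pair_cat) (u : nat_trans X (const_functor _ P)).
Hypothesis u_equiv : animated_equivalence std_pair u.
Local Notation G := (aug_of u).

(* The ring and the ideal of a pair are represented by (Z[x], 0) and (Z[y], (y)). *)
Lemma part_represented b : exists (mn : nat * nat)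
    (ev : forall Q : ring_pair, pair_hom (std_pair mn) Q -> pring Q),
  [/\ forall Q h, part b (ev Q h), forall Q (h h' : pair_hom (std_pair mn) Q),
        ev Q h = ev Q h' -> h = h',
      forall (Q Q' : ring_pair) (g : pair_hom Q Q') h, ev Q' (pair_comp g h) = g (ev Q h)
    & forall (Q : ring_pair) (x : pring Q), part b x -> exists h, ev Q h = x].
Proof.
case: b.
  exists (0%N, 1%N), (fun Q h => h (yvar 'I_0 (ord0 : 'I_1))); split=> //.
  - by move=> Q h; apply/pair_homP/yvar_ideal.
  - move=> Q h h' eq_h; apply: free_pair_ext => -[[|i] lt_i] //.
    by rewrite (_ : Ordinal lt_i = ord0) //; apply: val_inj.
  move=> Q x Qx; pose f0 (i : 'I_0) : pring Q := 0.
  by exists (@free_lift 'I_0 'I_1 Q f0 (fun=> x) (fun=> Qx)); rewrite free_lift_yvar.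
exists (1%N, 0%N), (fun Q h => h (xvar 'I_0 (ord0 : 'I_1))); split=> //.
  move=> Q h h' eq_h; apply: free_pair_ext => -[[|i] lt_i] //.
  by rewrite (_ : Ordinal lt_i = ord0) //; apply: val_inj.
move=> Q x _; pose g0 (i : 'I_0) : pring Q := 0.
have g0Q i : pideal Q (g0 i) by case: i.
by exists (@free_lift 'I_1 'I_0 Q (fun=> x) g0 g0Q); rewrite free_lift_xvar.
Qed.

(** The target is constant, so surjectivity on pi_0 is surjectivity of the augmentation. A
    normalized cycle with zero augmentation is a sphere at the base point 0 whose image is trivial,
    and injectivity on pi_n makes it homotopic to 0. *)
Lemma weak_aug_exact b : aug_exact G b.
Proof.
have [mn [ev [evP ev_inj evM ev_surj]]] := part_represented b.
have [surj0 inj _] := u_equiv mn.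
apply: aug_exact_of_nexact => -[|n] z bz dz0.
  have [y yz] := ev_surj P z bz.
  have [x [w wE]] := surj0 y.
  have wx := etrans (esym (const_simplex (coface ord0) w)) (wE ord0).
  have wy := etrans (esym (const_simplex (coface ord_max) w)) (wE ord_max).
  exists (ev _ x); first exact: evP.
  split=> [|i]; last by lia.
  rewrite -yz -(etrans (esym wx) wy); apply: esym; exact: (evM _ _ (u 0%N) x).
have [s0 s0E] := ev_surj (X n) z bz.
have [t0 t0E] := ev_surj (X n) 0 (part0 _ _).
have [x0 x0E] := ev_surj (X 0%N) 0 (part0 _ _).
have [w0 w0E] := ev_surj P 0 (part0 _ _).
pose S := comp_functor (hom_functor (std_pair mn)) X.
have map_ev m m' (a : simplex_hom m m') (h : S m') :
    ev (X m) (@fmap _ _ S m' m a h) = hom_fun (@fmap _ _ X m' m a) (ev (X m') h).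
  exact: evM.
have degen0 m : ev (X m) (degen (X := S) x0 m) = 0.
  by rewrite map_ev x0E raddf0.
have sphere0 (h : S n) : (forall m (a : simplex_hom m n), (m < n)%N ->
    hom_fun (@fmap _ _ X n m a) (ev (X n) h) = 0) -> sphere (X := S) x0 h.
  by move=> h0 m a lt_mn; apply: ev_inj; rewrite map_ev h0 // degen0.
have face0 m (a : simplex_hom m n) : (m < n)%N -> hom_fun (@fmap _ _ X n m a) z = 0.
  case: n z bz dz0 s0 s0E t0 t0E a {sphere0} => [//|n] z bz dz0 s0 s0E t0 t0E a lt_mn.
  have [i [c ->]] := simplex_hom_factor a lt_mn.
  rewrite (_ : @fmap _ _ X n.+1 m _ = compose (@fmap _ _ X n m c) (@fmap _ _ X n.+1 n (coface i))).
    rewrite hom_fun_comp -[coface i]/(coface i) -(inord_val i).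
    by rewrite [X in hom_fun _ X](dz0 i _) ?raddf0 // -ltnS ltn_ord.
  by rewrite -fmapM.
have aug0 : hom_fun (u n) z = 0.
  case: n z bz dz0 s0 s0E t0 t0E {sphere0 face0} => [|n] z bz dz0 s0 s0E t0 t0E.
    exact: (dz0 0%N).
  have := ncompP u (cof n 0 : @hom (opposite simplex_cat) n.+1 n).
  rewrite [RHS]comp1c => <-; rewrite hom_fun_comp.
  by rewrite [X in hom_fun _ X](dz0 0%N) // raddf0.
have ev_u m (h : S m) : ev P (whisker (hom_functor (std_pair mn)) u m h) =
    hom_fun (u m) (ev (X m) h) by exact: evM.
have [|||w wE] := inj x0 n s0 t0.
- by apply: sphere0 => m a lt_mn; rewrite s0E face0.
- by apply: sphere0 => m a lt_mn; rewrite t0E raddf0.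
- exists w0 => i; apply: ev_inj; rewrite [X in ev P X]const_simplex w0E.
  case: ifP => _; first by rewrite [X in ev P X]const_simplex ev_u x0E raddf0.
  by case: ifP => _; rewrite ev_u ?s0E ?t0E ?raddf0.
(* Only the face of index n is nonzero and it equals [z], so the boundary of this simplex is [z] up
   to the sign of n. *)
pose w1 := ev (X n.+1) w.
have dw i : (i <= n.+1)%N -> dX G n.+1 i w1 = if i == n then z else 0.
  move=> le_in; have := congr1 (ev (X n)) (wE (inord i)).
  rewrite map_ev inordK // -[LHS]/(dX G n.+1 i w1) => ->.
  have [lt_in|ge_in] := ltnP i n; first by rewrite ltn_eqF // degen0.
  by case: ifP => _; rewrite ?s0E ?t0E.
have bw : @bd (aug_group G) (@dX G) n.+1 w1 = z *~ (-1) ^+ n.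
  rewrite /bd 2!altSr (@eq_alt _ _ _ (fun=> 0)) => [|i lt_in].
    by rewrite alt_const0 add0r !dw // eqxx gtn_eqF // mul0rz addr0.
  by rewrite dw ?ltn_eqF //; lia.
apply: (@normalize_filler (aug_group G) (@dX G) (@sX G) (fun k => @part b (G k))
  _ _ _ _ _ _ _ _ n z (w1 *~ (-1) ^+ n)) => //.
- exact: dX_dX.
- exact: dX_sX_lt.
- exact: dX_sX.
- exact: dXS_sX.
- exact: dX_sX_gt.
- by move=> *; apply: partB.
- by move=> *; apply: part_hom.
- by move=> *; apply: part_hom.
- rewrite -signr_odd; case: (odd n); last exact: evP.
  by rewrite expr1 mulrNz mulr1z -sub0r; apply: partB; [apply: part0|apply: evP].
by rewrite raddfMz /= bw -mulrzA -expr2 sqrr_sign mulr1z.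
Qed.
End WeakToExact.

(** * Morphisms out of the standard PD-pairs *)

Section EnvelopeHom.
Variables (Env : functor pair_cat pd_pair_cat) (adj : left_adjoint Env forget_pd).
Variables (m n : nat).
Local Notation std := (std_pd_pair Env (m, n)).
Local Notation is_y v := (if v is inr _ then true else false).

Definition std_var (v : 'I_m + 'I_n) : pring (free_pair 'I_m 'I_n) :=
  match v with inl i => xvar 'I_n i | inr j => yvar 'I_m j end.

(** Coordinates on the hom-set: by adjunction a morphism is determined by [m] ring elements and [n]
    ideal elements, which may be arbitrary. Lifting and filling can thus be done one variable at a
    time. *)
Definition std_eval (Q : pd_pair_cat) (h : hom std Q) v : pring (forget_pd Q) :=
  hom_fun (fmap forget_pd h) (eta adj (std_pair (m, n)) (std_var v)).

Lemma std_eval_part (Q : pd_pair_cat) (h : hom std Q) v :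
  part (is_y v) (std_eval h v).
Proof.
by case: v => [//|j]; apply/(pair_homP (pd_fun h))/pair_homP/yvar_ideal.
Qed.

Lemma std_evalM (Q Q' : pd_pair_cat) (g : hom Q Q') (h : hom std Q) v :
  std_eval (compose g h) v = hom_fun (fmap forget_pd g) (std_eval h v).
Proof. by []. Qed.

Lemma std_eval_inj (Q : pd_pair_cat) (h h' : hom std Q) :
  std_eval h =1 std_eval h' -> h = h'.
Proof.
move=> eq_h; apply/pd_hom_ext/pair_hom_ext/(env_ext (adj := adj)).
suff : pair_comp (pd_fun h) (eta adj _) = pair_comp (pd_fun h') (eta adj _).
  by move=> e x; have := congr1 (fun g : pair_hom _ _ => g x) e.
by apply: free_pair_ext => [i|j]; [exact: (eq_h (inl i))|exact: (eq_h (inr j))].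
Qed.

Lemma std_eval_surj (Q : pd_pair_cat) (x : 'I_m + 'I_n -> pring (forget_pd Q)) :
  (forall v, part (is_y v) (x v)) -> exists h : hom std Q, std_eval h =1 x.
Proof.
move=> xP; pose g := free_lift (Q := pd_base Q) (fun i => x (inl i))
  (fun j => xP (inr j) : pideal (pd_base Q) (x (inr j))).
have [h hE] := env_lift adj (D := Q) g.
exists h => -[i|j]; first exact: etrans (hE _) (free_lift_xvar _ _ _).
exact: etrans (hE _) (free_lift_yvar _ _ _).
Qed.

Variable Z : aug_simplicial pd_pair_cat.
Hypothesis Z_exact : forall b, aug_exact (map_aug forget_pd Z) b.

Lemma std_hom_surj (y : hom std (Z 0%N)) :
  exists x : hom std (Z 1%N), compose (dface Z 0 0) x = y.
Proof.
have /choice[x xP] v : exists x : pring (forget_pd (Z 1%N)),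
    part (is_y v) x /\ hom_fun (fmap forget_pd (dface Z 0 0)) x = std_eval y v.
  have [x bx <-] := @Z_exact (is_y v) 0 _ (std_eval_part y v) Logic.I.
  by exists x; split=> //; rewrite /bd altSl alt0 subr0.
have [h hE] := std_eval_surj (fun v => (xP v).1).
exists h; apply: std_eval_inj => v.
by rewrite std_evalM hE; case: (xP v).
Qed.

Lemma std_hom_filler k (x : nat -> hom std (Z k.+1)) :
  (forall i j, (i < j)%N -> (j <= k.+1)%N ->
    compose (dface Z k i) (x j) = compose (dface Z k j.-1) (x i)) ->
  exists w : hom std (Z k.+2), forall i, (i <= k.+1)%N -> compose (dface Z k.+1 i) w = x i.
Proof.
move=> x_compat.
have /choice[w wP] v : exists w : pring (forget_pd (Z k.+2)), part (is_y v) w /\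
    forall i, (i <= k.+1)%N ->
      hom_fun (fmap forget_pd (dface Z k.+1 i)) w = std_eval (x i) v.
  have [|i j lt_ij le_jk|w bw wE] := @aug_filler (is_y v) (map_aug forget_pd Z) k
    (fun i => std_eval (x i) v) (@Z_exact _).
  - by move=> i; apply: std_eval_part.
  - by have := congr1 (fun h => std_eval h v) (x_compat i j lt_ij le_jk).
  - by exists w.
have [h hE] := std_eval_surj (fun v => (wP v).1).
exists h => i le_ik; apply: std_eval_inj => v.
by rewrite std_evalM hE; case: (wP v) => _; apply.
Qed.
End EnvelopeHom.

(** * From exactness to weak equivalence *)

Section ExactToWeak.
Variables (Env : functor pair_cat pd_pair_cat) (adj : left_adjoint Env forget_pd).
Variables (P : pair_cat) (R : free_resolution P).
Hypothesis R_exact : forall b,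
  aug_exact (map_aug (pd_ring_functor Env) (aug_of (augmentation R))) b.

(** Since the target is constant, its spheres of positive dimension are degenerate and its
    homotopies are equalities. Everything then follows from lifting along the augmentation and from
    filling compatible boundaries. *)
Lemma exact_animated_equivalence :
  animated_equivalence (std_pd_pair Env) (animated_to_classical Env R).
Proof.
case=> m n; pose std := std_pd_pair Env (m, n).
pose Z := map_aug Env (aug_of (augmentation R)).
have Z_exact b : aug_exact (map_aug forget_pd Z) b := @R_exact b.
pose S := comp_functor (hom_functor std) (animated_pd_envelope Env R).
have faceE k (i : 'I_k.+2) (w : S k.+1) : face i w = compose (dface Z k.+1 i) w.
  by rewrite /face /= /cof inord_val.
have SM k l p (a : simplex_hom k l) (b : simplex_hom p k) (s : S l) :
    @fmap _ _ S k p b (@fmap _ _ S l k a s) = @fmap _ _ S l p (simplex_comp a b) s.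
  exact: (esym (congr1 (fun g => g s) (@fmapM _ _ S l k p b a))).
have degenM x k p (b : simplex_hom p k) :
    @fmap _ _ S k p b (degen (X := S) x k) = degen x p.
  rewrite SM; congr (@fmap _ _ S _ _ _ x).
  by apply: simplex_hom_ext => j; rewrite /= !ffunE.
have aug_nat k p (b : simplex_hom p k) (s : S k) :
    compose (fmap Env (augmentation R p)) (@fmap _ _ S k p b s) =
    compose (fmap Env (augmentation R k)) s.
  transitivity (compose (compose (fmap Env (augmentation R p)) (fmap Env
    (@fmap (opposite simplex_cat) pair_cat (res R) k p b))) s); first exact: compA.
  by rewrite -fmapM (ncompP (augmentation R)) comp1c.
pose T := comp_functor (hom_functor std)
  (comp_functor Env (const_functor (opposite simplex_cat) P)).
have constE k l (a : simplex_hom k l) (w : T l) : @fmap _ _ T l k a w = w.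
  transitivity (compose (fmap Env (idc P)) w); first by [].
  by rewrite fmap1 comp1c.
have faceT k (i : 'I_k.+2) (w : T k.+1) : face i w = w by apply: constE.
have degenT k (w : T 0%N) : degen w k = w by apply: constE.
split.
- move=> y; have [x xE] := std_hom_surj adj Z_exact y; exists x, y => i.
  rewrite [LHS]faceT; by case: ifP => // _; apply: esym xE.
- move=> x k s t s_sph t_sph [w wE].
  (* The faces k and k+1 of [w] are the images of s and t, and in a constant object both equal
     [w]. *)
  have st : compose (fmap Env (augmentation R k)) s =
      compose (fmap Env (augmentation R k)) t.
    have := wE (inord k); rewrite [LHS]faceT inordK // ltnn.
    case: eqP => // _ ws; have := wE ord_max; rewrite [LHS]faceT ltnNge leqnSn /=.
    by case: eqP => [|_ wt]; [lia|apply: etrans (esym ws) wt].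
  have [|h hE] := @std_hom_filler _ adj m n Z Z_exact k
    (fun i => if (i < k)%N then degen (X := S) x k else if i == k then s else t).
    (* For k = 0 compatibility concerns the augmentations, which agree by [st]. For larger k all
       faces of the prescribed simplices are degenerate at x. *)
    case: k s t s_sph t_sph st {w wE} => [|k] s t s_sph t_sph st i j lt_ij le_jk.
      have [-> ->] : i = 0%N /\ j = 1%N by lia.
      exact: esym st.
    have z_face p q : compose (dface Z k.+1 q) (if (p < k.+1)%N then degen (X := S) x k.+1
        else if p == k.+1 then s else t) = degen (X := S) x k.
      case: ifP => _; first exact: (degenM _ _ _ (cof k q)).
      by case: ifP => _; [exact: (s_sph _ (cof k q))|exact: (t_sph _ (cof k q))].
    by rewrite !z_face.
  by exists h => i; rewrite faceE hE // -ltnS.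
move=> x [|k] t t_sph.
  have [s sE] := std_hom_surj adj Z_exact t; exists s => //; exists t => i.
  by rewrite [LHS]faceT; case: ifP => // _; apply: esym sE.
(* In positive dimension the sphere condition includes the vertices, and a simplex of a constant
   object equals any of its vertices. *)
have tE : t = compose (fmap Env (augmentation R 0%N)) x.
  have vertex_mono : monotone [ffun _ : 'I_1 => ord0 : 'I_k.+2].
    by apply/forallP => i; apply/forallP => j; rewrite !ffunE implybT.
  have := t_sph 0%N (Sub _ vertex_mono) isT.
  by rewrite [LHS]constE [RHS]degenT.
exists (degen (X := S) x k.+1); first by move=> p a _; apply: degenM.
exists t => i; rewrite [LHS]faceT; case: ifP => _.
  by rewrite [RHS]degenT.
case: ifP => // _; rewrite tE; apply/esym/aug_nat.
Qed.
End ExactToWeak.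

Theorem theorem1p4 (Env : functor pair_cat pd_pair_cat)
  (Env_adjoint : left_adjoint Env forget_pd)
  (A : comPzRingType) (I : ideal A) (r : nat) (f : 'I_r -> A)
  (f_generates : forall x, I x <-> generated (fun y => exists i, y = f i) x)
  (f_regular : koszul_regular f)
  (R : free_resolution (RingPair I)) :
  animated_equivalence (std_pd_pair Env) (animated_to_classical Env R).
Proof.
have fI i : I (f i) by apply/f_generates/generated_mem; exists i.
have yres_free k : exists V W : choiceType,
    isomorphic (yres_aug fI k.+1) (free_pair V W : pair_cat).
  exists (pring (yres r I k) : choiceType), 'I_r.
  by exists (idc _), (idc _); rewrite comp1c.
have yres_exact b : aug_exact (yres_aug fI) b.
  case: b; last exact: yres_exact_ring.
  exact: (yres_exact_ideal f_generates f_regular).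
apply: (exact_animated_equivalence Env_adjoint) => b.
pose F := pd_ring_functor Env.
(* The bar construction at (A, I) depends on no resolution, so it transports exactness from the
   explicit one to [R]. *)
have [_ from_bar] := @comparison F (aug_of (augmentation R)) (@res_free _ R)
  (weak_aug_exact (@res_equivalence _ R)) b.
have [to_bar _] := @comparison F (yres_aug fI) yres_free yres_exact b.
exact/from_bar/to_bar/(env_yres_exact Env_adjoint f_generates f_regular).
Qed.
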